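(* Let $d\in\mathbb{N}$, $1<p\le2$, $a>1/p$, $b\in\mathbb{R}$. There exist constants $c_0$, $c=c(a,d,p)$ and $C=C(a,b,d,p)$ such that for every $v\in\mathbb{N}$ there is $M$ with $|\Gamma(M)|\le v^{c_0}$ such that, with $\Phi_N:=\{e^{i(\mathbf{k},\mathbf{x})}\}_{\mathbf{k}\in\Gamma(M)}$, $$\varrho^{ls}_{m,v}(\mathbf{W}^{a,b}_p,\Phi_N,L_2(\mathbb{T}^d))\le C\,v^{-a+1/p-1/2}(\log v)^{(d-1)(a+b+1-2/p)+1/2}$$ for any $m\ge c\,v(\log(2v))^4$.
   Context: $\mathbb{T}^d=[0,2\pi)^d$ with normalized Lebesgue measure, $\|f\|_q=((2\pi)^{-d}\int_{\mathbb{T}^d}|f|^q)^{1/q}$, $\hat f(\mathbf{k})=(2\pi)^{-d}\int f(\mathbf{x})e^{-i(\mathbf{k},\mathbf{x})}d\mathbf{x}$. $\Gamma(M)=\{\mathbf{k}\in\mathbb{Z}^d:\prod_j\max(|k_j|,1)\le M\}$. For $\mathbf{s}\in\mathbb{N}_0^d$, $\rho(\mathbf{s})=\{\mathbf{k}\in\mathbb{Z}^d:[2^{s_j-1}]\le|k_j|<2^{s_j}\}$, $\delta_{\mathbf{s}}(f)=\sum_{\mathbf{k}\in\rho(\mathbf{s})}\hat f(\mathbf{k})e^{i(\mathbf{k},\cdot)}$, $f_j=\sum_{\|\mathbf{s}\|_1=j}\delta_{\mathbf{s}}(f)$. $\mathbf{W}^{a,b}_p:=\{f:\|f_j\|_p\le2^{-aj}\bar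 j^{(d-1)b},\ \bar j=\max(j,1),\ j\in\mathbb{N}_0\}$. $\mathcal{X}_v(\Phi_N)$ is the collection of spans of $v$-element subsets of $\Phi_N$; $LS(\xi,L)(f)$ is an element $u\in L$ minimizing $\frac1m\sum_j|f(\xi^j)-u(\xi^j)|^2$; $\varrho^{ls}_{m,v}(\mathbf{F},\Phi_N,L_2(\mathbb{T}^d)):=\inf_{\xi\in(\mathbb{T}^d)^m}\sup_{f\in\mathbf{F}}\min_{L\in\mathcal{X}_v(\Phi_N)}\|f-LS(\xi,L)(f)\|_2$.
   Formalization: The formal theorem takes v ≥ 2 instead of every v in N: for v = 1 the condition |Γ(M)| ≤ v^{c_0} = 1 forces Γ(M) to be empty, so there is no 1-element subset of Φ_N, and log v = 0, so the claim fails there. *)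

(* Defs.v *)
From Stdlib Require Import Reals Lra Lia ZArith List ClassicalEpsilon.
From Coquelicot Require Import Coquelicot.
Import ListNotations.
Open Scope R_scope.

(* Points of R^d are lists of reals of length d; frequencies in Z^d are
   lists of integers of length d. *)

Definition cexpi (t : R) : C := (cos t, sin t).

Fixpoint dotZR (k : list Z) (x : list R) : R :=
  match k, x with
  | kh :: kt, xh :: xt => IZR kh * xh + dotZR kt xt
  | _, _ => 0
  end.

Definition charac (k : list Z) (x : list R) : C := cexpi (dotZR k x).

Definition Csum {A : Type} (l : list A) (F : A -> C) : C :=
  fold_right (fun a acc => Cplus (F a) acc) (RtoC 0) l.

Definition Rsum {A : Type} (l : list A) (F : A -> R) : R :=
  fold_right (fun a acc => F a + acc) 0 l.

(* iterated integral over [0,2pi]^d (Riemann; used only on continuous functions) *)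
Fixpoint integ (d : nat) (F : list R -> R) : R :=
  match d with
  | O => F []
  | S d' => RInt (fun t => integ d' (fun xs => F (t :: xs))) 0 (2 * PI)
  end.

Definition mean (d : nat) (F : list R -> R) : R := integ d F / (2 * PI) ^ d.

Definition rpow (x y : R) : R := if Rlt_dec 0 x then Rpower x y else 0.

Definition normq (d : nat) (q : R) (g : list R -> C) : R :=
  rpow (mean d (fun x => rpow (Cmod (g x)) q)) (1 / q).

Definition fhat (d : nat) (f : list R -> C) (k : list Z) : C :=
  (mean d (fun x => Re (Cmult (f x) (Cconj (charac k x)))),
   mean d (fun x => Im (Cmult (f x) (Cconj (charac k x))))).

Definition gammaM (d : nat) (M : R) (k : list Z) : Prop :=
  length k = d /\ fold_right (fun kj acc => Rmax (IZR (Z.abs kj)) 1 * acc) 1 k <= M.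

(* dyadic blocks rho(s) = {k : [2^{s_j-1}] <= |k_j| < 2^{s_j}} *)
Definition lowb (s : nat) : Z :=
  match s with O => 0%Z | S s' => (2 ^ Z.of_nat s')%Z end.

Definition in_rho1 (s : nat) (kj : Z) : Prop :=
  (lowb s <= Z.abs kj < 2 ^ Z.of_nat s)%Z.

Definition in_rho (s : list nat) (k : list Z) : Prop := Forall2 in_rho1 s k.

Definition rho1_list (s : nat) : list Z :=
  filter (fun z => (Z.leb (lowb s) (Z.abs z) && Z.ltb (Z.abs z) (2 ^ Z.of_nat s))%bool)
    (map (fun n => (Z.of_nat n - 2 ^ Z.of_nat s)%Z)
         (seq 0 (Z.to_nat (2 * 2 ^ Z.of_nat s + 1)))).

Fixpoint rho_list (s : list nat) : list (list Z) :=
  match s with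
  | [] => [[]]
  | sj :: st => flat_map (fun z => map (cons z) (rho_list st)) (rho1_list sj)
  end.

Definition delta (d : nat) (s : list nat) (f : list R -> C) (x : list R) : C :=
  Csum (rho_list s) (fun k => Cmult (fhat d f k) (charac k x)).

Fixpoint comps (d j : nat) : list (list nat) :=
  match d with
  | O => if Nat.eqb j 0 then [[]] else []
  | S d' => flat_map (fun i => map (cons i) (comps d' (j - i))) (seq 0 (S j))
  end.

Definition fblock (d : nat) (f : list R -> C) (j : nat) (x : list R) : C :=
  Csum (comps d j) (fun s => delta d s f x).

Definition torus_continuous (d : nat) (f : list R -> C) : Prop :=
  (forall x, length x = d -> forall eps, 0 < eps -> exists delta, 0 < delta /\
     forall y, length y = d -> Forall2 (fun a b => Rabs (a - b) < delta) x y ->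
       Cmod (Cminus (f y) (f x)) < eps) /\
  (forall x i, length x = d -> (i < d)%nat ->
     f (firstn i x ++ (nth i x 0 + 2 * PI) :: skipn (S i) x) = f x).

Definition inW (d : nat) (p a b : R) (f : list R -> C) : Prop :=
  torus_continuous d f /\
  forall j : nat,
    normq d p (fblock d f j) <=
      Rpower 2 (- a * INR j) * Rpower (INR (Nat.max j 1)) ((INR d - 1) * b).

Definition trigpoly (S : list (list Z)) (c : list Z -> C) (x : list R) : C :=
  Csum S (fun k => Cmult (c k) (charac k x)).

Definition emp_err (xi : list (list R)) (f u : list R -> C) : R :=
  Rsum xi (fun y => (Cmod (Cminus (f y) (u y))) ^ 2) / INR (length xi).

Definition LS (xi : list (list R)) (S : list (list Z)) (f : list R -> C) : list R -> C :=
  trigpoly S (epsilon (inhabits (fun _ : list Z => RtoC 0))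
     (fun c => forall c', emp_err xi f (trigpoly S c) <= emp_err xi f (trigpoly S c'))).

Definition sample_points (d m : nat) (xi : list (list R)) : Prop :=
  length xi = m /\
  List.Forall (fun y : list R => (length y = d)%nat /\ List.Forall (fun t : R => 0 <= t < 2 * PI) y) xi.

(* L in X_v(Phi_N), Phi_N = {e^{i(k,x)}}_{k in Gamma(M)}: a v-element subset,
   given by its (distinct) frequencies *)
Definition v_subset (d v : nat) (M : R) (S : list (list Z)) : Prop :=
  NoDup S /\ length S = v /\ List.Forall (gammaM d M) S.

(* varrho^{ls}_{m,v}(W^{a,b}_p, Phi_N, L_2(T^d)) <= B, written out:
   inf over xi of sup over f of min over L of ||f - LS(xi,L)(f)||_2 <= B *)
Definition varrho_ls_le (d m v : nat) (M p a b B : R) : Prop :=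
  forall eps, 0 < eps ->
  exists xi, sample_points d m xi /\
    forall f, inW d p a b f ->
      exists S, v_subset d v M S /\
        normq d 2 (fun x => Cminus (f x) (LS xi S f x)) <= B + eps.

Definition card_gamma_le (d : nat) (M K : R) : Prop :=
  exists l, NoDup l /\ (forall k, In k l <-> gammaM d M k) /\ INR (length l) <= K.

(* Main.v *)
(* Write [f_j] for the dyadic layers and [A_j] for the l1 norm of the coefficients of [f_j]. Duality
   against a polynomial [g] with unimodular coefficients on the layer, and a bound for the even
   moments of [g] through a product majorant, give
   [A_j <= K 2^(j/p) (j+1)^(d(1-1/p)) ||f_j||_p].

   The sample points form a set on which all [v]-sparse polynomials with frequencies in a large cube
   have comparable empirical and L2 norms. It is extracted from a fine grid by repeated halving: the
   signs of a halving are controlled by chaining, with nets obtained from Maurey's empirical method.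
   For arbitrary [g] with coefficients [c] in the cube this implies
   [||g||_emp <= K (||c||_2 + ||c||_1 / sqrt v)].

   For [f] in the class, take all the low layers (about [v / 2] frequencies) and the [v / 2] largest
   remaining coefficients up to level [J]. The missed part has l1 norm [<= K A_n] and, by
   thresholding, l2 norm [<= K A_n / sqrt v], where [n] is the first level beyond the low ones.
   Least squares is then as good as this approximant, by the two-sided norm equivalence.

   The power [c0] does not depend on [a - 1/p], so the frequencies beyond level [J] cannot be made
   negligible in the sup norm; they are measured through the same empirical bound, using
   [|c_k| <= ||f_j||_p] for their l2 norm, and only the levels beyond a much larger [J'], which
   the discretization still covers, are estimated trivially. *)

(* The fourth power of the logarithm comes from the halving. One halving of weight [W] has
   discrepancy about [(L + 1) * sqrt (v * W * logs)], so it can be repeated until [W] is of order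
   [v * (L + 1) ^ 2 * logs]. The cube has side a power of [v], hence the chaining depth [L] and both
   logarithms in [logs] (number of points, number of frequencies) are of order [ln v]. The relative
   errors of successive halvings grow geometrically, so the last one dominates. Random choices are
   replaced by greedy ones that keep a sum of hyperbolic cosines below its average.

   The exponent of the logarithm in the rate: the low layers must fit into [v / 2] frequencies, so
   [2 ^ n] is about [v / (ln v) ^ (d - 1)], and the decay [2 ^ (- (a - 1/p) n)] loses the power
   [(d - 1)(a - 1/p)]. With the powers [d (1 - 1/p)] and [(d - 1) b] of [A_n] this adds up to
   [(d - 1)(a + b + 1 - 2/p) + (1 - 1/p)], and [1 - 1/p <= 1/2] because [p <= 2]. *)
Require Import Defs.
From Stdlib Require Import Reals Lra Lia ZArith List Permutation ClassicalEpsilon FunctionalExtensionality.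
From Coquelicot Require Import Coquelicot.
Import ListNotations.
Open Scope R_scope.
Set Bullet Behavior "Strict Subproofs".

(** * Finite sums *)

Section Rsums.
Context {A : Type}.
Implicit Types (l : list A) (F G : A -> R).

Lemma Rsum_cons a l F : Rsum (a :: l) F = F a + Rsum l F.
Proof. reflexivity. Qed.

Lemma Rsum_ext l F G : (forall a, In a l -> F a = G a) -> Rsum l F = Rsum l G.
Proof.
  induction l as [|a l IH]; intros H; [reflexivity|]. rewrite !Rsum_cons.
  rewrite H, IH; auto using in_eq, in_cons.
Qed.

Lemma Rsum_le l F G : (forall a, In a l -> F a <= G a) -> Rsum l F <= Rsum l G.
Proof.
  induction l as [|a l IH]; intros H; [apply Rle_refl|]. rewrite !Rsum_cons.
  apply Rplus_le_compat; auto using in_eq, in_cons.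
Qed.

Lemma Rsum_plus l F G : Rsum l (fun a => F a + G a) = Rsum l F + Rsum l G.
Proof. induction l as [|a l IH]; [simpl; ring|]. rewrite !Rsum_cons, IH. ring. Qed.

Lemma Rsum_scal c l F : Rsum l (fun a => c * F a) = c * Rsum l F.
Proof. induction l as [|a l IH]; [simpl; ring|]. rewrite !Rsum_cons, IH. ring. Qed.

Lemma Rsum_minus l F G : Rsum l (fun a => F a - G a) = Rsum l F - Rsum l G.
Proof. induction l as [|a l IH]; [simpl; ring|]. rewrite !Rsum_cons, IH. ring. Qed.

Lemma Rsum_const c l : Rsum l (fun _ => c) = INR (length l) * c.
Proof.
  induction l as [|a l IH]; [simpl; ring|].
  rewrite Rsum_cons, IH. simpl length. rewrite S_INR. ring.
Qed.

Lemma Rsum_zero l F : (forall a, In a l -> F a = 0) -> Rsum l F = 0.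
Proof.
  intros H. rewrite (Rsum_ext l F (fun _ => 0)) by exact H. rewrite Rsum_const. ring.
Qed.

Lemma Rsum_ge0 l F : (forall a, In a l -> 0 <= F a) -> 0 <= Rsum l F.
Proof.
  intros H. rewrite <- (Rsum_zero l (fun _ => 0)) by auto. apply Rsum_le, H.
Qed.

Lemma Rsum_le_const c l F : (forall a, In a l -> F a <= c) -> Rsum l F <= INR (length l) * c.
Proof. intros H. rewrite <- Rsum_const. apply Rsum_le, H. Qed.

Lemma Rsum_app l l' F : Rsum (l ++ l') F = Rsum l F + Rsum l' F.
Proof. induction l as [|a l IH]; simpl app; [simpl; ring|]. rewrite !Rsum_cons, IH. ring. Qed.

Lemma Rsum_perm l l' F : Permutation l l' -> Rsum l F = Rsum l' F.
Proof. induction 1; rewrite ?Rsum_cons; try lra; try congruence. Qed.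

Lemma Rsum_elem l F a : (forall b, In b l -> 0 <= F b) -> In a l -> F a <= Rsum l F.
Proof.
  intros H Ha. destruct (in_split _ _ Ha) as (l1 & l2 & ->).
  rewrite Rsum_app, Rsum_cons.
  assert (0 <= Rsum l1 F) by (apply Rsum_ge0; intros; apply H; apply in_or_app; auto).
  assert (0 <= Rsum l2 F)
    by (apply Rsum_ge0; intros; apply H; apply in_or_app; right; right; auto).
  lra.
Qed.

Lemma Rsum_incl l l' F : NoDup l -> incl l l' -> (forall b, In b l' -> 0 <= F b) ->
  Rsum l F <= Rsum l' F.
Proof.
  revert l'. induction l as [|a l IH]; intros l' Hd Hi Hp.
  - apply Rsum_ge0, Hp.
  - inversion Hd; subst.
    destruct (in_split a l') as (l1 & l2 & ->); [apply Hi, in_eq|].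
    rewrite (Rsum_perm (l1 ++ a :: l2) (a :: l1 ++ l2)) by (symmetry; apply Permutation_middle).
    rewrite !Rsum_cons. apply Rplus_le_compat_l, IH; auto.
    + intros b Hb. assert (b <> a) by congruence.
      specialize (Hi b (in_cons _ _ _ Hb)).
      apply in_app_or in Hi. apply in_or_app. destruct Hi as [|[|]]; auto. congruence.
    + intros b Hb. apply Hp. apply in_app_or in Hb. apply in_or_app.
      destruct Hb; auto. right; right; auto.
Qed.

Lemma Rsum_Rabs l F : Rabs (Rsum l F) <= Rsum l (fun a => Rabs (F a)).
Proof.
  induction l as [|a l IH]; [simpl; rewrite Rabs_R0; lra|]. rewrite !Rsum_cons.
  eapply Rle_trans; [apply Rabs_triang|]. lra.
Qed.

Lemma Rsum_cauchy_schwarz l F G :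
  (Rsum l (fun a => F a * G a)) ^ 2 <= Rsum l (fun a => F a ^ 2) * Rsum l (fun a => G a ^ 2).
Proof.
  induction l as [|a l IH]; [simpl; lra|]. rewrite !Rsum_cons.
  set (X := Rsum l (fun a => F a * G a)) in *.
  set (Y := Rsum l (fun a => F a ^ 2)) in *. set (Z := Rsum l (fun a => G a ^ 2)) in *.
  assert (0 <= Y) by (apply Rsum_ge0; intros; apply pow2_ge_0).
  assert (0 <= Z) by (apply Rsum_ge0; intros; apply pow2_ge_0).
  (* The cross term: by the induction hypothesis the square of [f * g * X] is at most the product of
     the two summands on the right, and the arithmetic mean dominates the geometric one. *)
  assert (E : 2 * (F a * G a) * X <= F a ^ 2 * Z + G a ^ 2 * Y).
  { set (f := F a) in *. set (g := G a) in *.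
    assert (H1 : (f * g * X) ^ 2 <= (f ^ 2 * Z) * (g ^ 2 * Y)).
    { replace ((f * g * X) ^ 2) with ((f * g) ^ 2 * X ^ 2) by ring.
      replace ((f ^ 2 * Z) * (g ^ 2 * Y)) with ((f * g) ^ 2 * (Y * Z)) by ring.
      apply Rmult_le_compat_l; [apply pow2_ge_0|exact IH]. }
    assert (0 <= f ^ 2 * Z) by (apply Rmult_le_pos; auto using pow2_ge_0).
    assert (0 <= g ^ 2 * Y) by (apply Rmult_le_pos; auto using pow2_ge_0).
    apply Rnot_lt_le. intros Hlt.
    set (u := f ^ 2 * Z) in *. set (w := g ^ 2 * Y) in *.
    assert ((u + w) ^ 2 < (2 * (f * g) * X) ^ 2).
    { simpl. rewrite !Rmult_1_r. apply Rmult_le_0_lt_compat; lra. }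
    pose proof (pow2_ge_0 (u - w)). nra. }
  nra.
Qed.

Lemma Rsum_minkowski l F G :
  sqrt (Rsum l (fun a => (F a + G a) ^ 2))
  <= sqrt (Rsum l (fun a => F a ^ 2)) + sqrt (Rsum l (fun a => G a ^ 2)).
Proof.
  set (Y := Rsum l (fun a => F a ^ 2)). set (Z := Rsum l (fun a => G a ^ 2)).
  assert (HY : 0 <= Y) by (apply Rsum_ge0; intros; apply pow2_ge_0).
  assert (HZ : 0 <= Z) by (apply Rsum_ge0; intros; apply pow2_ge_0).
  assert (E : Rsum l (fun a => (F a + G a) ^ 2) = Y + 2 * Rsum l (fun a => F a * G a) + Z).
  { unfold Y, Z. rewrite <- Rsum_scal, <- !Rsum_plus. apply Rsum_ext. intros; ring. }
  pose proof (Rsum_cauchy_schwarz l F G) as CS. fold Y Z in CS.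
  assert (Rsum l (fun a => F a * G a) <= sqrt Y * sqrt Z).
  { rewrite <- sqrt_mult by auto. eapply Rle_trans; [apply Rle_abs|].
    rewrite <- sqrt_Rsqr_abs. apply sqrt_le_1_alt. unfold Rsqr. simpl in CS. lra. }
  rewrite E. pose proof (sqrt_pos Y). pose proof (sqrt_pos Z).
  rewrite <- (sqrt_Rsqr (sqrt Y + sqrt Z)) by lra.
  apply sqrt_le_1_alt. unfold Rsqr.
  pose proof (sqrt_sqrt Y HY). pose proof (sqrt_sqrt Z HZ). nra.
Qed.

Lemma Rsum_sq_le l F : (forall a, In a l -> 0 <= F a) ->
  (Rsum l F) ^ 2 <= INR (length l) * Rsum l (fun a => F a ^ 2).
Proof.
  intros H. pose proof (Rsum_cauchy_schwarz l (fun _ => 1) F) as CS.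
  rewrite (Rsum_ext _ (fun a => 1 * F a) F) in CS by (intros; ring).
  rewrite (Rsum_ext _ (fun a => 1 ^ 2) (fun _ => 1)) in CS by (intros; ring).
  rewrite Rsum_const in CS. lra.
Qed.

(** The averaging step of the probabilistic method. If every value exceeded [X], the non-negative
    terms [p a * (F a - X)] would have a sum at most 0, so every weight would vanish. *)
Lemma exists_below_average l (p F : A -> R) X :
  (forall a, In a l -> 0 <= p a) -> Rsum l p = 1 ->
  Rsum l (fun a => p a * F a) <= X -> exists a, In a l /\ F a <= X.
Proof.
  intros Hp H1 HX.
  destruct (excluded_middle_informative (exists a, In a l /\ F a <= X)) as [|HN]; auto.
  exfalso.
  assert (HF : forall a, In a l -> X < F a).
  { intros a Ha. apply Rnot_le_lt. intros Hle. apply HN. eauto. }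
  assert (Hlt : Rsum l (fun a => p a * (F a - X)) <= 0).
  { rewrite (Rsum_ext _ _ (fun a => p a * F a - X * p a)) by (intros; ring).
    rewrite Rsum_minus, Rsum_scal, H1. lra. }
  assert (Hall : forall a, In a l -> p a = 0).
  { intros a Ha. pose proof HF as HF0. specialize (HF a Ha). pose proof (Hp a Ha) as Hpa.
    assert (p a * (F a - X) <= 0).
    { eapply Rle_trans; [|exact Hlt].
      apply (Rsum_elem l (fun a => p a * (F a - X))); auto.
      intros b Hb. pose proof (HF0 b Hb). pose proof (Hp b Hb). nra. }
    nra. }
  rewrite (Rsum_zero l p Hall) in H1. lra.
Qed.

End Rsums.

Lemma Rsum_map {A B} (g : A -> B) l F : Rsum (map g l) F = Rsum l (fun a => F (g a)).
Proof. induction l as [|a l IH]; [reflexivity|]. simpl map. rewrite !Rsum_cons, IH. reflexivity. Qed.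

Lemma Rsum_flat_map {A B} (g : A -> list B) l F :
  Rsum (flat_map g l) F = Rsum l (fun a => Rsum (g a) F).
Proof.
  induction l as [|a l IH]; [reflexivity|].
  simpl flat_map. rewrite Rsum_app, Rsum_cons, IH. reflexivity.
Qed.

Lemma Rsum_swap {A B} (l : list A) (l' : list B) (F : A -> B -> R) :
  Rsum l (fun a => Rsum l' (F a)) = Rsum l' (fun b => Rsum l (fun a => F a b)).
Proof.
  induction l as [|a l IH].
  - simpl. symmetry. apply Rsum_zero. auto.
  - rewrite Rsum_cons, IH, <- Rsum_plus. reflexivity.
Qed.

Section Csums.
Context {A : Type}.
Implicit Types (l : list A) (F G : A -> C).

Lemma Csum_cons a l F : Csum (a :: l) F = (F a + Csum l F)%C.
Proof. reflexivity. Qed.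

Lemma Csum_ext l F G : (forall a, In a l -> F a = G a) -> Csum l F = Csum l G.
Proof.
  induction l as [|a l IH]; intros H; [reflexivity|]. rewrite !Csum_cons.
  rewrite H, IH; auto using in_eq, in_cons.
Qed.

Lemma Csum_plus l F G : Csum l (fun a => F a + G a)%C = (Csum l F + Csum l G)%C.
Proof. induction l as [|a l IH]; [simpl; ring|]. rewrite !Csum_cons, IH. ring. Qed.

Lemma Csum_minus l F G : Csum l (fun a => F a - G a)%C = (Csum l F - Csum l G)%C.
Proof. induction l as [|a l IH]; [simpl; ring|]. rewrite !Csum_cons, IH. ring. Qed.

Lemma Csum_scal (c : C) l F : Csum l (fun a => c * F a)%C = (c * Csum l F)%C.
Proof. induction l as [|a l IH]; [simpl; ring|]. rewrite !Csum_cons, IH. ring. Qed.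

Lemma Csum_zero l F : (forall a, In a l -> F a = RtoC 0) -> Csum l F = RtoC 0.
Proof.
  induction l as [|a l IH]; intros H; [reflexivity|]. rewrite Csum_cons, H, IH.
  - ring.
  - auto using in_cons.
  - apply in_eq.
Qed.

Lemma Csum_app l l' F : Csum (l ++ l') F = (Csum l F + Csum l' F)%C.
Proof. induction l as [|a l IH]; simpl app; [simpl; ring|]. rewrite !Csum_cons, IH. ring. Qed.

Lemma Csum_perm l l' F : Permutation l l' -> Csum l F = Csum l' F.
Proof.
  induction 1; rewrite ?Csum_cons; try congruence. ring.
Qed.

Lemma Cmod_Csum l F : Cmod (Csum l F) <= Rsum l (fun a => Cmod (F a)).
Proof.
  induction l as [|a l IH]; [simpl; rewrite Cmod_0; lra|]. rewrite Rsum_cons, Csum_cons.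
  eapply Rle_trans; [apply Cmod_triangle|]. lra.
Qed.

Lemma Re_Csum l F : Re (Csum l F) = Rsum l (fun a => Re (F a)).
Proof. induction l as [|a l IH]; [reflexivity|]. rewrite Rsum_cons, Csum_cons, <- IH. reflexivity. Qed.

Lemma Im_Csum l F : Im (Csum l F) = Rsum l (fun a => Im (F a)).
Proof. induction l as [|a l IH]; [reflexivity|]. rewrite Rsum_cons, Csum_cons, <- IH. reflexivity. Qed.

Lemma Cconj_Csum l F : Cconj (Csum l F) = Csum l (fun a => Cconj (F a)).
Proof.
  induction l as [|a l IH]; [apply injective_projections; simpl; lra|].
  rewrite !Csum_cons, <- IH. apply Cplus_conj.
Qed.

Lemma RtoC_Rsum l (F : A -> R) : RtoC (Rsum l F) = Csum l (fun a => RtoC (F a)).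
Proof. induction l as [|a l IH]; [reflexivity|]. rewrite Rsum_cons, Csum_cons, <- IH. apply RtoC_plus. Qed.

Lemma Csum_filter (P : A -> bool) l F :
  Csum (filter P l) F = Csum l (fun a => if P a then F a else RtoC 0).
Proof.
  induction l as [|a l IH]; [reflexivity|]. simpl filter. rewrite Csum_cons, <- IH.
  destruct (P a); [reflexivity|]. ring.
Qed.

Lemma Csum_single (a : A) l F : NoDup l -> In a l ->
  (forall b, In b l -> b <> a -> F b = RtoC 0) -> Csum l F = F a.
Proof.
  intros Hd Ha H. destruct (in_split _ _ Ha) as (l1 & l2 & ->).
  rewrite Csum_app, Csum_cons.
  apply NoDup_remove_2 in Hd.
  rewrite (Csum_zero l1), (Csum_zero l2).
  - ring.
  - intros b Hb. apply H. { apply in_or_app; right; right; auto. }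
    intros ->. apply Hd, in_or_app; auto.
  - intros b Hb. apply H. { apply in_or_app; auto. }
    intros ->. apply Hd, in_or_app; auto.
Qed.

End Csums.

Lemma Csum_map {A B} (g : A -> B) l F : Csum (map g l) F = Csum l (fun a => F (g a)).
Proof. induction l as [|a l IH]; [reflexivity|]. simpl map. rewrite !Csum_cons, IH. reflexivity. Qed.

Lemma Csum_flat_map {A B} (g : A -> list B) l F :
  Csum (flat_map g l) F = Csum l (fun a => Csum (g a) F).
Proof.
  induction l as [|a l IH]; [reflexivity|].
  simpl flat_map. rewrite Csum_app, Csum_cons, IH. reflexivity.
Qed.

Lemma Csum_swap {A B} (l : list A) (l' : list B) (F : A -> B -> C) :
  Csum l (fun a => Csum l' (F a)) = Csum l' (fun b => Csum l (fun a => F a b)).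
Proof.
  induction l as [|a l IH].
  - simpl. symmetry. apply Csum_zero. auto.
  - rewrite Csum_cons, IH, <- Csum_plus. reflexivity.
Qed.

Lemma Csum_mult {A B} (l : list A) (l' : list B) F G :
  (Csum l F * Csum l' G)%C = Csum l (fun a => Csum l' (fun b => F a * G b)%C).
Proof.
  induction l as [|a l IH]; [simpl; ring|].
  rewrite !Csum_cons, Csum_scal, <- IH. ring.
Qed.

(** * Cartesian products and selection of largest entries *)

Fixpoint cart {A} (ls : list (list A)) : list (list A) :=
  match ls with
  | [] => [[]]
  | l :: t => flat_map (fun z => map (cons z) (cart t)) l
  end.

Lemma in_cart {A} (ls : list (list A)) (t : list A) :
  In t (cart ls) <-> Forall2 (fun a l => In a l) t ls.
Proof.
  revert t. induction ls as [|l ls IH]; intros t; simpl.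
  - split; [intros [<-|[]]; constructor|]. inversion 1; auto.
  - rewrite in_flat_map. split.
    + intros (z & Hz & Ht). apply in_map_iff in Ht. destruct Ht as (u & <- & Hu).
      constructor; auto. apply IH, Hu.
    + inversion 1; subst. exists x. split; auto. apply in_map, IH; auto.
Qed.

Lemma NoDup_flat_map {A B} (g : A -> list B) l : NoDup l ->
  (forall a, In a l -> NoDup (g a)) ->
  (forall a a' b, In a l -> In a' l -> In b (g a) -> In b (g a') -> a = a') ->
  NoDup (flat_map g l).
Proof.
  induction l as [|a l IH]; intros Hd Hg Hx; simpl; [constructor|].
  inversion Hd; subst.
  apply NoDup_app; [apply Hg, in_eq|apply IH; auto using in_cons| ].
  - intros; eapply Hx; eauto using in_cons.
  - intros b Hb Hb'. apply in_flat_map in Hb'. destruct Hb' as (a' & Ha' & Hb').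
    assert (a = a') by (eapply Hx; eauto using in_eq, in_cons). congruence.
Qed.

Lemma NoDup_cart {A} (ls : list (list A)) : List.Forall (@NoDup A) ls -> NoDup (cart ls).
Proof.
  induction 1; simpl; [repeat constructor; auto|].
  apply NoDup_flat_map; auto.
  - intros a _. apply FinFun.Injective_map_NoDup; auto. intros u v E; congruence.
  - intros a a' b _ _ Hb Hb'. apply in_map_iff in Hb, Hb'.
    destruct Hb as (u & <- & _), Hb' as (v & E & _). congruence.
Qed.

Lemma length_cart_repeat {A} (l : list A) r :
  length (cart (repeat l r)) = (length l ^ r)%nat.
Proof.
  induction r as [|r IH]; [reflexivity|]. simpl.
  rewrite (flat_map_constant_length (c := (length l ^ r)%nat)); [ring|].
  intros z _. rewrite length_map. exact IH.
Qed.

Lemma in_cart_repeat {A} (l : list A) r t :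
  In t (cart (repeat l r)) <-> length t = r /\ incl t l.
Proof.
  rewrite in_cart. revert t. induction r as [|r IH]; intros t; simpl.
  - split; [inversion 1; subst; split; auto; intros x []|].
    intros [H _]. destruct t; [constructor|discriminate].
  - split.
    + inversion 1; subst. apply IH in H4. destruct H4 as [<- Hi]. split; auto.
      intros z [<-|Hz]; auto.
    + intros [H Hi]. destruct t as [|a t]; [discriminate|]. constructor.
      * apply Hi, in_eq.
      * apply IH. split; [simpl in H; congruence|]. intros z Hz; apply Hi, in_cons, Hz.
Qed.

Definition Cprod {A} (l : list A) (F : A -> C) : C :=
  fold_right (fun a acc => Cmult (F a) acc) (RtoC 1) l.

(** Lets the [2 r]-th power of a modulus be treated as the square of one sum over [r]-tuples. *)
Lemma Csum_pow {A} (l : list A) (F : A -> C) r :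
  Csum (cart (repeat l r)) (fun t => Cprod t F) = (Csum l F ^ r)%C.
Proof.
  induction r as [|r IH]; simpl.
  - apply Cplus_0_r.
  - rewrite Csum_flat_map, <- IH, Csum_mult. apply Csum_ext. intros a _.
    rewrite Csum_map. reflexivity.
Qed.

Lemma exists_max {A} (c : A -> R) (l : list A) : l <> [] ->
  exists a l', Permutation l (a :: l') /\ forall b, In b l -> c b <= c a.
Proof.
  induction l as [|a l IH]; [congruence|]. intros _.
  destruct l as [|b l].
  - exists a, []. split; auto. intros ? [<-|[]]; lra.
  - destruct IH as (m & l' & Hp & Hm); [congruence|].
    destruct (Rle_dec (c m) (c a)) as [Hle|Hle].
    + exists a, (b :: l). split; auto. intros x [<-|Hx]; [lra|].
      eapply Rle_trans; [apply Hm, Hx|exact Hle].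
    + exists m, (a :: l'). split.
      * rewrite Hp. constructor.
      * intros x [<-|Hx]; [lra|auto].
Qed.

(** Serves both to peel off blocks of coefficients in [top_block] and to threshold in
    [select_frequencies]. *)
Lemma exists_top {A} (c : A -> R) n : forall l : list A, (n <= length l)%nat ->
  exists l1 l2, Permutation l (l1 ++ l2) /\ length l1 = n /\
    forall a b, In a l1 -> In b l2 -> c b <= c a.
Proof.
  induction n as [|n IH]; intros l Hn.
  - exists [], l. repeat split; auto. intros a b [].
  - destruct (exists_max c l) as (a & l' & Hp & Hm); [destruct l; simpl in Hn; [lia|congruence]|].
    destruct (IH l') as (l1 & l2 & Hp' & Hl & Ht).
    { apply Permutation_length in Hp. simpl in Hp. lia. }
    exists (a :: l1), l2. repeat split; [rewrite Hp, Hp'; reflexivity|simpl; lia|].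
    intros x b [<-|Hx] Hb; auto.
    apply Hm. rewrite Hp, Hp'. right. apply in_or_app; auto.
Qed.

(** * Means of continuous functions *)

(** Neighbourhoods in the sup metric, packaged as a filter: sums, products and compositions of
    continuous functions then follow from the limit theorems for filters. *)
Definition nbl (d : nat) (x : list R) (P : list R -> Prop) : Prop :=
  exists del, 0 < del /\ forall y, length y = d ->
    List.Forall2 (fun a b => Rabs (a - b) < del) x y -> P y.

Lemma Forall2_weaken {A B} (P Q : A -> B -> Prop) l l' :
  (forall a b, P a b -> Q a b) -> List.Forall2 P l l' -> List.Forall2 Q l l'.
Proof. intros H. induction 1; constructor; auto. Qed.

Lemma Forall2_close_refl del x : 0 < del ->
  List.Forall2 (fun a b => Rabs (a - b) < del) x x.
Proof. intros H. induction x; constructor; auto. rewrite Rminus_diag, Rabs_R0. auto. Qed.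

Global Instance nbl_filter d x : Filter (nbl d x).
Proof.
  constructor.
  - exists 1. split; [lra|auto].
  - intros P Q (e & He & HP) (e' & He' & HQ). exists (Rmin e e').
    split; [apply Rmin_glb_lt; auto|]. intros y Hy H. split.
    + apply HP; auto. eapply Forall2_weaken; [|exact H].
      intros a b Hab. eapply Rlt_le_trans; [exact Hab|apply Rmin_l].
    + apply HQ; auto. eapply Forall2_weaken; [|exact H].
      intros a b Hab. eapply Rlt_le_trans; [exact Hab|apply Rmin_r].
  - intros P Q HPQ (e & He & HP). exists e. split; auto.
Qed.

Definition cont (d : nat) (F : list R -> R) : Prop :=
  forall x, length x = d -> filterlim F (nbl d x) (locally (F x)).

Lemma cont_eps d F : cont d F <->
  forall x, length x = d -> forall eps, 0 < eps -> exists delta, 0 < delta /\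
     forall y, length y = d -> List.Forall2 (fun a b => Rabs (a - b) < delta) x y ->
       Rabs (F y - F x) < eps.
Proof.
  split.
  - intros H x Hx eps He.
    destruct (H x Hx (fun z => Rabs (z - F x) < eps)) as (del & Hd & HP).
    + exists (mkposreal eps He). intros z Hz. exact Hz.
    + exists del. split; auto.
  - intros H x Hx P (e & HP). destruct (H x Hx e (cond_pos e)) as (del & Hd & HQ).
    exists del. split; auto. intros y Hy Hxy. apply HP. apply HQ; auto.
Qed.

Lemma cont_ext d F G : (forall x, length x = d -> F x = G x) -> cont d F -> cont d G.
Proof.
  rewrite !cont_eps. intros E H x Hx eps He.
  destruct (H x Hx eps He) as (del & Hd & HP). exists del. split; auto.
  intros y Hy Hxy. rewrite <- !E by auto. auto.
Qed.

Lemma cont_const d c : cont d (fun _ => c).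
Proof. intros x _. apply filterlim_const. Qed.

Lemma cont_plus d F G : cont d F -> cont d G -> cont d (fun x => F x + G x).
Proof.
  intros HF HG x Hx. eapply filterlim_comp_2; [apply HF, Hx|apply HG, Hx|].
  apply (@filterlim_plus R_AbsRing R_NormedModule).
Qed.

Lemma cont_mult d F G : cont d F -> cont d G -> cont d (fun x => F x * G x).
Proof.
  intros HF HG x Hx. eapply filterlim_comp_2; [apply HF, Hx|apply HG, Hx|].
  apply (@filterlim_mult R_AbsRing).
Qed.

Lemma cont_comp d (phi : R -> R) F :
  (forall t, continuous phi t) -> cont d F -> cont d (fun x => phi (F x)).
Proof. intros Hp HF x Hx. eapply filterlim_comp; [apply HF, Hx|apply Hp]. Qed.

Lemma cont_scal d c F : cont d F -> cont d (fun x => c * F x).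
Proof. intros. apply cont_mult; auto using cont_const. Qed.

Lemma cont_opp d F : cont d F -> cont d (fun x => - F x).
Proof. intros H. apply cont_ext with (2 := cont_scal d (-1) F H). intros; ring. Qed.

Lemma cont_minus d F G : cont d F -> cont d G -> cont d (fun x => F x - G x).
Proof. intros HF HG. apply cont_plus; auto using cont_opp. Qed.

Lemma cont_pow d F n : cont d F -> cont d (fun x => F x ^ n).
Proof.
  intros H. induction n as [|n IH]; simpl; [apply cont_const|apply cont_mult; auto].
Qed.

Lemma cont_hd d (phi : R -> R) :
  (forall t, continuous phi t) -> cont (S d) (fun x => phi (hd 0 x)).
Proof.
  intros H. apply cont_comp; auto. apply cont_eps. intros x Hx eps He.
  exists eps. split; auto. intros y Hy. destruct 1; simpl in *; [lia|].
  rewrite Rabs_minus_sym. auto.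
Qed.

Lemma cont_tl d F : cont d F -> cont (S d) (fun x => F (tl x)).
Proof.
  rewrite !cont_eps. intros H x Hx eps He.
  destruct x as [|a x]; [discriminate|]. simpl in Hx.
  destruct (H x ltac:(lia) eps He) as (del & Hd & HP). exists del. split; auto.
  intros y Hy Hxy. destruct y as [|b y]; [discriminate|]. inversion Hxy; subst.
  simpl in *. apply HP; auto.
Qed.

Lemma cont_app_slice e d (F : list R -> R) y : cont (e + d) F -> length y = e ->
  cont d (fun xs => F (y ++ xs)).
Proof.
  rewrite !cont_eps. intros H He x Hx eps Hp.
  destruct (H (y ++ x)) with (eps := eps) as (del & Hd & HP); auto.
  { rewrite length_app; lia. }
  exists del. split; auto. intros z Hz Hxz. apply HP; [rewrite length_app; lia|].
  apply Forall2_app; auto using Forall2_close_refl.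
Qed.

Lemma cont_slice d F t : cont (S d) F -> cont d (fun xs => F (t :: xs)).
Proof. intros H. apply (cont_app_slice 1 d F [t] H eq_refl). Qed.

Lemma cont_last e F y : cont (S e) F -> length y = e ->
  forall t, continuous (fun t => F (y ++ [t])) t.
Proof.
  intros H Hy t. rewrite <- Nat.add_1_r in H.
  pose proof (cont_app_slice e 1 F y H Hy) as Hc.
  intros P HP. destruct (Hc [t] eq_refl P HP) as (del & Hd & HQ).
  exists (mkposreal del Hd). intros u Hu. apply HQ; auto. constructor; auto.
  rewrite Rabs_minus_sym. exact Hu.
Qed.

Lemma two_PI_pos : 0 < 2 * PI.
Proof. pose proof PI_RGT_0. lra. Qed.

Lemma ex_RInt_cont (f : R -> R) a b : (forall t, continuous f t) -> ex_RInt f a b.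
Proof. intros H. apply @ex_RInt_continuous. intros; apply H. Qed.

(* Compactness of [0, 2pi] makes the modulus of continuity uniform in the integration variable. *)
Lemma cont_RInt_last e G : cont (S e) G ->
  cont e (fun y => RInt (fun t => G (y ++ [t])) 0 (2 * PI)).
Proof.
  intros H. pose proof two_PI_pos as HPI. apply cont_eps. intros y Hy eps He.
  (* Both points are compared with the same centre, so the integrand changes by at most [2 * e'],
     and the integral by [eps / 2]. *)
  set (e' := eps / (4 * (2 * PI))).
  assert (He' : 0 < e') by (apply Rdiv_lt_0_compat; lra).
  pose proof (proj1 (cont_eps _ _) H) as Hc.
  assert (Hd : forall t, exists del : posreal, forall z, length z = S e ->
     List.Forall2 (fun a b => Rabs (a - b) < del) (y ++ [t]) z ->
     Rabs (G z - G (y ++ [t])) < e').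
  { intros t. destruct (Hc (y ++ [t])) with (eps := e') as (del & Hp & HQ); auto.
    { rewrite length_app; simpl; lia. }
    exists (mkposreal del Hp). exact HQ. }
  set (dl := fun t => proj1_sig (constructive_indefinite_description _ (Hd t))).
  assert (Hdl : forall t z, length z = S e ->
     List.Forall2 (fun a b => Rabs (a - b) < dl t) (y ++ [t]) z ->
     Rabs (G z - G (y ++ [t])) < e').
  { intros t. unfold dl. destruct constructive_indefinite_description as [D HD]. exact HD. }
  destruct (compactness_value_1d 0 (2 * PI) dl) as [D HD].
  exists D. split; [apply cond_pos|]. intros y' Hy' Hyy.
  assert (Hpt : forall t, 0 <= t <= 2 * PI ->
     Rabs (G (y' ++ [t]) - G (y ++ [t])) <= 2 * e').
  (* Compactness yields the centre [t0] only under a double negation; this suffices because the goal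
     is an inequality, proved by contradiction. *)
  { intros t Ht. apply Rnot_lt_le. intros Hlt. apply (HD t Ht).
    intros (t0 & Ht0 & Hn & HDt). revert Hlt. apply Rle_not_lt.
    assert (H1 : Rabs (G (y' ++ [t]) - G (y ++ [t0])) < e').
    { apply Hdl; [rewrite length_app; simpl; lia|]. apply Forall2_app.
      - eapply Forall2_weaken; [|exact Hyy]. simpl; intros; lra.
      - constructor; auto. rewrite Rabs_minus_sym; auto. }
    assert (H2 : Rabs (G (y ++ [t]) - G (y ++ [t0])) < e').
    { apply Hdl; [rewrite length_app; simpl; lia|]. apply Forall2_app.
      - apply Forall2_close_refl, cond_pos.
      - constructor; auto. rewrite Rabs_minus_sym; auto. }
    replace (G (y' ++ [t]) - G (y ++ [t]))
      with ((G (y' ++ [t]) - G (y ++ [t0])) - (G (y ++ [t]) - G (y ++ [t0]))) by ring.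
    eapply Rle_trans; [apply Rabs_triang|]. rewrite Rabs_Ropp. lra. }
  rewrite <- (@RInt_minus R_CompleteNormedModule)
    by (apply ex_RInt_cont; eapply cont_last; eauto).
  eapply Rle_lt_trans.
  - apply abs_RInt_le_const with (M := 2 * e'); [lra| |].
    + apply (@ex_RInt_minus R_NormedModule); apply ex_RInt_cont; eapply cont_last; eauto.
    + exact Hpt.
  - replace ((2 * PI - 0) * (2 * e')) with (eps / 2); [lra|].
    unfold e'. field. lra.
Qed.

(** The parameters form a prefix [y] that gains one coordinate at each step of the induction, so
    that [cont_RInt_last] can integrate this last coordinate. *)
Lemma cont_integ_param d : forall e F, cont (e + d) F ->
  cont e (fun y => integ d (fun xs => F (y ++ xs))).
Proof.
  induction d as [|d IH]; intros e F H; simpl.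
  - apply cont_ext with F; [intros; rewrite app_nil_r; auto|].
    rewrite Nat.add_0_r in H. exact H.
  - set (G := fun z => integ d (fun xs => F (z ++ xs))).
    assert (HG : cont (S e) G).
    { apply IH. replace (S e + d)%nat with (e + S d)%nat by lia. exact H. }
    apply cont_ext with (2 := cont_RInt_last e G HG).
    intros y Hy. apply RInt_ext. intros t _. unfold G.
    f_equal. apply FunctionalExtensionality.functional_extensionality. intros xs.
    rewrite <- app_assoc. reflexivity.
Qed.

Lemma cont_inner d F : cont (S d) F ->
  forall t, continuous (fun t => integ d (fun xs => F (t :: xs))) t.
Proof.
  intros H t. pose proof (cont_integ_param d 1 F H) as Hc.
  exact (cont_last 0 _ [] Hc eq_refl t).
Qed.

Lemma ex_RInt_inner d F a b : cont (S d) F ->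
  ex_RInt (fun t => integ d (fun xs => F (t :: xs))) a b.
Proof. intros H. apply ex_RInt_cont. intros; apply cont_inner, H. Qed.

Lemma integ_ext d : forall F G, (forall x, length x = d -> F x = G x) ->
  integ d F = integ d G.
Proof.
  induction d as [|d IH]; intros F G H; simpl; [apply H; reflexivity|].
  apply RInt_ext. intros t _. apply IH. intros x Hx. apply H. simpl; lia.
Qed.

Lemma integ_plus d : forall F G, cont d F -> cont d G ->
  integ d (fun x => F x + G x) = integ d F + integ d G.
Proof.
  induction d as [|d IH]; intros F G HF HG; simpl; [reflexivity|].
  rewrite <- (@RInt_plus R_CompleteNormedModule) by (apply ex_RInt_inner; auto).
  apply RInt_ext. intros t _. apply IH; apply cont_slice; auto.
Qed.

Lemma integ_scal d c : forall F, cont d F ->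
  integ d (fun x => c * F x) = c * integ d F.
Proof.
  induction d as [|d IH]; intros F HF; simpl; [reflexivity|].
  rewrite <- (@RInt_scal R_CompleteNormedModule) by (apply ex_RInt_inner; auto).
  apply RInt_ext. intros t _. apply IH; apply cont_slice; auto.
Qed.

Definition in_box (x : list R) : Prop := List.Forall (fun t => 0 <= t <= 2 * PI) x.

Lemma integ_le d : forall F G, cont d F -> cont d G ->
  (forall x, length x = d -> in_box x -> F x <= G x) -> integ d F <= integ d G.
Proof.
  pose proof two_PI_pos as HPI.
  induction d as [|d IH]; intros F G HF HG H; simpl; [apply H; [reflexivity|constructor]|].
  apply RInt_le; [lra|apply ex_RInt_inner; auto|apply ex_RInt_inner; auto|].
  intros t Ht. apply IH; [apply cont_slice; auto|apply cont_slice; auto|].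
  intros x Hx Hb. apply H; [simpl; lia|]. constructor; auto. lra.
Qed.

Lemma integ_const d c : integ d (fun _ => c) = (2 * PI) ^ d * c.
Proof.
  induction d as [|d IH]; simpl; [ring|].
  rewrite (RInt_ext _ (fun _ => (2 * PI) ^ d * c)) by (intros; apply IH).
  rewrite RInt_const. unfold scal; simpl; unfold mult; simpl. ring.
Qed.

Lemma integ_cons_mult d (phi : R -> R) F : cont d F -> (forall t, continuous phi t) ->
  integ (S d) (fun x => phi (hd 0 x) * F (tl x)) = RInt phi 0 (2 * PI) * integ d F.
Proof.
  intros HF Hp. simpl.
  rewrite (RInt_ext _ (fun t => scal (integ d F) (phi t))).
  - rewrite (@RInt_scal R_CompleteNormedModule) by (apply ex_RInt_cont; auto).
    unfold scal; simpl; unfold mult; simpl. ring.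
  - intros t _. rewrite integ_scal by auto. apply Rmult_comm.
Qed.

Lemma mean_ext d F G : (forall x, length x = d -> F x = G x) -> mean d F = mean d G.
Proof. intros H. unfold mean. rewrite (integ_ext d F G H). reflexivity. Qed.

Lemma mean_plus d F G : cont d F -> cont d G ->
  mean d (fun x => F x + G x) = mean d F + mean d G.
Proof. intros. unfold mean. rewrite integ_plus by auto. unfold Rdiv. ring. Qed.

Lemma mean_scal d c F : cont d F -> mean d (fun x => c * F x) = c * mean d F.
Proof. intros. unfold mean. rewrite integ_scal by auto. unfold Rdiv. ring. Qed.

Lemma mean_minus d F G : cont d F -> cont d G ->
  mean d (fun x => F x - G x) = mean d F - mean d G.
Proof.
  intros HF HG. rewrite (mean_ext d _ (fun x => F x + (-1) * G x)) by (intros; ring).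
  rewrite mean_plus, mean_scal; auto using cont_scal. ring.
Qed.

Lemma mean_le d F G : cont d F -> cont d G ->
  (forall x, length x = d -> in_box x -> F x <= G x) -> mean d F <= mean d G.
Proof.
  intros HF HG H. unfold mean. apply Rmult_le_compat_r; [|apply integ_le; auto].
  left. apply Rinv_0_lt_compat, pow_lt, two_PI_pos.
Qed.

Lemma mean_const d c : mean d (fun _ => c) = c.
Proof.
  unfold mean. rewrite integ_const. field. apply pow_nonzero.
  pose proof two_PI_pos; lra.
Qed.

Lemma mean_ge0 d F : cont d F -> (forall x, length x = d -> in_box x -> 0 <= F x) ->
  0 <= mean d F.
Proof. intros HF H. rewrite <- (mean_const d 0). apply mean_le; auto using cont_const. Qed.

Lemma mean_cons_mult d (phi : R -> R) F : cont d F -> (forall t, continuous phi t) ->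
  mean (S d) (fun x => phi (hd 0 x) * F (tl x))
  = RInt phi 0 (2 * PI) / (2 * PI) * mean d F.
Proof.
  intros HF Hp. unfold mean. rewrite integ_cons_mult by auto. simpl pow. field.
  split; [|pose proof PI_RGT_0; lra].
  apply pow_nonzero. pose proof two_PI_pos; lra.
Qed.

(** * Trigonometric polynomials *)

Lemma Cmod_sqr z : Cmod z ^ 2 = Re z ^ 2 + Im z ^ 2.
Proof.
  unfold Cmod. rewrite pow2_sqrt; [reflexivity|].
  apply Rplus_le_le_0_compat; apply pow2_ge_0.
Qed.

Lemma Re_plus z w : Re (z + w)%C = Re z + Re w. Proof. reflexivity. Qed.
Lemma Im_plus z w : Im (z + w)%C = Im z + Im w. Proof. reflexivity. Qed.
Lemma Re_mult z w : Re (z * w)%C = Re z * Re w - Im z * Im w. Proof. reflexivity. Qed.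
Lemma Im_mult z w : Im (z * w)%C = Re z * Im w + Im z * Re w. Proof. reflexivity. Qed.
Lemma Re_conj z : Re (Cconj z) = Re z. Proof. reflexivity. Qed.
Lemma Im_conj z : Im (Cconj z) = - Im z. Proof. reflexivity. Qed.
Lemma Re_minus z w : Re (z - w)%C = Re z - Re w. Proof. reflexivity. Qed.
Lemma Im_minus z w : Im (z - w)%C = Im z - Im w. Proof. reflexivity. Qed.

Lemma C_eq z w : Re z = Re w -> Im z = Im w -> z = w.
Proof. intros. apply injective_projections; assumption. Qed.

Lemma Re_le_Cmod z : Rabs (Re z) <= Cmod z.
Proof.
  rewrite <- (Rabs_pos_eq (Cmod z)) by apply Cmod_ge_0. apply Rsqr_le_abs_0.
  unfold Rsqr. pose proof (Cmod_sqr z). pose proof (pow2_ge_0 (Im z)). nra.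
Qed.

Lemma Im_le_Cmod z : Rabs (Im z) <= Cmod z.
Proof.
  rewrite <- (Rabs_pos_eq (Cmod z)) by apply Cmod_ge_0. apply Rsqr_le_abs_0.
  unfold Rsqr. pose proof (Cmod_sqr z). pose proof (pow2_ge_0 (Re z)). nra.
Qed.

Lemma Cmod_le_Re_Im z : Cmod z <= Rabs (Re z) + Rabs (Im z).
Proof.
  pose proof (Cmod_sqr z) as E. pose proof (Cmod_ge_0 z).
  pose proof (Rabs_pos (Re z)). pose proof (Rabs_pos (Im z)).
  rewrite <- (pow2_abs (Re z)), <- (pow2_abs (Im z)) in E. nra.
Qed.

Lemma Cmod_plus_sqr_le z w : Cmod (z + w) ^ 2 <= 2 * Cmod z ^ 2 + 2 * Cmod w ^ 2.
Proof.
  rewrite !Cmod_sqr, Re_plus, Im_plus.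
  pose proof (pow2_ge_0 (Re z - Re w)). pose proof (pow2_ge_0 (Im z - Im w)). nra.
Qed.

(** The multiplier of modulus at most 1 that rotates [z] onto the non-negative half-line; the
    default 0 at [z = 0] respects both properties. *)
Definition phase (z : C) : C :=
  if Req_EM_T (Cmod z) 0 then RtoC 0 else (Cconj z / RtoC (Cmod z))%C.

Lemma phase_mult z : (phase z * z)%C = RtoC (Cmod z).
Proof.
  unfold phase. destruct Req_EM_T as [E|E].
  - rewrite E. ring.
  - assert (RtoC (Cmod z) <> 0) by (intros H; apply E; apply RtoC_inj; auto).
    replace (Cconj z / Cmod z * z)%C with ((z * Cconj z) / Cmod z)%C by (field; auto).
    rewrite <- Cmod2_conj, RtoC_pow. field. auto.
Qed.

Lemma Cmod_phase z : Cmod (phase z) <= 1.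
Proof.
  unfold phase. destruct Req_EM_T as [E|E]; [rewrite Cmod_0; lra|].
  rewrite Cmod_div by (intros H; apply E; apply RtoC_inj; auto).
  rewrite Cmod_conj, Cmod_R, Rabs_pos_eq by apply Cmod_ge_0. right. field. auto.
Qed.

Definition ccont (d : nat) (F : list R -> C) : Prop :=
  cont d (fun x => Re (F x)) /\ cont d (fun x => Im (F x)).

Definition cmean (d : nat) (F : list R -> C) : C :=
  (mean d (fun x => Re (F x)), mean d (fun x => Im (F x))).

Lemma fhat_cmean d f k : fhat d f k = cmean d (fun x => f x * Cconj (charac k x))%C.
Proof. reflexivity. Qed.

Lemma ccont_ext d F G : (forall x, length x = d -> F x = G x) -> ccont d F -> ccont d G.
Proof.
  intros E [H1 H2]. split; [apply cont_ext with (2 := H1)|apply cont_ext with (2 := H2)];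
    intros x Hx; rewrite E; auto.
Qed.

Lemma ccont_const d c : ccont d (fun _ => c).
Proof. split; apply cont_const. Qed.

Lemma ccont_plus d F G : ccont d F -> ccont d G -> ccont d (fun x => F x + G x)%C.
Proof. intros [] []. split; [apply (cont_plus d)|apply (cont_plus d)]; auto. Qed.

Lemma ccont_minus d F G : ccont d F -> ccont d G -> ccont d (fun x => F x - G x)%C.
Proof. intros [] []. split; [apply (cont_minus d)|apply (cont_minus d)]; auto. Qed.

Lemma ccont_mult d F G : ccont d F -> ccont d G -> ccont d (fun x => F x * G x)%C.
Proof.
  intros [] []. split.
  - apply (cont_minus d); apply cont_mult; auto.
  - apply (cont_plus d); apply cont_mult; auto.
Qed.

Lemma ccont_conj d F : ccont d F -> ccont d (fun x => Cconj (F x)).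
Proof. intros []. split; [auto|apply (cont_opp d); auto]. Qed.

Lemma ccont_scal d c F : ccont d F -> ccont d (fun x => c * F x)%C.
Proof. intros; apply ccont_mult; auto using ccont_const. Qed.

Lemma ccont_Csum {A} d (l : list A) (F : A -> list R -> C) :
  (forall a, In a l -> ccont d (F a)) -> ccont d (fun x => Csum l (fun a => F a x)).
Proof.
  induction l as [|a l IH]; intros H; simpl; [apply ccont_const|].
  apply ccont_plus; auto using in_eq, in_cons.
Qed.

Lemma cont_Cmod_sqr d F : ccont d F -> cont d (fun x => Cmod (F x) ^ 2).
Proof.
  intros [H1 H2]. apply cont_ext with (fun x => Re (F x) ^ 2 + Im (F x) ^ 2).
  - intros; symmetry; apply Cmod_sqr.
  - apply cont_plus; apply cont_pow; auto.
Qed.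

Lemma cont_Cmod d F : ccont d F -> cont d (fun x => Cmod (F x)).
Proof.
  intros H. apply cont_ext with (fun x => sqrt (Cmod (F x) ^ 2)).
  - intros; apply sqrt_pow2, Cmod_ge_0.
  - apply cont_comp; [apply continuous_sqrt|]. apply cont_Cmod_sqr, H.
Qed.

Lemma cmean_ext d F G : (forall x, length x = d -> F x = G x) -> cmean d F = cmean d G.
Proof. intros H. unfold cmean. f_equal; apply mean_ext; intros; rewrite H; auto. Qed.

Lemma cmean_plus d F G : ccont d F -> ccont d G ->
  cmean d (fun x => F x + G x)%C = (cmean d F + cmean d G)%C.
Proof. intros [] []. apply C_eq; apply (mean_plus d); auto. Qed.

Lemma cmean_minus d F G : ccont d F -> ccont d G ->
  cmean d (fun x => F x - G x)%C = (cmean d F - cmean d G)%C.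
Proof. intros [] []. apply C_eq; apply (mean_minus d); auto. Qed.

Lemma cmean_scal d c F : ccont d F -> cmean d (fun x => c * F x)%C = (c * cmean d F)%C.
Proof.
  intros [H1 H2]. apply C_eq; simpl.
  - rewrite <- (mean_scal d (Re c)), <- (mean_scal d (Im c)), <- mean_minus;
      auto using cont_scal.
  - rewrite <- (mean_scal d (Re c)), <- (mean_scal d (Im c)), <- mean_plus;
      auto using cont_scal.
Qed.

Lemma cmean_const d c : cmean d (fun _ => c) = c.
Proof. apply C_eq; [apply (mean_const d (Re c))|apply (mean_const d (Im c))]. Qed.

Lemma cmean_Csum {A} d (l : list A) (F : A -> list R -> C) :
  (forall a, In a l -> ccont d (F a)) ->
  cmean d (fun x => Csum l (fun a => F a x)) = Csum l (fun a => cmean d (F a)).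
Proof.
  induction l as [|a l IH]; intros H; simpl; [apply cmean_const|].
  rewrite cmean_plus, IH; auto using in_eq, in_cons.
  apply (ccont_Csum d l F). auto using in_cons.
Qed.

Lemma Re_cmean_le d F G : ccont d F -> cont d G ->
  (forall x, length x = d -> in_box x -> Cmod (F x) <= G x) -> Re (cmean d F) <= mean d G.
Proof.
  intros HF HG H. simpl. apply mean_le; auto; [apply HF|]. intros x Hx Hb.
  eapply Rle_trans; [|apply H; auto]. eapply Rle_trans; [apply Rle_abs|apply Re_le_Cmod].
Qed.

(** A rotation by [phase] makes the mean real and non-negative, after which only real parts have to
    be compared. *)
Lemma Cmod_cmean_le d F G : ccont d F -> cont d G ->
  (forall x, length x = d -> in_box x -> Cmod (F x) <= G x) -> Cmod (cmean d F) <= mean d G.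
Proof.
  intros HF HG H. set (s := phase (cmean d F)).
  replace (Cmod (cmean d F)) with (Re (cmean d (fun x => s * F x)%C)).
  - apply Re_cmean_le; auto using ccont_scal. intros x Hx Hb. rewrite Cmod_mult.
    pose proof (Cmod_phase (cmean d F)). fold s in H0. pose proof (Cmod_ge_0 (F x)).
    specialize (H x Hx Hb). nra.
  - rewrite cmean_scal by auto. unfold s. rewrite phase_mult. reflexivity.
Qed.

Lemma cexpi_plus s t : cexpi (s + t) = (cexpi s * cexpi t)%C.
Proof. apply C_eq; unfold cexpi; simpl; rewrite ?cos_plus, ?sin_plus; ring. Qed.

Lemma cexpi_0 : cexpi 0 = RtoC 1.
Proof. apply C_eq; simpl; [apply cos_0|apply sin_0]. Qed.

Lemma cexpi_conj t : Cconj (cexpi t) = cexpi (- t).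
Proof. apply C_eq; simpl; [symmetry; apply cos_neg|symmetry; apply sin_neg]. Qed.

Lemma Cmod_cexpi t : Cmod (cexpi t) = 1.
Proof.
  unfold Cmod, cexpi; simpl. rewrite !Rmult_1_r, <- sqrt_1. f_equal.
  pose proof (sin2_cos2 t). unfold Rsqr in *. lra.
Qed.

Lemma Cmod_charac k x : Cmod (charac k x) = 1.
Proof. apply Cmod_cexpi. Qed.

Definition zadd (k l : list Z) : list Z := map (fun p => (fst p + snd p)%Z) (combine k l).

Lemma charac_cons k1 k t x : charac (k1 :: k) (t :: x) = (cexpi (IZR k1 * t) * charac k x)%C.
Proof. apply cexpi_plus. Qed.

Lemma length_zadd k l : length k = length l -> length (zadd k l) = length l.
Proof. intros H. unfold zadd. rewrite length_map, length_combine. lia. Qed.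

Lemma charac_zadd k l x : length k = length l ->
  charac (zadd k l) x = (charac k x * charac l x)%C.
Proof.
  intros H. unfold charac. rewrite <- cexpi_plus. f_equal.
  revert l H x. induction k as [|a k IH]; intros [|b l] H x; try discriminate; simpl in *.
  - ring.
  - destruct x as [|y x]; [ring|]. fold (zadd k l). rewrite IH by lia. rewrite plus_IZR. ring.
Qed.

Lemma charac_opp k x : charac (map Z.opp k) x = Cconj (charac k x).
Proof.
  unfold charac. rewrite cexpi_conj. f_equal.
  revert x. induction k as [|a k IH]; intros [|y x]; simpl; try ring.
  rewrite IH, opp_IZR. ring.
Qed.

Lemma charac_zero d x : charac (repeat 0%Z d) x = RtoC 1.
Proof.
  unfold charac. rewrite <- cexpi_0. f_equal. revert x.
  induction d as [|d IH]; intros [|y x]; simpl; auto. rewrite IH. ring.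
Qed.

Lemma continuous_cos_lin a t : continuous (fun t => cos (a * t)) t.
Proof.
  apply (continuous_comp (fun t => a * t) cos); [|apply continuous_cos].
  apply (continuous_mult (fun _ => a) (fun t => t)); [apply continuous_const|apply continuous_id].
Qed.

Lemma continuous_sin_lin a t : continuous (fun t => sin (a * t)) t.
Proof.
  apply (continuous_comp (fun t => a * t) sin); [|apply continuous_sin].
  apply (continuous_mult (fun _ => a) (fun t => t)); [apply continuous_const|apply continuous_id].
Qed.

Lemma ccont_charac k : ccont (length k) (charac k).
Proof.
  induction k as [|a k IH]; [apply ccont_ext with (2 := ccont_const 0 1)|].
  { intros x _. unfold charac. simpl. symmetry; apply cexpi_0. }
  apply ccont_ext with (fun x => cexpi (IZR a * hd 0 x) * charac k (tl x))%C.
  - intros [|t x] Hx; [discriminate|]. rewrite charac_cons. reflexivity.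
  - apply ccont_mult.
    + split; simpl; [apply (cont_hd _ (fun t => cos (IZR a * t)))|
                     apply (cont_hd _ (fun t => sin (IZR a * t)))];
      intros; auto using continuous_cos_lin, continuous_sin_lin.
    + destruct IH. split; [apply (cont_tl _ (fun x => Re (charac k x)))|apply (cont_tl _ (fun x => Im (charac k x)))]; auto.
Qed.

Lemma ccont_charac_len d k : length k = d -> ccont d (charac k).
Proof. intros <-. apply ccont_charac. Qed.

Definition cmean1 (phi : R -> C) : C :=
  (RInt (fun t => Re (phi t)) 0 (2 * PI) / (2 * PI),
   RInt (fun t => Im (phi t)) 0 (2 * PI) / (2 * PI)).

Lemma cmean_cons_mult d (phi : R -> C) F : ccont d F ->
  (forall t, continuous (fun t => Re (phi t)) t) ->
  (forall t, continuous (fun t => Im (phi t)) t) ->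
  cmean (S d) (fun x => phi (hd 0 x) * F (tl x))%C = (cmean1 phi * cmean d F)%C.
Proof.
  intros [H1 H2] P1 P2.
  assert (Hc : forall (f : R -> R) G, (forall t, continuous f t) -> cont d G ->
     cont (S d) (fun x => f (hd 0 x) * G (tl x))).
  { intros f G Hf HG. apply cont_mult; [apply cont_hd, Hf|apply cont_tl, HG]. }
  apply C_eq; simpl.
  - rewrite <- (mean_cons_mult d (fun t => Re (phi t)) (fun x => Re (F x)) H1 P1).
    rewrite <- (mean_cons_mult d (fun t => Im (phi t)) (fun x => Im (F x)) H2 P2).
    rewrite <- mean_minus; auto.
    + apply (Hc (fun t => Re (phi t)) (fun x => Re (F x))); auto.
    + apply (Hc (fun t => Im (phi t)) (fun x => Im (F x))); auto.
  - rewrite <- (mean_cons_mult d (fun t => Re (phi t)) (fun x => Im (F x)) H2 P1).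
    rewrite <- (mean_cons_mult d (fun t => Im (phi t)) (fun x => Re (F x)) H1 P2).
    rewrite <- mean_plus; auto.
    + apply (Hc (fun t => Re (phi t)) (fun x => Im (F x))); auto.
    + apply (Hc (fun t => Im (phi t)) (fun x => Re (F x))); auto.
Qed.

Lemma cexpi_2kPI k : cexpi (IZR k * (2 * PI)) = RtoC 1.
Proof.
  replace (IZR k * (2 * PI)) with (2 * (IZR k * PI)) by ring.
  assert (sin (IZR k * PI) = 0) by (apply sin_eq_0_1; eauto).
  apply C_eq; unfold cexpi; simpl.
  - rewrite cos_2a_sin, H. ring.
  - rewrite sin_2a, H. ring.
Qed.

Lemma cmean1_cexpi k :
  cmean1 (fun t => cexpi (IZR k * t)) = RtoC (if Z.eq_dec k 0 then 1 else 0).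
Proof.
  pose proof two_PI_pos as HP.
  destruct (Z.eq_dec k 0) as [->|Hk].
  - unfold cmean1, cexpi; simpl. apply C_eq; simpl.
    + rewrite (RInt_ext _ (fun _ => 1)) by (intros; rewrite Rmult_0_l; apply cos_0).
      rewrite RInt_const. unfold scal; simpl; unfold mult; simpl. field. lra.
    + rewrite (RInt_ext _ (fun _ => 0)) by (intros; rewrite Rmult_0_l; apply sin_0).
      rewrite RInt_const. unfold scal; simpl; unfold mult; simpl. field. lra.
  - assert (Hk' : IZR k <> 0) by (apply not_0_IZR; auto).
    pose proof (cexpi_2kPI k) as E.
    apply C_eq; simpl.
    + rewrite (is_RInt_unique (fun t => cos (IZR k * t)) 0 (2 * PI) 0); [field; lra|].
      replace 0 with (minus (sin (IZR k * (2 * PI)) / IZR k) (sin (IZR k * 0) / IZR k)) at 2.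
      * apply (is_RInt_derive (fun t => sin (IZR k * t) / IZR k)).
        -- intros t _. auto_derive; auto. field; auto.
        -- intros; apply continuous_cos_lin.
      * unfold minus, plus, opp; simpl. replace (sin (IZR k * (2 * PI))) with (Im (cexpi (IZR k * (2 * PI)))) by reflexivity.
        rewrite E, Rmult_0_r, sin_0. simpl. field; auto.
    + rewrite (is_RInt_unique (fun t => sin (IZR k * t)) 0 (2 * PI) 0); [field; lra|].
      replace 0 with (minus (- cos (IZR k * (2 * PI)) / IZR k) (- cos (IZR k * 0) / IZR k)) at 2.
      * apply (is_RInt_derive (fun t => - cos (IZR k * t) / IZR k)).
        -- intros t _. auto_derive; auto. field; auto.
        -- intros; apply continuous_sin_lin.
      * unfold minus, plus, opp; simpl. replace (cos (IZR k * (2 * PI))) with (Re (cexpi (IZR k * (2 * PI)))) by reflexivity.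
        rewrite E, Rmult_0_r, cos_0. simpl. field; auto.
Qed.

Definition zl_eq_dec : forall k l : list Z, {k = l} + {k <> l} := list_eq_dec Z.eq_dec.

Lemma cmean_charac k :
  cmean (length k) (charac k) = RtoC (if zl_eq_dec k (repeat 0%Z (length k)) then 1 else 0).
Proof.
  induction k as [|a k IH].
  - unfold charac; simpl. rewrite (cmean_ext _ _ (fun _ => RtoC 1)).
    + rewrite cmean_const. reflexivity.
    + intros; apply cexpi_0.
  - rewrite (cmean_ext _ _ (fun x => cexpi (IZR a * hd 0 x) * charac k (tl x))%C).
    + simpl length.
      rewrite (cmean_cons_mult _ (fun t => cexpi (IZR a * t)) (charac k) (ccont_charac k))
        by (intros t; first [exact (continuous_cos_lin (IZR a) t)|exact (continuous_sin_lin (IZR a) t)]).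
      rewrite cmean1_cexpi, IH, <- RtoC_mult. f_equal. simpl repeat.
      destruct (Z.eq_dec a 0), (zl_eq_dec k _), (zl_eq_dec (a :: k) _); try ring;
        exfalso; congruence.
    + intros [|t x] Hx; [discriminate|]. rewrite charac_cons. reflexivity.
Qed.

Lemma zadd_opp_zero k l : length k = length l ->
  (zadd k (map Z.opp l) = repeat 0%Z (length l) <-> k = l).
Proof.
  revert l. induction k as [|a k IH]; intros [|b l] H; try discriminate; simpl in *; [tauto|].
  unfold zadd in *; simpl. specialize (IH l ltac:(lia)). split.
  - intros E. injection E as E1 E2. f_equal; [lia|]. apply IH, E2.
  - intros E. injection E as -> ->. f_equal; [lia|]. apply IH, eq_refl.
Qed.

Lemma cmean_charac_orth d k l : length k = d -> length l = d ->
  cmean d (fun x => charac k x * Cconj (charac l x))%C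
  = RtoC (if zl_eq_dec k l then 1 else 0).
Proof.
  intros Hk Hl.
  assert (HL : length (zadd k (map Z.opp l)) = d).
  { rewrite length_zadd; rewrite length_map; congruence. }
  rewrite (cmean_ext _ _ (charac (zadd k (map Z.opp l)))).
  - rewrite <- HL at 1. rewrite cmean_charac, HL. f_equal.
    pose proof (zadd_opp_zero k l ltac:(congruence)) as E. rewrite Hl in E.
    destruct (zl_eq_dec k l), (zl_eq_dec (zadd _ _) _); tauto.
  - intros x _. rewrite charac_zadd, charac_opp; auto. rewrite length_map. congruence.
Qed.

Lemma ccont_trig {A} d (T : list A) (kap : A -> list Z) (c : A -> C) :
  (forall a, In a T -> length (kap a) = d) ->
  ccont d (fun x => Csum T (fun a => c a * charac (kap a) x)%C).
Proof.
  intros H. apply (ccont_Csum d T (fun a x => c a * charac (kap a) x)%C).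
  intros a Ha. apply ccont_scal, ccont_charac_len; auto.
Qed.

(** Stated for indexed families whose frequencies may coincide: expanding a power of a polynomial
    gives a sum over tuples in which they do. *)
Lemma cmean_trig_pairing {A B} d (T : list A) (T' : list B) (kap : A -> list Z)
    (kap' : B -> list Z) (c : A -> C) (c' : B -> C) :
  (forall a, In a T -> length (kap a) = d) -> (forall a, In a T' -> length (kap' a) = d) ->
  cmean d (fun x => Csum T (fun a => c a * charac (kap a) x)%C
                    * Cconj (Csum T' (fun b => c' b * charac (kap' b) x)%C))%C
  = Csum T (fun a => Csum T' (fun b =>
      c a * Cconj (c' b) * RtoC (if zl_eq_dec (kap a) (kap' b) then 1 else 0))%C).
Proof.
  intros H H'.
  assert (Hc : forall a b, In a T -> In b T' ->
     ccont d (fun x => charac (kap a) x * Cconj (charac (kap' b) x))%C).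
  { intros a b Ha Hb. apply ccont_mult; [|apply ccont_conj]; apply ccont_charac_len; auto. }
  rewrite (cmean_ext _ _ (fun x => Csum T (fun a => Csum T' (fun b =>
     (c a * Cconj (c' b)) * (charac (kap a) x * Cconj (charac (kap' b) x)))%C))).
  - rewrite (cmean_Csum d T (fun a x => Csum T' (fun b =>
     (c a * Cconj (c' b)) * (charac (kap a) x * Cconj (charac (kap' b) x)))%C)).
    + apply Csum_ext. intros a Ha.
      rewrite (cmean_Csum d T' (fun b x =>
         (c a * Cconj (c' b)) * (charac (kap a) x * Cconj (charac (kap' b) x)))%C).
      * apply Csum_ext. intros b Hb. rewrite cmean_scal by auto.
        rewrite cmean_charac_orth by auto. reflexivity.
      * intros b Hb. apply ccont_scal; auto.
    + intros a Ha. apply (ccont_Csum d T' (fun b x =>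
         (c a * Cconj (c' b)) * (charac (kap a) x * Cconj (charac (kap' b) x)))%C).
      intros b Hb. apply ccont_scal; auto.
  - intros x _. rewrite Cconj_Csum, Csum_mult. apply Csum_ext. intros a _.
    apply Csum_ext. intros b _. rewrite Cmult_conj. ring.
Qed.

Lemma mean_Cmod_sqr d F : mean d (fun x => Cmod (F x) ^ 2) = Re (cmean d (fun x => F x * Cconj (F x))%C).
Proof.
  simpl. apply mean_ext. intros x _. pose proof (Cmod_sqr (F x)) as E. simpl in E. simpl.
  unfold Re, Im in *. rewrite E. ring.
Qed.

(* Positive definiteness; the frequencies [kap a] may repeat, so this is not a consequence of Parseval. *)
Lemma mean_sqr_majorant {A} d (T : list A) (kap : A -> list Z) (c : A -> C) (w : A -> R) :
  (forall a, In a T -> length (kap a) = d) -> (forall a, In a T -> Cmod (c a) <= w a) ->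
  mean d (fun x => Cmod (Csum T (fun a => c a * charac (kap a) x)%C) ^ 2)
  <= mean d (fun x => Cmod (Csum T (fun a => RtoC (w a) * charac (kap a) x)%C) ^ 2).
Proof.
  intros H Hw. rewrite !mean_Cmod_sqr, !cmean_trig_pairing by auto.
  rewrite !Re_Csum. apply Rsum_le. intros a Ha. rewrite !Re_Csum. apply Rsum_le. intros b Hb.
  destruct (zl_eq_dec _ _).
  - rewrite !Cmult_1_r. replace (Re (RtoC (w a) * Cconj (RtoC (w b)))%C) with (w a * w b).
    + eapply Rle_trans; [apply Rle_abs|]. eapply Rle_trans; [apply Re_le_Cmod|].
      rewrite Cmod_mult, Cmod_conj. apply Rmult_le_compat; auto using Cmod_ge_0.
    + simpl. ring.
  - rewrite !Cmult_0_r. simpl. lra.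
Qed.

Lemma fhat_trigpoly d T (c : list Z -> C) k : NoDup T ->
  (forall a, In a T -> length a = d) -> In k T -> fhat d (trigpoly T c) k = c k.
Proof.
  intros Hd H Hk. rewrite fhat_cmean.
  rewrite (cmean_ext _ _ (fun x => Csum T (fun a => c a * charac a x)%C
      * Cconj (Csum [k] (fun b => RtoC 1 * charac b x)%C))%C).
  - rewrite (cmean_trig_pairing d T [k] (fun a => a) (fun a => a) c (fun _ => RtoC 1)).
    + rewrite (Csum_single k); auto.
      * simpl. destruct (zl_eq_dec _ _); [|congruence]. apply C_eq; unfold Re, Im; simpl; ring.
      * intros b Hb Hne. simpl. destruct (zl_eq_dec _ _); [congruence|]. ring.
    + auto.
    + intros a [<-|[]]. auto.
  - intros x _. unfold trigpoly. f_equal. f_equal. simpl. ring.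
Qed.

Lemma parseval d T (c : list Z -> C) : NoDup T -> (forall a, In a T -> length a = d) ->
  mean d (fun x => Cmod (trigpoly T c x) ^ 2) = Rsum T (fun k => Cmod (c k) ^ 2).
Proof.
  intros Hd H. rewrite mean_Cmod_sqr. unfold trigpoly.
  rewrite (cmean_trig_pairing d T T (fun a => a) (fun a => a) c c) by auto.
  rewrite Re_Csum. apply Rsum_ext. intros a Ha. rewrite (Csum_single a); auto.
  - destruct (zl_eq_dec _ _); [|congruence]. rewrite Cmult_1_r, <- Cmod2_conj. reflexivity.
  - intros b Hb Hne. destruct (zl_eq_dec _ _); [congruence|]. apply Cmult_0_r.
Qed.

(** * Uniqueness of Fourier coefficients *)

(** With [is_RInt], integrability travels together with the value through linear combinations. *)
Definition trig_orth (h : R -> R) : Prop :=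
  forall k : Z, is_RInt (fun t => h t * cos (IZR k * t)) 0 (2 * PI) 0 /\
                is_RInt (fun t => h t * sin (IZR k * t)) 0 (2 * PI) 0.

Lemma is_RInt_zero_comb (g1 g2 g3 : R -> R) a b c1 c2 c3 :
  is_RInt g1 a b 0 -> is_RInt g2 a b 0 -> is_RInt g3 a b 0 ->
  is_RInt (fun t => c1 * g1 t + c2 * g2 t + c3 * g3 t) a b 0.
Proof.
  intros H1 H2 H3.
  replace 0 with (plus (plus (scal c1 0) (scal c2 0)) (scal c3 0)) at 1
    by (unfold plus, scal; simpl; unfold mult; simpl; ring).
  apply (@is_RInt_plus R_NormedModule (fun t => c1 * g1 t + c2 * g2 t) (fun t => c3 * g3 t)).
  - apply (@is_RInt_plus R_NormedModule (fun t => c1 * g1 t) (fun t => c2 * g2 t));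
      apply (@is_RInt_scal R_NormedModule); auto.
  - apply (@is_RInt_scal R_NormedModule); auto.
Qed.

(** By the addition formulas, [cos (t - t0)] times a mode of frequency [k] is a combination of modes
    of frequencies [k + 1] and [k - 1]. *)
Lemma trig_orth_mult h A t0 : trig_orth h ->
  trig_orth (fun t => h t * (A + cos (t - t0))).
Proof.
  intros H k. destruct (H k) as [C0 S0]. destruct (H (k + 1)%Z) as [C1 S1].
  destruct (H (k - 1)%Z) as [C2 S2].
  assert (Ek1 : forall t, IZR (k + 1) * t = IZR k * t + t) by (intros; rewrite plus_IZR; ring).
  assert (Ek2 : forall t, IZR (k - 1) * t = IZR k * t - t) by (intros; rewrite minus_IZR; ring).
  split.
  - pose proof (is_RInt_zero_comb _ _ _ _ _ A (cos t0 / 2) (cos t0 / 2) C0 C1 C2) as Q1.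
    pose proof (is_RInt_zero_comb _ _ _ _ _ 1 (sin t0 / 2) (- sin t0 / 2) Q1 S1 S2) as Q2.
    eapply is_RInt_ext; [|exact Q2]. intros t _. simpl.
    rewrite Ek1, Ek2, cos_plus, cos_minus, sin_plus, sin_minus, cos_minus. field.
  - pose proof (is_RInt_zero_comb _ _ _ _ _ A (cos t0 / 2) (cos t0 / 2) S0 S1 S2) as Q1.
    pose proof (is_RInt_zero_comb _ _ _ _ _ 1 (sin t0 / 2) (- sin t0 / 2) Q1 C2 C1) as Q2.
    eapply is_RInt_ext; [|exact Q2]. intros t _. simpl.
    rewrite Ek1, Ek2, cos_plus, cos_minus, sin_plus, sin_minus, cos_minus. field.
Qed.

Lemma trig_orth_pow h A t0 n : trig_orth h ->
  trig_orth (fun t => h t * (A + cos (t - t0)) ^ n).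
Proof.
  intros H. induction n as [|n IH].
  - intros k. destruct (H k) as [H1 H2].
    split; [eapply is_RInt_ext; [|exact H1]|eapply is_RInt_ext; [|exact H2]]; intros; simpl; ring.
  - intros k. destruct (trig_orth_mult _ A t0 IH k) as [H1 H2].
    split; [eapply is_RInt_ext; [|exact H1]|eapply is_RInt_ext; [|exact H2]]; intros; simpl; ring.
Qed.

Lemma cos_le_outside del s : 0 < del -> del < PI -> del <= Rabs s <= 2 * PI - del ->
  cos s <= cos del.
Proof.
  intros H0 H1 [H2 H3].
  replace (cos s) with (cos (Rabs s)).
  - destruct (Rle_dec (Rabs s) PI).
    + apply cos_decr_1; lra.
    + replace (cos (Rabs s)) with (cos (2 * PI - Rabs s)).
      * apply cos_decr_1; lra.
      * rewrite cos_minus, cos_2PI, sin_2PI. ring.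
  - unfold Rabs. destruct Rcase_abs; auto. apply cos_neg.
Qed.

Lemma continuous_cont_pt f t : continuous f t -> continuity_pt f t.
Proof. intros H. apply continuity_pt_filterlim. exact H. Qed.

Lemma continuous_bump t0 del t :
  continuous (fun t => Rmax 0 (cos (t - t0) - cos del)) t.
Proof.
  assert (HE : forall x, Rmax 0 x = (x + Rabs x) / 2).
  { intros x. unfold Rmax, Rabs. destruct Rle_dec, Rcase_abs; lra. }
  apply continuous_ext with (fun t =>
     ((cos (t - t0) - cos del) + Rabs (cos (t - t0) - cos del)) * / 2).
  { intros; symmetry; apply HE. }
  assert (Hc : continuous (fun t => cos (t - t0) - cos del) t).
  { apply (@continuous_minus R_UniformSpace R_AbsRing R_NormedModule).
    - apply (continuous_comp (fun t => t - t0) cos); [|apply continuous_cos].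
      apply (@continuous_minus R_UniformSpace R_AbsRing R_NormedModule);
        [apply continuous_id|apply continuous_const].
    - apply continuous_const. }
  apply (continuous_mult (K := R_AbsRing)); [|apply continuous_const].
  apply (@continuous_plus R_UniformSpace R_AbsRing R_NormedModule); auto.
  apply (continuous_comp _ Rabs); [exact Hc|apply continuous_Rabs].
Qed.

(* The powers of [1 + cos (t - t0) - cos del] are trigonometric polynomials that blow up near [t0]
   and stay bounded elsewhere. *)
Lemma trig_orth_not_pos h t0 : (forall t, continuous h t) -> trig_orth h ->
  0 < t0 < 2 * PI -> ~ 0 < h t0.
Proof.
  intros Hc Ho Ht0 Hpos. pose proof PI_RGT_0 as HPI.
  set (c := h t0 / 2).
  destruct (Hc t0 (fun z => c < z)) as [d0 Hd0].
  { exists (mkposreal c ltac:(unfold c; lra)). intros z Hz.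
    change (Rabs (z - h t0) < c) in Hz. apply Rabs_def2 in Hz. unfold c in *. lra. }
  (* [d0] keeps [h] above [c] near [t0], and 1 keeps [del] below [PI]. The distances to both
     endpoints keep the window inside the period and give [Rabs (t - t0) <= 2 * PI - del] on it, as
     [cos_le_outside] requires. *)
  set (del := Rmin (Rmin d0 1) (Rmin t0 (2 * PI - t0))).
  assert (Hdel : 0 < del /\ del <= d0 /\ del <= 1 /\ del <= t0 /\ del <= 2 * PI - t0).
  { unfold del. pose proof (cond_pos d0). unfold Rmin.
    repeat destruct Rle_dec; lra. }
  destruct Hdel as (HD0 & HD1 & HD2 & HD3 & HD4).
  assert (Hnear : forall t, 0 <= t <= 2 * PI -> cos del < cos (t - t0) -> c < h t).
  { intros t Ht Hcos. destruct (Rlt_dec (Rabs (t - t0)) del) as [Hlt|Hge].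
    - apply Hd0. change (Rabs (t - t0) < d0). lra.
    - exfalso. revert Hcos. apply Rle_not_lt. apply cos_le_outside; auto.
      + pose proof PI2_3_2; pose proof PI2_1; lra.
      + split; [lra|]. apply Rabs_le. lra. }
  destruct (continuity_ab_maj (fun t => Rabs (h t)) 0 (2 * PI)) as (tm & Hm & _); [lra| |].
  { intros t _. apply continuous_cont_pt, (continuous_comp h Rabs); auto.
    apply continuous_Rabs. }
  set (M := Rabs (h tm)) in *.
  assert (HM : 0 <= M) by apply Rabs_pos.
  assert (Hcpos : 0 < c) by (unfold c; lra).
  set (psi := fun t => Rmax 0 (cos (t - t0) - cos del)).
  assert (Hpsic : forall t, continuous psi t) by (intros; apply continuous_bump).
  assert (Hpsi0 : forall t, 0 <= psi t) by (intros; apply Rmax_l).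
  assert (Ipsi : 0 < RInt psi 0 (2 * PI)).
  { rewrite <- (RInt_Chasles psi 0 (t0 - del) (2 * PI)) by (apply ex_RInt_cont; auto).
    rewrite <- (RInt_Chasles psi (t0 - del) (t0 + del) (2 * PI)) by (apply ex_RInt_cont; auto).
    unfold plus; simpl.
    assert (0 <= RInt psi 0 (t0 - del)) by (apply RInt_ge_0; auto; [lra|apply ex_RInt_cont; auto]).
    assert (0 <= RInt psi (t0 + del) (2 * PI))
      by (apply RInt_ge_0; auto; [lra|apply ex_RInt_cont; auto]).
    assert (0 < RInt psi (t0 - del) (t0 + del)); [|lra].
    apply RInt_gt_0; auto; [lra|]. intros t Ht. unfold psi.
    eapply Rlt_le_trans; [|apply Rmax_r].
    assert (cos del < cos (t - t0)); [|lra].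
    replace (cos (t - t0)) with (cos (Rabs (t - t0))).
    - pose proof PI2_1. assert (Rabs (t - t0) < del) by (apply Rabs_def1; lra).
      pose proof (Rabs_pos (t - t0)). apply cos_decreasing_1; lra.
    - unfold Rabs. destruct Rcase_abs; auto. apply cos_neg. }
  (* Where [psi] is positive, Bernoulli's inequality bounds the [n]-th power from below by
     [INR n * psi]; elsewhere its base has modulus at most 1, so the integrand is at least [- M].
     The total integral is 0 for every [n], which bounds [n] by a constant. *)
  assert (Hn : forall n : nat, c * INR n * RInt psi 0 (2 * PI) <= 2 * PI * M).
  { intros n.
    pose proof (trig_orth_pow h (1 - cos del) t0 n Ho 0%Z) as [Hz0 _].
    assert (Hz : is_RInt (fun t => h t * (1 - cos del + cos (t - t0)) ^ n) 0 (2 * PI) 0).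
    { eapply is_RInt_ext; [|exact Hz0]. intros; simpl; rewrite Rmult_0_l, cos_0; ring. }
    assert (Hlow : RInt (fun t => c * INR n * psi t + - M) 0 (2 * PI) <= 0).
    { eapply Rle_trans; [|right; exact (is_RInt_unique _ _ _ _ Hz)]. apply RInt_le; [lra| |eexists; exact Hz|].
      - apply ex_RInt_cont. intros t.
        apply (@continuous_plus R_UniformSpace R_AbsRing R_NormedModule); [|apply continuous_const].
        apply (continuous_mult (K := R_AbsRing)); [apply continuous_const|auto].
      - intros t Ht. unfold psi.
        pose proof (COS_bound (t - t0)) as HC1. pose proof (COS_bound del) as HC2.
        destruct (Rlt_dec (cos del) (cos (t - t0))) as [Hlt|Hge].
        + rewrite Rmax_right by lra. pose proof (Hnear t ltac:(lra) Hlt).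
          pose proof (poly n (cos (t - t0) - cos del) ltac:(lra)) as HB.
          replace (1 + (cos (t - t0) - cos del)) with (1 - cos del + cos (t - t0)) in HB by ring.
          set (P := (1 - cos del + cos (t - t0)) ^ n) in *.
          set (X := INR n * (cos (t - t0) - cos del)) in *.
          assert (0 <= X) by (apply Rmult_le_pos; [apply pos_INR|lra]).
          apply Rle_trans with (c * P); [|nra].
          replace (c * INR n * (cos (t - t0) - cos del)) with (c * X) by (unfold X; ring). nra.
        + rewrite Rmax_left by lra. rewrite Rmult_0_r, Rplus_0_l.
          assert (HP : Rabs (h t * (1 - cos del + cos (t - t0)) ^ n) <= M).
          { rewrite Rabs_mult. rewrite <- (Rmult_1_r M).
            apply Rmult_le_compat; auto using Rabs_pos; [apply Hm; lra|].
            rewrite <- RPow_abs. apply Rle_trans with (1 ^ n); [|rewrite pow1; lra]. apply pow_incr.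
            split; [apply Rabs_pos|]. apply Rabs_le. lra. }
          apply Rabs_le_between in HP. lra. }
    rewrite (@RInt_plus R_CompleteNormedModule) in Hlow.
    - rewrite (@RInt_scal R_CompleteNormedModule psi) in Hlow by (apply ex_RInt_cont; auto).
      rewrite RInt_const in Hlow. unfold plus, scal in Hlow; simpl in Hlow.
      unfold mult in Hlow; simpl in Hlow. lra.
    - apply ex_RInt_cont. intros t.
      apply (continuous_mult (K := R_AbsRing)); [apply continuous_const|auto].
    - apply ex_RInt_cont. intros t. apply continuous_const. }
  assert (Hpos2 : 0 < c * RInt psi 0 (2 * PI)) by (apply Rmult_lt_0_compat; auto).
  destruct (INR_unbounded (2 * PI * M / (c * RInt psi 0 (2 * PI)))) as [n Hbig].
  specialize (Hn n). apply Rlt_div_l in Hbig; [|exact Hpos2]. lra.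
Qed.

(** Interior points follow from the previous lemma for [h] and [- h]. A nonzero value at an endpoint
    would persist, by continuity, at the interior point [s]. *)
Lemma trig_orth_zero h : (forall t, continuous h t) -> trig_orth h ->
  forall t, 0 <= t <= 2 * PI -> h t = 0.
Proof.
  intros Hc Ho.
  assert (Hopp : trig_orth (fun t => - h t)).
  { intros k. destruct (Ho k) as [H1 H2]. split.
    - eapply is_RInt_ext; [|exact (is_RInt_zero_comb _ _ _ _ _ (-1) 0 0 H1 H1 H1)].
      intros; simpl; ring.
    - eapply is_RInt_ext; [|exact (is_RInt_zero_comb _ _ _ _ _ (-1) 0 0 H2 H2 H2)].
      intros; simpl; ring. }
  assert (Hcopp : forall t, continuous (fun t => - h t) t).
  { intros t. apply (@continuous_opp R_UniformSpace R_AbsRing R_NormedModule), Hc. }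
  assert (Hin : forall t, 0 < t < 2 * PI -> h t = 0).
  { intros t Ht. pose proof (trig_orth_not_pos h t Hc Ho Ht).
    pose proof (trig_orth_not_pos _ t Hcopp Hopp Ht). lra. }
  intros t Ht. pose proof PI_RGT_0 as HPI.
  destruct (Req_dec (h t) 0) as [|Hne]; auto. exfalso.
  destruct (Hc t (fun z => z <> 0)) as [e He].
  { exists (mkposreal (Rabs (h t)) (Rabs_pos_lt _ Hne)). intros z Hz ->.
    change (Rabs (0 - h t) < Rabs (h t)) in Hz.
    rewrite Rminus_0_l, Rabs_Ropp in Hz. lra. }
  pose proof (cond_pos e) as Hep.
  set (s := if Rlt_dec t PI then t + Rmin e 1 / 2 else t - Rmin e 1 / 2).
  assert (Hm : 0 < Rmin e 1 <= e /\ Rmin e 1 <= 1).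
  { unfold Rmin; destruct Rle_dec; lra. }
  pose proof PI2_3_2; pose proof PI2_1.
  apply (He s); [|apply Hin].
  - change (Rabs (s - t) < e). unfold s. destruct Rlt_dec; apply Rabs_def1; lra.
  - unfold s. destruct Rlt_dec; lra.
Qed.

Lemma ccont_inner d F : ccont (S d) F -> forall t, ccont d (fun xs => F (t :: xs)).
Proof. intros [H1 H2] t. split; [apply (cont_slice _ _ t H1)|apply (cont_slice _ _ t H2)]. Qed.

Lemma integ_slice_charac d F k1 k t : ccont (S d) F -> length k = d ->
  let G := fun xs => (F (t :: xs) * Cconj (charac k xs))%C in
  integ d (fun xs => Re (F (t :: xs) * Cconj (charac (k1 :: k) (t :: xs)))%C)
    = integ d (fun xs => Re (G xs)) * cos (IZR k1 * t)
      + integ d (fun xs => Im (G xs)) * sin (IZR k1 * t) /\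
  integ d (fun xs => Im (F (t :: xs) * Cconj (charac (k1 :: k) (t :: xs)))%C)
    = integ d (fun xs => Im (G xs)) * cos (IZR k1 * t)
      - integ d (fun xs => Re (G xs)) * sin (IZR k1 * t).
Proof.
  intros HF Hk G.
  assert (HG : ccont d G).
  { apply ccont_mult; [apply ccont_inner, HF|apply ccont_conj, ccont_charac_len, Hk]. }
  destruct HG as [G1 G2]. split.
  - rewrite (Rmult_comm (integ d _)), (Rmult_comm (integ d (fun xs => Im (G xs)))).
    rewrite <- !integ_scal, <- integ_plus by auto using cont_scal.
    apply integ_ext. intros x _. unfold G. rewrite charac_cons, Cmult_conj.
    unfold cexpi, Re, Im; simpl. ring.
  - rewrite (Rmult_comm (integ d _)), (Rmult_comm (integ d (fun xs => Re (G xs)))).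
    unfold Rminus. rewrite Ropp_mult_distr_l.
    rewrite <- !integ_scal, <- integ_plus by auto using cont_scal.
    apply integ_ext. intros x _. unfold G. rewrite charac_cons, Cmult_conj.
    unfold cexpi, Re, Im; simpl. ring.
Qed.

Lemma mean_zero_integ d F : mean d F = 0 -> integ d F = 0.
Proof.
  unfold mean. intros H. apply Rmult_integral in H. destruct H as [|H]; auto.
  exfalso. revert H. apply Rinv_neq_0_compat, pow_nonzero. pose proof two_PI_pos; lra.
Qed.

(** Induction on the dimension. For fixed [k], the coefficient of a slice of [F] is, up to the
    normalization, a function [a + i b] of the first variable all of whose Fourier coefficients
    vanish. Hence it is zero, and the induction hypothesis applies to every slice. *)
Lemma fourier_uniqueness d : forall F, ccont d F ->
  (forall k, length k = d -> fhat d F k = RtoC 0) ->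
  forall x, length x = d -> in_box x -> F x = RtoC 0.
Proof.
  induction d as [|d IH]; intros F HF H0 x Hx Hb.
  - destruct x; [|discriminate]. specialize (H0 [] eq_refl).
    rewrite fhat_cmean in H0. rewrite (cmean_ext _ _ (fun _ => F [])) in H0.
    + rewrite cmean_const in H0. exact H0.
    + intros [|] Hy; [|discriminate]. apply C_eq; unfold charac, cexpi; simpl;
        rewrite cos_0, sin_0; unfold Re, Im; ring.
  - destruct x as [|t x]; [discriminate|]. inversion Hb; subst.
    apply (IH (fun xs => F (t :: xs))); auto; [apply ccont_inner, HF|].
    intros k Hk.
    set (a := fun t => integ d (fun xs => Re (F (t :: xs) * Cconj (charac k xs))%C)).
    set (b := fun t => integ d (fun xs => Im (F (t :: xs) * Cconj (charac k xs))%C)).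
    assert (HC : ccont (S d) (fun x => F x * Cconj (charac k (tl x)))%C).
    { apply ccont_mult; auto. apply ccont_conj.
      destruct (ccont_charac_len d k Hk) as [K1 K2].
      split; [apply (cont_tl _ _ K1)|apply (cont_tl _ _ K2)]. }
    assert (Ca : forall t, continuous a t) by (apply (cont_inner d _ (proj1 HC))).
    assert (Cb : forall t, continuous b t) by (apply (cont_inner d _ (proj2 HC))).
    assert (Exc : forall g k1, (forall t, continuous g t) ->
       is_RInt (fun t => g t * cos (IZR k1 * t)) 0 (2 * PI)
               (RInt (fun t => g t * cos (IZR k1 * t)) 0 (2 * PI))).
    { intros g k1 Hg. apply (RInt_correct (V := R_CompleteNormedModule)), ex_RInt_cont.
      intros u. apply (continuous_mult (K := R_AbsRing)); [auto|apply continuous_cos_lin]. }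
    assert (Exs : forall g k1, (forall t, continuous g t) ->
       is_RInt (fun t => g t * sin (IZR k1 * t)) 0 (2 * PI)
               (RInt (fun t => g t * sin (IZR k1 * t)) 0 (2 * PI))).
    { intros g k1 Hg. apply (RInt_correct (V := R_CompleteNormedModule)), ex_RInt_cont.
      intros u. apply (continuous_mult (K := R_AbsRing)); [auto|apply continuous_sin_lin]. }
    assert (Hsum : forall k1,
      RInt (fun t => a t * cos (IZR k1 * t)) 0 (2 * PI)
      + RInt (fun t => b t * sin (IZR k1 * t)) 0 (2 * PI) = 0 /\
      RInt (fun t => b t * cos (IZR k1 * t)) 0 (2 * PI)
      - RInt (fun t => a t * sin (IZR k1 * t)) 0 (2 * PI) = 0).
    { intros k1. specialize (H0 (k1 :: k) ltac:(simpl; lia)).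
      pose proof (f_equal Re H0) as R0. pose proof (f_equal Im H0) as I0.
      unfold fhat in R0, I0. simpl in R0, I0. apply mean_zero_integ in R0, I0.
      simpl in R0, I0. split.
      - pose proof (is_RInt_plus _ _ _ _ _ _ (Exc a k1 Ca) (Exs b k1 Cb)) as E.
        apply (@is_RInt_unique R_CompleteNormedModule) in E. etransitivity; [symmetry; exact E|]. etransitivity; [|exact R0].
        apply RInt_ext. intros u _. symmetry. apply (integ_slice_charac d F k1 k u HF Hk).
      - pose proof (is_RInt_minus _ _ _ _ _ _ (Exc b k1 Cb) (Exs a k1 Ca)) as E.
        apply (@is_RInt_unique R_CompleteNormedModule) in E. etransitivity; [symmetry; exact E|].
        etransitivity; [|exact I0].
        apply RInt_ext. intros u _. symmetry. apply (integ_slice_charac d F k1 k u HF Hk). }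
    assert (Hneg : forall g k1,
      RInt (fun t => g t * cos (IZR (- k1) * t)) 0 (2 * PI)
        = RInt (fun t => g t * cos (IZR k1 * t)) 0 (2 * PI) /\
      RInt (fun t => g t * sin (IZR (- k1) * t)) 0 (2 * PI)
        = - RInt (fun t => g t * sin (IZR k1 * t)) 0 (2 * PI) \/ ~ forall t, continuous g t).
    { intros g k1. destruct (classic (forall t, continuous g t)) as [Hg|Hg]; [left|auto].
      split.
      - apply RInt_ext. intros u _. rewrite opp_IZR, Ropp_mult_distr_l_reverse, cos_neg. auto.
      - pose proof (is_RInt_opp _ _ _ _ (Exs g k1 Hg)) as E. apply (@is_RInt_unique R_CompleteNormedModule) in E.
        etransitivity; [|exact E]. apply RInt_ext. intros u _.
        rewrite opp_IZR, Ropp_mult_distr_l_reverse, sin_neg.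
        symmetry. apply Ropp_mult_distr_r. }
    (* Each complex equation mixes a cosine integral with a sine integral; the equations at [k1] and
       [- k1] together separate them. *)
    assert (Ha : trig_orth a /\ trig_orth b).
    { split; intros k1; pose proof (Hsum k1) as [E1 E2]; pose proof (Hsum (- k1)%Z) as [E3 E4];
        destruct (Hneg a k1) as [[N1 N2]|]; try tauto;
        destruct (Hneg b k1) as [[N3 N4]|]; try tauto;
        rewrite ?N1, ?N2, ?N3, ?N4 in E3, E4; split.
      - replace 0 with (RInt (fun t => a t * cos (IZR k1 * t)) 0 (2 * PI)) at 2 by lra. auto.
      - replace 0 with (RInt (fun t => a t * sin (IZR k1 * t)) 0 (2 * PI)) at 2 by lra. auto.
      - replace 0 with (RInt (fun t => b t * cos (IZR k1 * t)) 0 (2 * PI)) at 2 by lra. auto.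
      - replace 0 with (RInt (fun t => b t * sin (IZR k1 * t)) 0 (2 * PI)) at 2 by lra. auto. }
    unfold fhat. apply C_eq; simpl; unfold mean.
    + change (a t / (2 * PI) ^ d = 0). rewrite (trig_orth_zero a); auto; [|apply Ha].
      unfold Rdiv; ring.
    + change (b t / (2 * PI) ^ d = 0). rewrite (trig_orth_zero b); auto; [|apply Ha].
      unfold Rdiv; ring.
Qed.

(** * Moments of polynomials with frequencies in one layer *)

(** The number of binary digits of [Z.abs z], which is the index of the dyadic block containing [z].
    Layers thus become level sets of the sum [lev]. *)
Definition bits (z : Z) : nat := if Z.eq_dec z 0 then 0%nat else S (Z.to_nat (Z.log2 (Z.abs z))).

Lemma in_rho1_list s z : In z (rho1_list s) <-> bits z = s.
Proof.
  unfold rho1_list, bits. rewrite filter_In, in_map_iff, Bool.andb_true_iff, Z.leb_le, Z.ltb_lt.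
  assert (Hp : (0 < 2 ^ Z.of_nat s)%Z) by (apply Z.pow_pos_nonneg; lia).
  transitivity (lowb s <= Z.abs z < 2 ^ Z.of_nat s)%Z.
  { split; [tauto|]. intros H. split; auto.
    exists (Z.to_nat (z + 2 ^ Z.of_nat s)). split; [lia|]. apply in_seq. lia. }
  destruct (Z.eq_dec z 0) as [->|Hz].
  - destruct s as [|s]; simpl lowb; [simpl; split; auto; lia|].
    split; [|discriminate]. assert (0 < 2 ^ Z.of_nat s)%Z by (apply Z.pow_pos_nonneg; lia). lia.
  - destruct s as [|s]; simpl lowb; [simpl; split; [lia|discriminate]|].
    pose proof (Z.log2_nonneg (Z.abs z)). split.
    + intros [H1 H2]. f_equal. rewrite Nat2Z.inj_succ in H2.
      assert (Z.log2 (Z.abs z) = Z.of_nat s) by (apply Z.log2_unique; lia). lia.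
    + intros E. injection E as E. subst s. rewrite Nat2Z.inj_succ, Z2Nat.id by lia.
      apply Z.log2_spec. lia.
Qed.

Lemma NoDup_rho1_list s : NoDup (rho1_list s).
Proof.
  apply NoDup_filter. apply FinFun.Injective_map_NoDup; [|apply seq_NoDup].
  intros a b H. lia.
Qed.

Lemma length_rho1_list s : INR (length (rho1_list s)) <= 3 * 2 ^ s.
Proof.
  unfold rho1_list.
  apply Rle_trans with (INR (2 * 2 ^ s + 1)).
  - apply le_INR. eapply Nat.le_trans; [apply filter_length_le|].
    rewrite length_map, length_seq.
    replace 2%Z with (Z.of_nat 2) by reflexivity. rewrite <- Nat2Z.inj_pow. lia.
  - rewrite plus_INR, mult_INR, pow_INR. simpl (INR 2). simpl (INR 1).
    pose proof (pow_R1_Rle 2 s ltac:(lra)). replace (1 + 1) with 2 by ring. lra.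
Qed.

Definition lev (k : list Z) : nat := fold_right (fun z a => (bits z + a)%nat) 0%nat k.
Definition layer (d j : nat) : list (list Z) := flat_map rho_list (comps d j).

Lemma in_comps d : forall j s, In s (comps d j) <->
  length s = d /\ fold_right Nat.add 0%nat s = j.
Proof.
  induction d as [|d IH]; intros j s; simpl.
  - destruct (Nat.eqb_spec j 0) as [->|Hj]; simpl.
    + split; [intros [<-|[]]; auto|]. intros [H1 H2]. destruct s; [auto|discriminate].
    + split; [tauto|]. intros [H1 H2]. destruct s; [simpl in *; congruence|discriminate].
  - split.
    + intros H. apply (in_flat_map (fun i => map (cons i) (comps d (j - i))) (seq 0 (S j))) in H.
      destruct H as (i & Hi & Hs). apply in_map_iff in Hs. destruct Hs as (u & <- & Hu).
      apply IH in Hu. apply in_seq in Hi. simpl. lia.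
    + intros [H1 H2]. destruct s as [|i s]; [discriminate|]. simpl in H1, H2.
      apply (in_flat_map (fun i => map (cons i) (comps d (j - i))) (seq 0 (S j))).
      exists i. split; [apply in_seq; lia|]. apply in_map, IH. lia.
Qed.

Lemma NoDup_comps d : forall j, NoDup (comps d j).
Proof.
  induction d as [|d IH]; intros j; simpl.
  - destruct (Nat.eqb j 0); repeat constructor; auto.
  - apply (NoDup_flat_map (fun i => map (cons i) (comps d (j - i))) (seq 0 (S j))).
    + apply seq_NoDup.
    + intros a _. apply FinFun.Injective_map_NoDup; auto. intros u v E; congruence.
    + intros a a' b _ _ Hb Hb'. apply in_map_iff in Hb, Hb'.
      destruct Hb as (u & <- & _), Hb' as (v & E & _). congruence.
Qed.

Lemma length_comps d j : (length (comps (S d) j) <= (j + 1) ^ d)%nat.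
Proof.
  revert j. induction d as [|d IH]; intros j.
  - apply (NoDup_incl_length (l' := [[j]]) (NoDup_comps 1 j)).
    intros s Hs. apply in_comps in Hs. destruct Hs as [H1 H2].
    destruct s as [|i [|]]; try discriminate. simpl in H2. left. f_equal. lia.
  - change (comps (S (S d)) j)
      with (flat_map (fun i => map (cons i) (comps (S d) (j - i))) (seq 0 (S j))).
    assert (H : forall l, (length (flat_map (fun i => map (cons i) (comps (S d) (j - i))) l)
              <= length l * (j + 1) ^ d)%nat).
    { induction l as [|i l IHl]; [simpl; lia|]. cbn [flat_map].
      rewrite length_app, length_map. cbn [length]. rewrite Nat.mul_succ_l.
      assert (length (comps (S d) (j - i)) <= (j + 1) ^ d)%nat.
      { eapply Nat.le_trans; [apply IH|]. apply Nat.pow_le_mono_l. lia. }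
      lia. }
    eapply Nat.le_trans; [apply H|]. rewrite length_seq. simpl. lia.
Qed.

Lemma rho_list_cart s : rho_list s = cart (map rho1_list s).
Proof. induction s as [|a s IH]; simpl; [reflexivity|]. rewrite IH. reflexivity. Qed.

Lemma in_rho_list s k : In k (rho_list s) <-> map bits k = s.
Proof.
  rewrite rho_list_cart, in_cart. revert k. induction s as [|a s IH]; intros k; simpl.
  - split; [inversion 1; auto|]. destruct k; [constructor|discriminate].
  - split.
    + inversion 1; subst. simpl. f_equal; [apply in_rho1_list; auto|apply IH; auto].
    + destruct k as [|z k]; [discriminate|]. simpl. intros E. injection E as E1 E2.
      constructor; [apply in_rho1_list; auto|apply IH; auto].
Qed.

Lemma in_layer d j k : In k (layer d j) <-> length k = d /\ lev k = j.
Proof.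
  unfold layer. rewrite in_flat_map.
  assert (E : forall k, lev k = fold_right Nat.add 0%nat (map bits k)).
  { induction k0; simpl; auto. }
  rewrite E. split.
  - intros (s & Hs & Hk). apply in_rho_list in Hk. subst s. apply in_comps in Hs.
    rewrite length_map in Hs. exact Hs.
  - intros H. exists (map bits k). rewrite in_comps, length_map, in_rho_list. auto.
Qed.

Lemma NoDup_layer d j : NoDup (layer d j).
Proof.
  apply NoDup_flat_map; [apply NoDup_comps| |].
  - intros s _. rewrite rho_list_cart. apply NoDup_cart. apply List.Forall_map.
    apply List.Forall_forall. intros; apply NoDup_rho1_list.
  - intros a a' k _ _ H1 H2. apply in_rho_list in H1, H2. congruence.
Qed.

Lemma length_rho_list s :
  INR (length (rho_list s)) <= 3 ^ length s * 2 ^ (fold_right Nat.add 0%nat s).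
Proof.
  induction s as [|a s IH]; simpl rho_list; [simpl; lra|].
  rewrite (flat_map_constant_length (c := length (rho_list s)))
    by (intros; apply length_map).
  rewrite mult_INR. simpl. rewrite pow_add.
  eapply Rle_trans; [apply Rmult_le_compat; [apply pos_INR|apply pos_INR|apply length_rho1_list|apply IH]|].
  right; ring.
Qed.

Lemma length_layer d j :
  INR (length (layer (S d) j)) <= 3 ^ S d * INR (j + 1) ^ d * 2 ^ j.
Proof.
  assert (H : forall l, (forall s, In s l -> length s = S d /\ fold_right Nat.add 0%nat s = j) ->
     INR (length (flat_map rho_list l)) <= INR (length l) * (3 ^ S d * 2 ^ j)).
  { induction l as [|s l IH]; intros Hl; [simpl; lra|]. simpl flat_map.
    rewrite length_app, plus_INR. simpl (length (s :: l)). rewrite S_INR.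
    destruct (Hl s (in_eq _ _)) as [E1 E2]. pose proof (length_rho_list s) as Hs.
    rewrite E1, E2 in Hs. specialize (IH (fun s Hs => Hl s (in_cons _ _ _ Hs))). lra. }
  eapply Rle_trans; [apply H; intros s Hs; apply in_comps, Hs|].
  replace (3 ^ S d * INR (j + 1) ^ d * 2 ^ j)
    with (INR (j + 1) ^ d * (3 ^ S d * 2 ^ j)) by ring.
  apply Rmult_le_compat_r.
  - apply Rmult_le_pos; apply pow_le; lra.
  - rewrite <- pow_INR. apply le_INR, length_comps.
Qed.

Lemma fblock_trigpoly d f j x : fblock d f j x = trigpoly (layer d j) (fhat d f) x.
Proof. unfold fblock, delta, trigpoly, layer. rewrite Csum_flat_map. reflexivity. Qed.

(** A bound for the norm in the Wiener algebra. The witnessing list may repeat frequencies, so sums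
    and products need no collecting of terms. *)
Definition expsum (d : nat) (A : R) (F : list R -> C) : Prop :=
  exists T : list (C * list Z), (forall a, In a T -> length (snd a) = d) /\
    Rsum T (fun a => Cmod (fst a)) <= A /\
    forall x, F x = Csum T (fun a => fst a * charac (snd a) x)%C.

Lemma expsum_plus d A B F G : expsum d A F -> expsum d B G ->
  expsum d (A + B) (fun x => F x + G x)%C.
Proof.
  intros (T & H1 & H2 & H3) (T' & H1' & H2' & H3'). exists (T ++ T'). repeat split.
  - intros a Ha. apply in_app_or in Ha. destruct Ha; auto.
  - rewrite Rsum_app. lra.
  - intros x. rewrite H3, H3', Csum_app. reflexivity.
Qed.

Lemma expsum_mult d A B F G : expsum d A F -> expsum d B G ->
  expsum d (A * B) (fun x => F x * G x)%C.
Proof.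
  intros (T & H1 & H2 & H3) (T' & H1' & H2' & H3').
  exists (flat_map (fun a => map (fun b => ((fst a * fst b)%C, zadd (snd a) (snd b))) T') T).
  repeat split.
  - intros a Ha. apply in_flat_map in Ha. destruct Ha as (u & Hu & Ha).
    apply in_map_iff in Ha. destruct Ha as (w & <- & Hw). simpl.
    rewrite length_zadd, (H1' w Hw); [reflexivity|]. rewrite (H1 u Hu), (H1' w Hw). reflexivity.
  - rewrite Rsum_flat_map.
    rewrite (Rsum_ext _ _ (fun a => Rsum T' (fun b => Cmod (fst b)) * Cmod (fst a))).
    + rewrite Rsum_scal. rewrite Rmult_comm.
      apply Rmult_le_compat; auto; apply Rsum_ge0; intros; apply Cmod_ge_0.
    + intros a _. rewrite Rsum_map. simpl.
      rewrite (Rsum_ext _ _ (fun b => Cmod (fst a) * Cmod (fst b))) by (intros; apply Cmod_mult).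
      rewrite Rsum_scal. ring.
  - intros x. rewrite H3, H3', Csum_mult, Csum_flat_map. apply Csum_ext. intros a Ha.
    rewrite Csum_map. apply Csum_ext. intros b Hb. simpl.
    rewrite charac_zadd by (rewrite (H1 a Ha), (H1' b Hb); reflexivity). ring.
Qed.

Lemma expsum_const d c : expsum d (Cmod c) (fun _ => c).
Proof.
  exists [(c, repeat 0%Z d)]. repeat split.
  - intros a [<-|[]]. apply repeat_length.
  - simpl. lra.
  - intros x. simpl. rewrite charac_zero. ring.
Qed.

Lemma expsum_le d A B F : A <= B -> expsum d A F -> expsum d B F.
Proof. intros H (T & H1 & H2 & H3). exists T. repeat split; auto. lra. Qed.

Lemma expsum_ext d A F G : (forall x, F x = G x) -> expsum d A F -> expsum d A G.
Proof. intros H (T & H1 & H2 & H3). exists T. repeat split; auto. intros; rewrite <- H; auto. Qed.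

Lemma expsum_pow d A F n : expsum d A F -> expsum d (A ^ n) (fun x => F x ^ n)%C.
Proof.
  intros H. induction n as [|n IH]; simpl.
  - apply expsum_le with (2 := expsum_const d (RtoC 1)). rewrite Cmod_1; lra.
  - apply expsum_mult; auto.
Qed.

Lemma expsum_ccont d A F : expsum d A F -> ccont d F.
Proof.
  intros (T & H1 & H2 & H3). eapply ccont_ext; [intros; symmetry; apply H3|].
  apply ccont_trig, H1.
Qed.

(** In [vpoly_moment] the difference [F - G] is a multiple of a single kernel [dker], so pulling it
    out leaves a factor [Q] of which only the l1 norm matters. *)
Lemma expsum_pow_diff d A F G n : expsum d A F -> expsum d A G ->
  exists Q, expsum d (INR (n + 1) * A ^ n) Q /\
    forall x, (F x ^ (n + 1) - G x ^ (n + 1) = (F x - G x) * Q x)%C.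
Proof.
  intros HF HG. induction n as [|n IH].
  - exists (fun _ => RtoC 1). split.
    + apply expsum_le with (2 := expsum_const d (RtoC 1)). rewrite Cmod_1. simpl. lra.
    + intros x. simpl. ring.
  - destruct IH as (Q & HQ & E). exists (fun x => F x ^ (n + 1) + G x * Q x)%C. split.
    + eapply expsum_le; [|apply expsum_plus; [apply expsum_pow, HF|apply expsum_mult; [apply HG|apply HQ]]].
      right. replace (INR (S n + 1)) with (INR (n + 1) + 1) by (rewrite <- S_INR; f_equal).
      rewrite pow_add. simpl. ring.
    + intros x. specialize (E x). simpl.
      replace (F x * F x ^ (n + 1) - G x * G x ^ (n + 1))%C
        with ((F x - G x) * F x ^ (n + 1) + G x * (F x ^ (n + 1) - G x ^ (n + 1)))%C by ring.
      rewrite E. ring.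
Qed.

Definition dker (s : nat) (x : list R) : C := Csum (rho1_list s) (fun z => charac [z] x).

Lemma dker_real s x : Cconj (dker s x) = dker s x.
Proof.
  unfold dker. rewrite Cconj_Csum.
  rewrite (Csum_perm (rho1_list s) (map Z.opp (rho1_list s)) (fun z => charac [z] x)).
  - rewrite Csum_map. apply Csum_ext. intros z _. rewrite <- charac_opp. reflexivity.
  - apply NoDup_Permutation; [apply NoDup_rho1_list| |].
    + apply FinFun.Injective_map_NoDup; [intros a b; lia|apply NoDup_rho1_list].
    + assert (E : forall z, bits (- z) = bits z).
      { intros z. unfold bits. rewrite Z.abs_opp.
        destruct (Z.eq_dec (- z) 0), (Z.eq_dec z 0); auto; lia. }
      intros z. rewrite in_map_iff, in_rho1_list. split.
      * intros H. exists (- z)%Z. rewrite in_rho1_list, E. split; auto. lia.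
      * intros (u & <- & Hu). apply in_rho1_list in Hu. rewrite E. auto.
Qed.

Lemma expsum_dker s : expsum 1 (3 * 2 ^ s) (dker s).
Proof.
  exists (map (fun z => (RtoC 1, [z])) (rho1_list s)). repeat split.
  - intros a Ha. apply in_map_iff in Ha. destruct Ha as (z & <- & _). reflexivity.
  - rewrite Rsum_map. simpl. rewrite Cmod_1, Rsum_const. pose proof (length_rho1_list s). lra.
  - intros x. rewrite Csum_map. apply Csum_ext. intros; simpl; ring.
Qed.

(** The mean sums the coefficients of [F] over one block, symmetric under negation. Its size is at
    most the l1 norm of [F], without the factor [3 * 2 ^ s] that [expsum_mult] would charge for the
    kernel. *)
Lemma cmean_dker_le s A F : expsum 1 A F -> Cmod (cmean 1 (fun x => dker s x * F x)%C) <= A.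
Proof.
  intros (T & H1 & H2 & H3).
  rewrite (cmean_ext _ _ (fun x => Csum T (fun a => fst a * charac (snd a) x)%C
     * Cconj (Csum (rho1_list s) (fun z => RtoC 1 * charac [z] x)%C))%C).
  - rewrite (cmean_trig_pairing 1 T (rho1_list s) snd (fun z => [z]) fst (fun _ => RtoC 1))
      by (auto; reflexivity).
    eapply Rle_trans; [apply Cmod_Csum|]. eapply Rle_trans; [|exact H2].
    apply Rsum_le. intros a Ha.
    destruct (classic (exists z, In z (rho1_list s) /\ snd a = [z])) as [(z & Hz & E)|HN].
    + rewrite (Csum_single z); auto using NoDup_rho1_list.
      * rewrite E. destruct (zl_eq_dec _ _); [|congruence].
        rewrite !Cmod_mult, Cmod_conj, !Cmod_1. lra.
      * intros b Hb Hne. rewrite E. destruct (zl_eq_dec _ _); [congruence|]. ring.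
    + rewrite Csum_zero; [rewrite Cmod_0; apply Cmod_ge_0|].
      intros b Hb. destruct (zl_eq_dec _ _); [exfalso; eauto|]. ring.
  - intros x _. rewrite H3, Cmult_comm. f_equal. rewrite <- (dker_real s x). f_equal.
    apply Csum_ext. intros; ring.
Qed.

(* [vpoly] is the factor of the majorant, in one variable; on [layer d j] a product of [d] such
   weights equals [q ^ j]. *)
Definition vlist (t : nat) : list Z := flat_map rho1_list (seq 0 (S t)).
Definition vpoly (q : R) (t : nat) (x : list R) : C :=
  Csum (vlist t) (fun z => RtoC (q ^ bits z) * charac [z] x)%C.

Lemma in_vlist t z : In z (vlist t) <-> (bits z <= t)%nat.
Proof.
  unfold vlist. rewrite in_flat_map. split.
  - intros (s & Hs & Hz). apply in_seq in Hs. apply in_rho1_list in Hz. lia.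
  - intros H. exists (bits z). rewrite in_seq, in_rho1_list. split; auto; lia.
Qed.

Lemma NoDup_vlist t : NoDup (vlist t).
Proof.
  apply NoDup_flat_map; [apply seq_NoDup|intros; apply NoDup_rho1_list|].
  intros a a' b _ _ H1 H2. apply in_rho1_list in H1, H2. congruence.
Qed.

Lemma Csum_rho1_weight q s x :
  Csum (rho1_list s) (fun z => RtoC (q ^ bits z) * charac [z] x)%C = (RtoC (q ^ s) * dker s x)%C.
Proof.
  unfold dker. rewrite <- Csum_scal. apply Csum_ext. intros z Hz.
  apply in_rho1_list in Hz. rewrite Hz. reflexivity.
Qed.

Lemma vpoly_0 q x : vpoly q 0 x = dker 0 x.
Proof.
  unfold vpoly, vlist. cbn [seq flat_map]. rewrite app_nil_r, Csum_rho1_weight.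
  change (q ^ 0) with 1. ring.
Qed.

Lemma vpoly_S q t x : vpoly q (S t) x = (vpoly q t x + RtoC (q ^ S t) * dker (S t) x)%C.
Proof.
  unfold vpoly, vlist. rewrite seq_S, flat_map_app, Csum_app. f_equal. cbn [flat_map].
  rewrite app_nil_r, Csum_rho1_weight. reflexivity.
Qed.

Lemma vpoly_real q t x : Cconj (vpoly q t x) = vpoly q t x.
Proof.
  induction t as [|t IH]; [rewrite vpoly_0; apply dker_real|].
  rewrite vpoly_S, Cplus_conj, Cmult_conj, IH, dker_real. f_equal. f_equal.
  apply C_eq; simpl; ring.
Qed.

(** With [q = y / 2], block [s] contributes at most [3 * y ^ s]: a geometric sum dominated by its
    last term. *)
Lemma expsum_vpoly y t : 1 < y -> expsum 1 (3 * y / (y - 1) * y ^ t) (vpoly (y / 2) t).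
Proof.
  intros Hy. induction t as [|t IH].
  - eapply expsum_ext; [intros; symmetry; apply vpoly_0|].
    eapply expsum_le; [|apply expsum_dker]. simpl.
    apply Rmult_le_reg_r with (y - 1); [lra|]. field_simplify; lra.
  - eapply expsum_ext; [intros; symmetry; apply vpoly_S|].
    eapply expsum_le; [|apply expsum_plus; [exact IH|apply expsum_mult; [apply expsum_const|apply expsum_dker]]].
    rewrite Cmod_R, Rabs_pos_eq by (apply pow_le; lra).
    unfold Rdiv at 2. rewrite Rpow_mult_distr, pow_inv.
    pose proof (pow_lt 2 (S t) ltac:(lra)). pose proof (pow_lt y t ltac:(lra)).
    replace (y ^ S t * / 2 ^ S t * (3 * 2 ^ S t)) with (3 * y ^ S t) by (field; lra).
    apply Req_le. simpl. field. lra.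
Qed.

(** The moments telescope in [t]. Passing to [t + 1] adds the mean of
    [(y / 2) ^ (t + 1) * dker (t + 1)] times a sum of l1 norm [2 r (A y ^ (t + 1)) ^ (2 r - 1)]. The
    choice [y ^ (2 r) = 2] cancels the powers of [y] against those of 2, so every step costs the
    same constant. *)
Lemma vpoly_moment r : (1 <= r)%nat -> exists y K, 1 < y /\ y ^ (2 * r) = 2 /\ 1 <= K /\
  forall t, mean 1 (fun x => Cmod (vpoly (y / 2) t x) ^ (2 * r)) <= K * INR (t + 1).
Proof.
  intros Hr. set (y := Rpower 2 (/ INR (2 * r))).
  assert (HR : 0 < INR (2 * r)) by (apply lt_0_INR; lia).
  assert (Hy2 : y ^ (2 * r) = 2).
  { unfold y. rewrite <- Rpower_pow by apply exp_pos. rewrite Rpower_mult.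
    rewrite Rinv_l by lra. apply Rpower_1. lra. }
  assert (Hy : 1 < y).
  { unfold y. rewrite <- (Rpower_O 2) by lra. apply Rpower_lt; [lra|].
    apply Rinv_0_lt_compat, HR. }
  set (A := 3 * y / (y - 1)).
  assert (HA : 3 <= A).
  { unfold A. apply Rmult_le_reg_r with (y - 1); [lra|]. field_simplify; lra. }
  exists y, (3 ^ (2 * r) + INR (2 * r) * A ^ (2 * r - 1)).
  assert (HP0 : 1 <= 3 ^ (2 * r)) by (apply pow_R1_Rle; lra).
  assert (HP1 : 0 <= INR (2 * r) * A ^ (2 * r - 1)).
  { apply Rmult_le_pos; [lra|apply pow_le; lra]. }
  split; [exact Hy|]. split; [exact Hy2|]. split; [lra|].
  (* [vpoly] is real, so its even moments are means of plain powers, to which the factorization of a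
     difference of powers applies. *)
  assert (Hre : forall t x, Cmod (vpoly (y / 2) t x) ^ (2 * r) = Re (vpoly (y / 2) t x ^ (2 * r))%C).
  { intros t x. rewrite pow_mult. rewrite Cpow_mult_r.
    replace (vpoly (y / 2) t x ^ 2)%C with (RtoC (Cmod (vpoly (y / 2) t x) ^ 2)).
    - rewrite <- RtoC_pow. reflexivity.
    - rewrite Cmod2_conj, vpoly_real. simpl. ring. }
  assert (Hce : forall t, ccont 1 (vpoly (y / 2) t)).
  { intros t. eapply expsum_ccont. apply expsum_vpoly, Hy. }
  induction t as [|t IH].
  - simpl (INR (0 + 1)). rewrite Rmult_1_r.
    apply Rle_trans with (mean 1 (fun _ => 3 ^ (2 * r))).
    + apply mean_le; [|apply cont_const|].
      * apply cont_pow, cont_Cmod, Hce.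
      * intros x _ _. apply pow_incr. split; [apply Cmod_ge_0|]. rewrite vpoly_0.
        unfold dker. eapply Rle_trans; [apply Cmod_Csum|].
        rewrite (Rsum_ext _ _ (fun _ => 1)) by (intros; apply Cmod_charac).
        rewrite Rsum_const. pose proof (length_rho1_list 0). simpl in *. lra.
    + rewrite mean_const. lra.
  - set (B := A * y ^ S t).
    assert (E0 : expsum 1 B (vpoly (y / 2) t)).
    { eapply expsum_le; [|apply expsum_vpoly, Hy]. fold A. apply Rmult_le_compat_l; [lra|].
      apply Rle_pow; [lra|lia]. }
    assert (E1 : expsum 1 B (vpoly (y / 2) (S t))) by (apply expsum_vpoly, Hy).
    destruct (expsum_pow_diff 1 B _ _ (2 * r - 1) E1 E0) as (Sx & HS & ES).
    replace (2 * r - 1 + 1)%nat with (2 * r)%nat in * by lia.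
    assert (Hdiff : mean 1 (fun x => Cmod (vpoly (y / 2) (S t) x) ^ (2 * r))
      - mean 1 (fun x => Cmod (vpoly (y / 2) t x) ^ (2 * r))
      = Re (RtoC ((y / 2) ^ S t) * cmean 1 (fun x => dker (S t) x * Sx x)%C)%C).
    { rewrite <- mean_minus by (apply cont_pow, cont_Cmod, Hce).
      rewrite <- cmean_scal.
      - apply mean_ext. intros x _. rewrite !Hre, <- Re_minus, ES, vpoly_S. f_equal. ring.
      - apply ccont_mult; [eapply expsum_ccont, expsum_dker|eapply expsum_ccont, HS]. }
    pose proof (cmean_dker_le (S t) _ _ HS) as Hle.
    assert (Hq : 0 <= (y / 2) ^ S t) by (apply pow_le; lra).
    assert (Hfin : mean 1 (fun x => Cmod (vpoly (y / 2) (S t) x) ^ (2 * r))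
      - mean 1 (fun x => Cmod (vpoly (y / 2) t x) ^ (2 * r)) <= INR (2 * r) * A ^ (2 * r - 1)).
    { rewrite Hdiff. eapply Rle_trans; [apply Rle_abs|]. eapply Rle_trans; [apply Re_le_Cmod|].
      rewrite Cmod_mult, Cmod_R, Rabs_pos_eq by exact Hq.
      eapply Rle_trans; [apply Rmult_le_compat_l; [exact Hq|exact Hle]|].
      right. unfold B. rewrite Rpow_mult_distr, <- pow_mult.
      rewrite (Nat.mul_comm (S t)), pow_mult.
      replace ((y / 2) ^ S t * (INR (2 * r) * (A ^ (2 * r - 1) * (y ^ (2 * r - 1)) ^ S t)))
        with (INR (2 * r) * A ^ (2 * r - 1) * ((y / 2) ^ S t * (y ^ (2 * r - 1)) ^ S t)) by ring.
      rewrite <- Rpow_mult_distr.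
      replace (y / 2 * y ^ (2 * r - 1)) with (y ^ (2 * r) / 2).
      - rewrite Hy2. replace (2 / 2) with 1 by field. rewrite pow1. ring.
      - replace (2 * r)%nat with (S (2 * r - 1)) at 1 by lia. simpl pow. field. }
    replace (INR (S t + 1)) with (INR (t + 1) + 1) by (rewrite <- S_INR; f_equal).
    lra.
Qed.

Lemma Cmod_Cprod_le {A} (l : list A) (F : A -> C) (w : A -> R) :
  (forall a, In a l -> Cmod (F a) <= w a) ->
  Cmod (Cprod l F) <= fold_right (fun a acc => w a * acc) 1 l.
Proof.
  induction l as [|a l IH]; intros H; simpl; [rewrite Cmod_1; lra|].
  rewrite Cmod_mult. apply Rmult_le_compat; auto using Cmod_ge_0, in_eq, in_cons.
Qed.

Lemma Cprod_RtoC {A} (l : list A) (w : A -> R) :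
  Cprod l (fun a => RtoC (w a)) = RtoC (fold_right (fun a acc => w a * acc) 1 l).
Proof. induction l as [|a l IH]; simpl; [reflexivity|]. rewrite IH, RtoC_mult. reflexivity. Qed.

Definition zsum (d : nat) (t : list (list Z)) : list Z := fold_right zadd (repeat 0%Z d) t.

Lemma length_zsum d t : (forall k, In k t -> length k = d) -> length (zsum d t) = d.
Proof.
  induction t as [|k t IH]; intros H; simpl; [apply repeat_length|].
  rewrite length_zadd; auto using in_cons. rewrite IH by auto using in_cons. apply H, in_eq.
Qed.

Lemma Cprod_charac d t (c : list Z -> C) x : (forall k, In k t -> length k = d) ->
  Cprod t (fun k => c k * charac k x)%C = (Cprod t c * charac (zsum d t) x)%C.
Proof.
  induction t as [|k t IH]; intros H; simpl; [rewrite charac_zero; ring|].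
  rewrite IH by auto using in_cons. rewrite charac_zadd.
  - ring.
  - rewrite length_zsum by auto using in_cons. apply H, in_eq.
Qed.

(** The majorant property of even exponents: the [r]-th power is an exponential sum over [r]-tuples,
    and majorization of the coefficients passes to their products, so [mean_sqr_majorant]
    applies. *)
Lemma mean_pow_majorant d (L : list (list Z)) (c : list Z -> C) (w : list Z -> R) r :
  (forall k, In k L -> length k = d) -> (forall k, In k L -> Cmod (c k) <= w k) ->
  mean d (fun x => Cmod (trigpoly L c x) ^ (2 * r))
  <= mean d (fun x => Cmod (trigpoly L (fun k => RtoC (w k)) x) ^ (2 * r)).
Proof.
  intros HL Hw. set (T := cart (repeat L r)).
  assert (HT : forall t k, In t T -> In k t -> In k L).
  { intros t k Ht Hk. apply in_cart_repeat in Ht. apply Ht, Hk. }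
  assert (E : forall (c : list Z -> C) x, Cmod (trigpoly L c x) ^ (2 * r)
      = Cmod (Csum T (fun t => Cprod t c * charac (zsum d t) x)%C) ^ 2).
  { intros c' x. rewrite Nat.mul_comm, pow_mult, <- Cmod_pow. f_equal. f_equal.
    unfold trigpoly. rewrite <- Csum_pow. apply Csum_ext. intros t Ht.
    apply Cprod_charac. intros k Hk. apply HL. eauto. }
  rewrite !(mean_ext d (fun x => Cmod (trigpoly L _ x) ^ (2 * r)) _ (fun x _ => E _ x)).
  eapply Rle_trans; [apply (mean_sqr_majorant d T (zsum d) (fun t => Cprod t c)
     (fun t => fold_right (fun k acc => w k * acc) 1 t))|].
  - intros t Ht. apply length_zsum. intros; apply HL; eauto.
  - intros t Ht. apply Cmod_Cprod_le. intros; apply Hw; eauto.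
  - apply Req_le, mean_ext. intros x _. f_equal. f_equal. apply Csum_ext. intros t _.
    rewrite Cprod_RtoC. reflexivity.
Qed.

(** The cube of frequencies with coordinates below [2 ^ t] in modulus. Unlike a layer it is a
    product set, so weights of the form [q ^ lev k] factor over it. *)
Definition box (d t : nat) : list (list Z) := cart (repeat (vlist t) d).

Lemma in_box_list d t k : In k (box d t) <-> length k = d /\ forall z, In z k -> (bits z <= t)%nat.
Proof.
  unfold box. rewrite in_cart_repeat. split; intros [H1 H2]; split; auto.
  - intros z Hz. apply in_vlist, H2, Hz.
  - intros z Hz. apply in_vlist, H2, Hz.
Qed.

Lemma NoDup_box d t : NoDup (box d t).
Proof.
  apply NoDup_cart. apply List.Forall_forall. intros l Hl. apply repeat_spec in Hl. subst.
  apply NoDup_vlist.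
Qed.

Lemma lev_ge_bits k z : In z k -> (bits z <= lev k)%nat.
Proof. induction k as [|a k IH]; simpl; [tauto|]. intros [->|H]; [lia|]. specialize (IH H). lia. Qed.

Lemma layer_in_box d j t k : (j <= t)%nat -> In k (layer d j) -> In k (box d t).
Proof.
  intros Hj Hk. apply in_layer in Hk. destruct Hk as [H1 H2]. apply in_box_list. split; auto.
  intros z Hz. apply lev_ge_bits in Hz. lia.
Qed.

Lemma box_poly_cons q d t s x :
  trigpoly (box (S d) t) (fun k => RtoC (q ^ lev k)) (s :: x)
  = (vpoly q t [s] * trigpoly (box d t) (fun k => RtoC (q ^ lev k)) x)%C.
Proof.
  unfold trigpoly, box, vpoly. cbn [repeat cart].
  rewrite Csum_flat_map, Csum_mult. apply Csum_ext. intros z _.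
  rewrite Csum_map. apply Csum_ext. intros k _.
  rewrite charac_cons. cbn [lev fold_right]. fold (lev k). rewrite pow_add, RtoC_mult.
  assert (E : charac [z] [s] = cexpi (IZR z * s)).
  { unfold charac. f_equal. simpl. ring. }
  rewrite E. ring.
Qed.

Lemma ccont_trigpoly d L c : (forall k, In k L -> length k = d) -> ccont d (trigpoly L c).
Proof. intros H. apply (ccont_trig d L (fun k => k) c H). Qed.

(** The polynomial with coefficients [q ^ lev k] on the cube is a tensor power of [vpoly q t]. *)
Lemma mean_box_poly q d t r :
  mean d (fun x => Cmod (trigpoly (box d t) (fun k => RtoC (q ^ lev k)) x) ^ (2 * r))
  = mean 1 (fun x => Cmod (vpoly q t x) ^ (2 * r)) ^ d.
Proof.
  induction d as [|d IH].
  - rewrite pow_O, (mean_ext _ _ (fun _ => 1)); [apply mean_const|].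
    intros [|] Hx; [|discriminate].
    assert (E : trigpoly (box 0 t) (fun k => RtoC (q ^ lev k)) [] = RtoC 1).
    { unfold trigpoly, box, charac, cexpi. simpl. rewrite cos_0, sin_0.
      apply C_eq; unfold Re, Im; simpl; ring. }
    rewrite E, Cmod_1, pow1. reflexivity.
  - set (phi := fun s => Cmod (vpoly q t [s]) ^ (2 * r)).
    rewrite (mean_ext _ _ (fun x => phi (hd 0 x) *
      (Cmod (trigpoly (box d t) (fun k => RtoC (q ^ lev k)) (tl x)) ^ (2 * r)))).
    + rewrite (mean_cons_mult d phi
        (fun x => Cmod (trigpoly (box d t) (fun k => RtoC (q ^ lev k)) x) ^ (2 * r))).
      * rewrite IH, <- tech_pow_Rmult. f_equal. unfold mean. simpl integ. rewrite pow_1.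
        reflexivity.
      * apply cont_pow, cont_Cmod, ccont_trigpoly. intros k Hk. apply in_box_list in Hk. tauto.
      * intros s. apply (cont_last 0 (fun x => Cmod (vpoly q t x) ^ (2 * r)) []); auto.
        apply cont_pow, cont_Cmod.
        apply (ccont_trig 1 (vlist t) (fun z => [z]) (fun z => RtoC (q ^ bits z))). reflexivity.
    + intros [|s x] Hx; [discriminate|]. rewrite box_poly_cons, Cmod_mult, Rpow_mult_distr.
      reflexivity.
Qed.

(** Scaled by [q ^ j] and extended by zero, a layer polynomial with coefficients of modulus at most
    1 is majorized on the cube by [q ^ lev k]. *)
Lemma layer_poly_box q d j (sg : list Z -> C) x :
  trigpoly (box d j) (fun k => if Nat.eq_dec (lev k) j then RtoC (q ^ j) * sg k else RtoC 0)%C x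
  = (RtoC (q ^ j) * trigpoly (layer d j) sg x)%C.
Proof.
  unfold trigpoly. rewrite <- Csum_scal.
  rewrite (Csum_perm (layer d j) (filter (fun k => if Nat.eq_dec (lev k) j then true else false) (box d j))).
  - rewrite Csum_filter. apply Csum_ext. intros k _. destruct Nat.eq_dec; ring.
  - apply NoDup_Permutation; [apply NoDup_layer|apply NoDup_filter, NoDup_box|].
    intros k. rewrite filter_In. split.
    + intros Hk. split; [eapply layer_in_box; [apply Nat.le_refl|exact Hk]|].
      apply in_layer in Hk. destruct Nat.eq_dec; tauto.
    + intros [Hk E]. apply in_box_list in Hk. apply in_layer.
      destruct Nat.eq_dec; [tauto|discriminate].
Qed.

Lemma pow_pow_comm x a b : (x ^ a) ^ b = (x ^ b) ^ a.
Proof. rewrite <- !pow_mult, Nat.mul_comm. reflexivity. Qed.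

(* The sharp power of [j + 1] is [d - 1]; the loss is absorbed by the exponent [1 / 2] of the
   logarithm in the theorem. *)
Lemma layer_moment d r : (1 <= r)%nat -> exists K, 1 <= K /\
  forall j sg, (forall k, In k (layer d j) -> Cmod (sg k) <= 1) ->
  mean d (fun x => Cmod (trigpoly (layer d j) sg x) ^ (2 * r))
  <= K * INR (j + 1) ^ d * (2 ^ j) ^ (2 * r - 1).
Proof.
  intros Hr. destruct (vpoly_moment r Hr) as (y & K & Hy & Hy2 & HK & HV).
  exists (K ^ d). split; [apply pow_R1_Rle, HK|]. intros j sg Hs.
  set (q := y / 2). assert (Hq : 0 < q) by (unfold q; lra).
  assert (Hqj : 0 < q ^ j) by (apply pow_lt, Hq).
  assert (H : mean d (fun x => Cmod (trigpoly (box d j)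
      (fun k => if Nat.eq_dec (lev k) j then RtoC (q ^ j) * sg k else RtoC 0)%C x) ^ (2 * r))
      <= (K * INR (j + 1)) ^ d).
  { eapply Rle_trans; [apply mean_pow_majorant with (w := fun k => q ^ lev k)|].
    - intros k Hk. apply in_box_list in Hk. tauto.
    - intros k Hk. destruct Nat.eq_dec as [E|E].
      + rewrite E, Cmod_mult, Cmod_R, Rabs_pos_eq by lra.
        rewrite <- (Rmult_1_r (q ^ j)) at 2. apply Rmult_le_compat_l; [lra|].
        apply Hs, in_layer. apply in_box_list in Hk. tauto.
      + rewrite Cmod_0. apply pow_le. lra.
    - rewrite mean_box_poly. apply pow_incr. split; [|apply HV].
      apply mean_ge0; [|intros; apply pow_le, Cmod_ge_0].
      apply cont_pow, cont_Cmod.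
      apply (ccont_trig 1 (vlist j) (fun z => [z]) (fun z => RtoC (q ^ bits z))). reflexivity. }
  rewrite (mean_ext _ _ (fun x => (q ^ j) ^ (2 * r) *
     Cmod (trigpoly (layer d j) sg x) ^ (2 * r))) in H.
  - rewrite mean_scal in H.
    + rewrite Rpow_mult_distr in H.
      set (X := mean d _) in *.
      (* Since [q = y / 2] and [y ^ (2 * r) = 2], undoing the scaling by [q ^ j] costs exactly the
         factor [(2 ^ j) ^ (2 * r - 1)]. *)
      assert (E : (q ^ j) ^ (2 * r) * (2 ^ j) ^ (2 * r - 1) = 1).
      { assert (E2 : q ^ (2 * r) * 2 ^ (2 * r - 1) = 1).
        { unfold q, Rdiv. rewrite Rpow_mult_distr, Hy2, pow_inv.
          replace (2 * r)%nat with (S (2 * r - 1)) at 1 by lia. simpl pow. field.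
          apply pow_nonzero; lra. }
        rewrite !(pow_pow_comm _ j), <- Rpow_mult_distr, E2. apply pow1. }
      set (P := (2 ^ j) ^ (2 * r - 1)) in *.
      assert (HP : 0 < P) by (unfold P; apply pow_lt, pow_lt; lra).
      replace X with ((q ^ j) ^ (2 * r) * X * P).
      * apply Rmult_le_compat_r; lra.
      * replace ((q ^ j) ^ (2 * r) * X * P) with ((q ^ j) ^ (2 * r) * P * X) by ring.
        rewrite E. ring.
    + apply cont_pow, cont_Cmod, ccont_trigpoly. intros k Hk. apply in_layer in Hk. tauto.
  - intros x _. rewrite layer_poly_box, Cmod_mult, Cmod_R, Rabs_pos_eq by lra.
    apply Rpow_mult_distr.
Qed.

(** * Real powers and Young's inequality *)

Lemma Rpower_pos x y : 0 < Rpower x y.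
Proof. apply exp_pos. Qed.

Lemma rpow_pos_eq x y : 0 < x -> rpow x y = Rpower x y.
Proof. intros H. unfold rpow. destruct Rlt_dec; [reflexivity|lra]. Qed.

Lemma rpow_nonpos_eq x y : x <= 0 -> rpow x y = 0.
Proof. intros H. unfold rpow. destruct Rlt_dec; [lra|reflexivity]. Qed.

Lemma rpow_ge0 x y : 0 <= rpow x y.
Proof. unfold rpow. destruct Rlt_dec; [left; apply exp_pos|lra]. Qed.

Lemma rpow_2 x : 0 <= x -> rpow x 2 = x ^ 2.
Proof.
  intros [H|<-].
  - rewrite rpow_pos_eq by auto. replace 2 with (INR 2) at 1 by (simpl; ring).
    apply Rpower_pow, H.
  - rewrite rpow_nonpos_eq by lra. ring.
Qed.

Lemma rpow_half x : rpow x (1 / 2) = sqrt x.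
Proof.
  destruct (Rlt_dec 0 x).
  - rewrite rpow_pos_eq by auto. replace (1 / 2) with (/ 2) by field. apply Rpower_sqrt; auto.
  - rewrite rpow_nonpos_eq by lra. rewrite sqrt_neg_0; lra.
Qed.

Lemma normq_2 d g : normq d 2 g = sqrt (mean d (fun x => Cmod (g x) ^ 2)).
Proof.
  unfold normq. rewrite rpow_half. f_equal. apply mean_ext. intros x _.
  apply rpow_2, Cmod_ge_0.
Qed.

Lemma continuous_rpow y : 0 < y -> forall t, continuous (fun x => rpow x y) t.
Proof.
  intros Hy t. destruct (total_order_T t 0) as [ [Ht| ->]|Ht].
  - apply continuous_ext_loc with (fun _ => 0); [|apply continuous_const].
    exists (mkposreal (- t) ltac:(lra)). intros u Hu. change (Rabs (u - t) < - t) in Hu.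
    apply Rabs_def2 in Hu. rewrite rpow_nonpos_eq; lra.
  - intros P [e He]. unfold filtermap.
    exists (mkposreal (Rpower e (/ y)) (Rpower_pos _ _)). intros u Hu.
    change (Rabs (u - 0) < Rpower e (/ y)) in Hu. apply He.
    change (Rabs (rpow u y - rpow 0 y) < e).
    rewrite (rpow_nonpos_eq 0) by lra. rewrite Rminus_0_r, Rabs_pos_eq by apply rpow_ge0.
    rewrite Rminus_0_r in Hu. destruct (Rlt_dec 0 u) as [Hu0|Hu0].
    + rewrite rpow_pos_eq by auto. rewrite Rabs_pos_eq in Hu by lra.
      replace (pos e) with (Rpower (Rpower e (/ y)) y).
      * apply Rlt_Rpower_l; lra.
      * rewrite Rpower_mult, Rinv_l, Rpower_1; [reflexivity|apply cond_pos|lra].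
    + rewrite rpow_nonpos_eq by lra. apply cond_pos.
  - apply continuous_ext_loc with (fun x => exp (y * ln x)).
    + exists (mkposreal t Ht). intros u Hu. change (Rabs (u - t) < t) in Hu.
      apply Rabs_def2 in Hu. rewrite rpow_pos_eq by lra. reflexivity.
    + apply (continuous_comp (fun x => y * ln x) exp); [|apply continuous_exp].
      apply (continuous_mult (fun _ => y) ln); [apply continuous_const|].
      apply continuous_ln, Ht.
Qed.

(** The tangent of [exp] at [m = ln x + ln y] lies below [exp] at [A] and [B], and the weights
    [1 / p] and [1 - 1 / p] average [A] and [B] to [m]. *)
Lemma young x y p : 0 < x -> 0 < y -> 1 < p ->
  x * y <= Rpower x p / p + Rpower y (p / (p - 1)) * (1 - 1 / p).
Proof.
  intros Hx Hy Hp. set (q := p / (p - 1)).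
  set (A := p * ln x). set (B := q * ln y). set (m := ln x + ln y).
  assert (Em : x * y = exp m).
  { unfold m. rewrite exp_plus, !exp_ln; auto. }
  assert (HA : exp m * (1 + (A - m)) <= Rpower x p).
  { unfold Rpower. fold A. replace A with (m + (A - m)) at 2 by ring. rewrite exp_plus.
    apply Rmult_le_compat_l; [left; apply exp_pos|]. apply exp_ineq1_le. }
  assert (HB : exp m * (1 + (B - m)) <= Rpower y q).
  { unfold Rpower. fold B. replace B with (m + (B - m)) at 2 by ring. rewrite exp_plus.
    apply Rmult_le_compat_l; [left; apply exp_pos|]. apply exp_ineq1_le. }
  assert (Hip : 0 < 1 / p < 1).
  { split; [apply Rdiv_lt_0_compat; lra|]. apply Rmult_lt_reg_r with p; [lra|]. field_simplify; lra. }
  rewrite Em.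
  replace (exp m) with (exp m * (1 + (A - m)) * (1 / p) + exp m * (1 + (B - m)) * (1 - 1 / p)).
  - replace (Rpower x p / p) with (Rpower x p * (1 / p)) by (field; lra).
    apply Rplus_le_compat; apply Rmult_le_compat_r; lra.
  - unfold A, B, m, q. field. lra.
Qed.

Lemma Rpower_le_two_powers t q r : 0 < t -> 2 <= q <= INR (2 * r) ->
  Rpower t q <= t ^ 2 + t ^ (2 * r).
Proof.
  intros Ht Hq. rewrite <- (Rpower_pow 2), <- (Rpower_pow (2 * r)) by auto.
  pose proof (Rpower_pos t (INR 2)). pose proof (Rpower_pos t (INR (2 * r))).
  destruct (Rle_dec 1 t).
  - assert (Rpower t q <= Rpower t (INR (2 * r))) by (apply Rle_Rpower; lra). lra.
  - assert (Rpower t q <= Rpower t (INR 2)); [|lra].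
    unfold Rpower. assert (ln t < 0) by (rewrite <- ln_1; apply ln_increasing; lra).
    destruct (Req_dec q (INR 2)) as [->|Hne]; [lra|]. left. apply exp_increasing.
    simpl INR in *. nra.
Qed.

(** * Coefficients of a layer and Fourier inversion *)

Lemma parseval_pairing d T (c c' : list Z -> C) : NoDup T -> (forall a, In a T -> length a = d) ->
  cmean d (fun x => trigpoly T c x * Cconj (trigpoly T c' x))%C
  = Csum T (fun k => c k * Cconj (c' k))%C.
Proof.
  intros Hd H. unfold trigpoly.
  rewrite (cmean_trig_pairing d T T (fun a => a) (fun a => a) c c') by auto.
  apply Csum_ext. intros a Ha. rewrite (Csum_single a); auto.
  - destruct (zl_eq_dec _ _); [|congruence]. apply Cmult_1_r.
  - intros b Hb Hne. destruct (zl_eq_dec _ _); [congruence|]. apply Cmult_0_r.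
Qed.

(** Young's inequality for [u / B] and [v / G]. When [B] and [G] bound the norms with exponents [p]
    and [p / (p - 1)], taking means gives Hölder's inequality with bound [B * G]. *)
Lemma young_scaled u v B G p : 0 <= u -> 0 <= v -> 0 < B -> 0 < G -> 1 < p ->
  u * v <= B * G * (rpow u p / Rpower B p / p
                    + rpow v (p / (p - 1)) / Rpower G (p / (p - 1)) * (1 - 1 / p)).
Proof.
  intros Hu Hv HB HG Hp.
  assert (Hip : 0 < 1 / p < 1).
  { split; [apply Rdiv_lt_0_compat; lra|]. apply Rmult_lt_reg_r with p; [lra|]. field_simplify; lra. }
  assert (Hrhs : forall a b, 0 <= a -> 0 <= b ->
     0 <= B * G * (a / Rpower B p / p + b / Rpower G (p / (p - 1)) * (1 - 1 / p))).
  { intros a b Ha Hb. apply Rmult_le_pos; [nra|]. apply Rplus_le_le_0_compat.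
    - apply Rdiv_le_0_compat; [|lra]. apply Rdiv_le_0_compat; [auto|apply Rpower_pos].
    - apply Rmult_le_pos; [|lra]. apply Rdiv_le_0_compat; [auto|apply Rpower_pos]. }
  destruct Hu as [Hu|<-]; [|rewrite Rmult_0_l; apply Hrhs; apply rpow_ge0].
  destruct Hv as [Hv|<-]; [|rewrite Rmult_0_r; apply Hrhs; apply rpow_ge0].
  assert (Hdiv : forall a b y, 0 < a -> 0 < b -> Rpower (a / b) y = Rpower a y / Rpower b y).
  { intros a b y Ha Hb. unfold Rdiv. rewrite <- Rpower_Ropp, <- Rpower_mult_distr, Rpower_Ropp; auto.
    - f_equal. unfold Rpower. rewrite ln_Rinv by auto. rewrite <- exp_Ropp. f_equal. ring.
    - apply Rinv_0_lt_compat, Hb. }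
  pose proof (young (u / B) (v / G) p (Rdiv_lt_0_compat _ _ Hu HB) (Rdiv_lt_0_compat _ _ Hv HG) Hp) as HY.
  rewrite !Hdiv in HY by auto. rewrite !rpow_pos_eq by auto.
  replace (u * v) with (B * G * (u / B * (v / G))) by (field; lra).
  apply Rmult_le_compat_l; [nra|exact HY].
Qed.

Lemma normq_moment d p F B : 1 < p -> 0 < B -> normq d p F <= B ->
  mean d (fun x => rpow (Cmod (F x)) p) <= Rpower B p.
Proof.
  intros Hp HB H. unfold normq in H. set (I := mean d _) in *.
  destruct (Rlt_dec 0 I) as [HI|HI]; [|pose proof (Rpower_pos B p); lra].
  rewrite rpow_pos_eq in H by auto.
  replace I with (Rpower (Rpower I (1 / p)) p).
  - apply Rle_Rpower_l; [lra|]. split; [apply Rpower_pos|exact H].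
  - rewrite Rpower_mult. replace (1 / p * p) with 1 by (field; lra). apply Rpower_1, HI.
Qed.

Lemma cont_rpow_Cmod d F y : 0 < y -> ccont d F -> cont d (fun x => rpow (Cmod (F x)) y).
Proof.
  intros Hy HF. apply (cont_comp d (fun t => rpow t y)); [apply continuous_rpow, Hy|].
  apply cont_Cmod, HF.
Qed.

Lemma exists_even_above q : exists r, (1 <= r)%nat /\ q <= INR (2 * r).
Proof.
  destruct (INR_unbounded q) as [n Hn]. exists (S n). split; [lia|].
  apply Rle_trans with (INR n); [lra|]. apply le_INR. lia.
Qed.

(* With [q = p / (p - 1)] and [N = 2 ^ j], the bound [(t / N) ^ q <= (t / N) ^ 2 + (t / N) ^ (2 r)]
   for [2 <= q <= 2 r] replaces interpolation between even moments. *)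
Lemma layer_holder d p : 1 < p <= 2 -> exists K, 0 < K /\
  forall j c B, 0 < B -> normq d p (trigpoly (layer d j) c) <= B ->
    Rsum (layer d j) (fun k => Cmod (c k))
      <= K * Rpower (2 ^ j) (1 / p) * Rpower (INR (j + 1)) (INR d * (1 - 1 / p)) * B /\
    forall k, In k (layer d j) -> Cmod (c k) <= B.
Proof.
  intros [Hp1 Hp2]. set (q := p / (p - 1)).
  assert (Hq2 : 2 <= q).
  { unfold q. apply Rmult_le_reg_r with (p - 1); [lra|]. field_simplify; lra. }
  assert (Hip : 0 < 1 / p < 1).
  { split; [apply Rdiv_lt_0_compat; lra|]. apply Rmult_lt_reg_r with p; [lra|]. field_simplify; lra. }
  destruct (exists_even_above q) as (r & Hr & Hqr).
  destruct (layer_moment d 1 ltac:(lia)) as (K1 & HK1 & M1).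
  destruct (layer_moment d r Hr) as (Kr & HKr & Mr).
  set (K0 := K1 + Kr). assert (HK0 : 0 < K0) by (unfold K0; lra).
  exists (Rpower K0 (1 - 1 / p)). split; [apply Rpower_pos|].
  intros j c B HB Hn. set (F := trigpoly (layer d j) c).
  assert (Hlen : forall k, In k (layer d j) -> length k = d) by (intros k Hk; apply in_layer in Hk; tauto).
  assert (HF : ccont d F) by (apply ccont_trigpoly, Hlen).
  pose proof (normq_moment d p F B Hp1 HB Hn) as HI.
  pose proof (Rpower_pos B p) as HBp.
  assert (CI : cont d (fun x => rpow (Cmod (F x)) p)) by (apply cont_rpow_Cmod; auto; lra).
  assert (Hmu : mean d (fun x => rpow (Cmod (F x)) p / Rpower B p / p) <= 1 / p).
  { rewrite (mean_ext _ _ (fun x => (/ Rpower B p / p) * rpow (Cmod (F x)) p)) by (intros; field; lra).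
    rewrite mean_scal by auto.
    apply Rle_trans with ((/ Rpower B p / p) * Rpower B p); [|right; field; lra].
    apply Rmult_le_compat_l; auto. apply Rdiv_le_0_compat; [|lra].
    left; apply Rinv_0_lt_compat, HBp. }
  assert (Cu : cont d (fun x => rpow (Cmod (F x)) p / Rpower B p / p)).
  { apply cont_ext with (2 := cont_scal d (/ Rpower B p / p) _ CI). intros; field; lra. }
  split.
  - set (N := 2 ^ j). assert (HN : 1 <= N) by (apply pow_R1_Rle; lra).
    (* The dual polynomial: pairing [F] with [g] gives the sum of the moduli of the coefficients. *)
    set (sg := fun k => Cconj (phase (c k))). set (g := trigpoly (layer d j) sg).
    assert (Hsg : forall k, In k (layer d j) -> Cmod (sg k) <= 1).
    { intros k _. unfold sg. rewrite Cmod_conj. apply Cmod_phase. }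
    specialize (M1 j sg Hsg). specialize (Mr j sg Hsg). fold g N in M1, Mr.
    assert (Hg : ccont d g) by (apply ccont_trigpoly, Hlen).
    set (T := INR (j + 1) ^ d) in *.
    assert (HJ : 1 <= INR (j + 1)) by (rewrite plus_INR; simpl; pose proof (pos_INR j); lra).
    assert (HT : 1 <= T) by (apply pow_R1_Rle, HJ).
    (* The bound for the [q]-norm of [g]: by [EG], its [q]-th power is [N ^ q] times [K0 * T / N],
       and the latter bounds the mean of [(|g| / N) ^ 2 + (|g| / N) ^ (2 r)] through the two moment
       estimates. *)
    set (G := Rpower N (1 / p) * Rpower (K0 * T) (1 - 1 / p)).
    assert (HKT : 0 < K0 * T) by (apply Rmult_lt_0_compat; lra).
    assert (HG : 0 < G) by (apply Rmult_lt_0_compat; apply Rpower_pos).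
    assert (EG : Rpower N q * (K0 * T / N) = Rpower G q).
    { unfold G. rewrite <- Rpower_mult_distr by apply Rpower_pos. rewrite !Rpower_mult.
      replace ((1 - 1 / p) * q) with 1 by (unfold q; field; lra).
      rewrite (Rpower_1 (K0 * T)) by auto.
      replace (1 / p * q) with (q + - (1)) by (unfold q; field; lra).
      rewrite Rpower_plus, Rpower_Ropp, Rpower_1 by lra. field. lra. }
    set (h := fun x => Rpower N q * ((/ N) ^ 2 * Cmod (g x) ^ (2 * 1)
                                   + (/ N) ^ (2 * r) * Cmod (g x) ^ (2 * r))).
    assert (Ch : cont d h).
    { apply cont_scal. apply cont_plus; apply cont_scal, cont_pow, cont_Cmod, Hg. }
    assert (Hh : mean d h <= Rpower G q).
    { unfold h. rewrite mean_scal by (apply cont_plus; apply cont_scal, cont_pow, cont_Cmod, Hg).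
      rewrite <- EG. apply Rmult_le_compat_l; [left; apply Rpower_pos|].
      rewrite mean_plus by (apply cont_scal, cont_pow, cont_Cmod, Hg).
      rewrite !mean_scal by (apply cont_pow, cont_Cmod, Hg).
      assert (Hb : forall K i X, (1 <= i)%nat -> X <= K * T * N ^ (2 * i - 1) ->
                (/ N) ^ (2 * i) * X <= K * T / N).
      { intros K i X Hi HX.
        apply Rle_trans with ((/ N) ^ (2 * i) * (K * T * N ^ (2 * i - 1))).
        - apply Rmult_le_compat_l; auto. apply pow_le. left. apply Rinv_0_lt_compat; lra.
        - right. assert (E : N ^ (2 * i) = N * N ^ (2 * i - 1)).
          { rewrite tech_pow_Rmult. f_equal. lia. }
          rewrite pow_inv, E. field. repeat split; try apply pow_nonzero; lra. }
      pose proof (Hb K1 1%nat _ ltac:(lia) M1). pose proof (Hb Kr r _ Hr Mr).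
      change (2 * 1)%nat with 2%nat in *. unfold K0. lra. }
    assert (Hpt : forall x, rpow (Cmod (g x)) q <= h x).
    { intros x. pose proof (Cmod_ge_0 (g x)) as [H0|H0].
      - rewrite rpow_pos_eq by auto. set (t := Cmod (g x) * / N).
        assert (Ht : 0 < t) by (apply Rmult_lt_0_compat; auto; apply Rinv_0_lt_compat; lra).
        pose proof (Rpower_le_two_powers t q r Ht ltac:(lra)) as H1.
        replace (Cmod (g x)) with (N * t) at 1 by (unfold t; field; lra).
        rewrite <- Rpower_mult_distr by lra.
        unfold h. apply Rmult_le_compat_l; [left; apply Rpower_pos|].
        eapply Rle_trans; [exact H1|]. right. unfold t. rewrite !Rpow_mult_distr.
        change (2 * 1)%nat with 2%nat. ring.
      - rewrite <- H0, rpow_nonpos_eq by lra. unfold h.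
        apply Rmult_le_pos; [left; apply Rpower_pos|].
        assert (0 <= / N) by (left; apply Rinv_0_lt_compat; lra).
        apply Rplus_le_le_0_compat; apply Rmult_le_pos; apply pow_le; auto using Cmod_ge_0. }
    assert (Hsum : Rsum (layer d j) (fun k => Cmod (c k))
                   = Re (cmean d (fun x => F x * Cconj (g x))%C)).
    { unfold F, g. rewrite parseval_pairing by (auto using NoDup_layer). rewrite Re_Csum.
      apply Rsum_ext. intros k _. unfold sg. rewrite Cconj_conj, Cmult_comm, phase_mult. reflexivity. }
    rewrite Hsum.
    apply Rle_trans with (mean d (fun x => B * G * (rpow (Cmod (F x)) p / Rpower B p / p
                            + (/ Rpower G q * (1 - 1 / p)) * h x))).
    + apply Re_cmean_le.
      * apply ccont_mult; auto using ccont_conj.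
      * apply cont_scal, cont_plus; auto using cont_scal.
      * intros x _ _. rewrite Cmod_mult, Cmod_conj.
        eapply Rle_trans; [apply (young_scaled _ _ B G p); auto using Cmod_ge_0|].
        apply Rmult_le_compat_l; [nra|]. apply Rplus_le_compat_l. fold q.
        replace (rpow (Cmod (g x)) q / Rpower G q * (1 - 1 / p))
          with (/ Rpower G q * (1 - 1 / p) * rpow (Cmod (g x)) q)
          by (unfold Rdiv; ring).
        apply Rmult_le_compat_l; [|apply Hpt].
        apply Rmult_le_pos; [|lra]. left. apply Rinv_0_lt_compat, Rpower_pos.
    + rewrite mean_scal by (apply cont_plus; auto using cont_scal).
      rewrite mean_plus, (mean_scal d (/ Rpower G q * (1 - 1 / p))) by auto using cont_scal.
      apply Rle_trans with (B * G * 1).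
      * apply Rmult_le_compat_l; [nra|].
        assert (H1 : / Rpower G q * (1 - 1 / p) * mean d h <= 1 - 1 / p).
        { pose proof (Rpower_pos G q) as HGq.
          apply Rle_trans with (/ Rpower G q * (1 - 1 / p) * Rpower G q); [|right; field; lra].
          apply Rmult_le_compat_l; auto. apply Rmult_le_pos; [|lra].
          left. apply Rinv_0_lt_compat, HGq. }
        lra.
      * right. unfold G, T. rewrite <- Rpower_mult_distr by (auto; apply pow_lt; lra).
        rewrite <- (Rpower_pow d) by lra. rewrite Rpower_mult. ring.
  - intros k Hk.
    assert (E : c k = cmean d (fun x => F x * Cconj (charac k x))%C).
    { rewrite <- fhat_cmean. symmetry. apply fhat_trigpoly; auto using NoDup_layer. }
    rewrite E.
    (* The same inequality against a character, of modulus 1, with [G = 1]: the two terms have means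
       at most [1 / p] and [1 - 1 / p]. *)
    apply Rle_trans with (mean d (fun x => B * (rpow (Cmod (F x)) p / Rpower B p / p + (1 - 1 / p)))).
    + apply Cmod_cmean_le.
      * apply ccont_mult; auto. apply ccont_conj, ccont_charac_len; auto.
      * apply cont_scal, cont_plus; auto using cont_const.
      * intros x _ _. rewrite Cmod_mult, Cmod_conj, Cmod_charac.
        eapply Rle_trans; [apply (young_scaled _ _ B 1 p); auto using Cmod_ge_0; lra|].
        right. rewrite (rpow_pos_eq 1) by lra. fold q. pose proof (Rpower_pos 1 q).
        field. lra.
    + rewrite mean_scal by (apply cont_plus; auto using cont_const).
      rewrite mean_plus, mean_const by auto using cont_const. nra.
Qed.

Definition layers (d a n : nat) : list (list Z) := flat_map (layer d) (seq a n).

Lemma in_layers d a n k : In k (layers d a n) <-> length k = d /\ (a <= lev k < a + n)%nat.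
Proof.
  unfold layers. rewrite in_flat_map. split.
  - intros (j & Hj & Hk). apply in_seq in Hj. apply in_layer in Hk. lia.
  - intros [H1 H2]. exists (lev k). rewrite in_seq, in_layer. auto.
Qed.

Lemma NoDup_layers d a n : NoDup (layers d a n).
Proof.
  apply NoDup_flat_map; [apply seq_NoDup|intros; apply NoDup_layer|].
  intros j j' k _ _ H1 H2. apply in_layer in H1, H2. lia.
Qed.

Lemma real_cauchy (u : nat -> R) (tau : nat -> R) :
  (forall J n, Rabs (u (J + n)%nat - u J) <= tau J) ->
  (forall eps n, 0 < eps -> exists J, (n <= J)%nat /\ tau J < eps) ->
  exists l, forall J, Rabs (l - u J) <= tau J.
Proof.
  intros Hu Ht. destruct (Rcomplete.R_complete u) as [l Hl].
  - intros eps He. destruct (Ht (eps / 2) 0%nat ltac:(lra)) as (J & _ & HJ).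
    exists J. intros n m Hn Hm.
    pose proof (Hu J (n - J)%nat) as H1. pose proof (Hu J (m - J)%nat) as H2.
    replace (J + (n - J))%nat with n in H1 by lia. replace (J + (m - J))%nat with m in H2 by lia.
    unfold Rdist. apply Rabs_le_between in H1, H2. apply Rabs_def1; lra.
  - exists l. intros J. apply Rnot_lt_le. intros Hlt.
    destruct (Hl (Rabs (l - u J) - tau J) ltac:(lra)) as [n0 Hn0].
    specialize (Hn0 (J + n0)%nat ltac:(lia)). unfold Rdist in Hn0.
    pose proof (Hu J n0) as H1.
    assert (Rabs (l - u J) <= Rabs (u (J + n0)%nat - l) + Rabs (u (J + n0)%nat - u J)).
    { replace (l - u J) with (- (u (J + n0)%nat - l) + (u (J + n0)%nat - u J)) by ring.
      eapply Rle_trans; [apply Rabs_triang|]. rewrite Rabs_Ropp. lra. }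
    lra.
Qed.

Lemma complex_cauchy (u : nat -> C) (tau : nat -> R) :
  (forall J n, Cmod (u (J + n)%nat - u J) <= tau J) ->
  (forall eps n, 0 < eps -> exists J, (n <= J)%nat /\ tau J < eps) ->
  exists l, forall J, Cmod (l - u J) <= 2 * tau J.
Proof.
  intros Hu Ht.
  destruct (real_cauchy (fun n => Re (u n)) tau) as [a Ha]; auto.
  { intros J n. eapply Rle_trans; [|apply (Hu J n)]. rewrite <- Re_minus. apply Re_le_Cmod. }
  destruct (real_cauchy (fun n => Im (u n)) tau) as [b Hb]; auto.
  { intros J n. eapply Rle_trans; [|apply (Hu J n)]. rewrite <- Im_minus. apply Im_le_Cmod. }
  exists (a, b). intros J. eapply Rle_trans; [apply Cmod_le_Re_Im|].
  rewrite Re_minus, Im_minus. simpl. specialize (Ha J). specialize (Hb J). lra.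
Qed.

Lemma cont_uniform_limit d F (P : nat -> list R -> R) (tau : nat -> R) :
  (forall J, cont d (P J)) -> (forall J x, Rabs (F x - P J x) <= tau J) ->
  (forall eps n, 0 < eps -> exists J, (n <= J)%nat /\ tau J < eps) -> cont d F.
Proof.
  intros HP HF Ht. apply cont_eps. intros x Hx eps He.
  destruct (Ht (eps / 3) 0%nat ltac:(lra)) as (J & _ & HJ).
  destruct (proj1 (cont_eps _ _) (HP J) x Hx (eps / 3) ltac:(lra)) as (del & Hd & HQ).
  exists del. split; auto. intros y Hy Hxy. specialize (HQ y Hy Hxy).
  pose proof (HF J x) as H1. pose proof (HF J y) as H2.
  apply Rabs_le_between in H1, H2. apply Rabs_def2 in HQ. apply Rabs_def1; lra.
Qed.

(** Absolute summability makes the partial sums over layers converge uniformly to a continuous [L].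
    Uniqueness of Fourier coefficients then identifies [L] with [f], and this is the only way in
    which pointwise values of [f] are reached. *)
Lemma fourier_inversion d f (A tau : nat -> R) : ccont d f ->
  (forall j, Rsum (layer d j) (fun k => Cmod (fhat d f k)) <= A j) ->
  (forall J n, Rsum (seq (S J) n) A <= tau J) ->
  (forall eps n, 0 < eps -> exists J, (n <= J)%nat /\ tau J < eps) ->
  forall J x, length x = d -> in_box x ->
  Cmod (f x - trigpoly (layers d 0 (S J)) (fhat d f) x) <= 2 * tau J.
Proof.
  intros Hf HA Htau Ht0.
  set (P := fun J x => trigpoly (layers d 0 (S J)) (fhat d f) x).
  assert (HPl : forall J k, In k (layers d 0 (S J)) -> length k = d).
  { intros J k Hk. apply in_layers in Hk. tauto. }
  assert (HP : forall x J n, Cmod (P (J + n)%nat x - P J x) <= tau J).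
  { intros x J n. unfold P, trigpoly, layers. replace (S (J + n)) with (S J + n)%nat by lia.
    rewrite seq_app, flat_map_app, Csum_app.
    replace (_ - _)%C with (Csum (flat_map (layer d) (seq (0 + S J) n))
       (fun k => fhat d f k * charac k x)%C) by ring.
    eapply Rle_trans; [apply Cmod_Csum|]. rewrite Rsum_flat_map.
    eapply Rle_trans; [|apply (Htau J n)]. apply Rsum_le. intros j _.
    eapply Rle_trans; [|apply HA]. apply Rsum_le. intros k _.
    rewrite Cmod_mult, Cmod_charac. lra. }
  set (L := fun x => proj1_sig (constructive_indefinite_description _
      (complex_cauchy (fun J => P J x) tau (HP x) Ht0))).
  assert (HL : forall J x, Cmod (L x - P J x) <= 2 * tau J).
  { intros J x. unfold L. destruct constructive_indefinite_description as [l Hl]. apply Hl. }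
  assert (Ht0' : forall eps n, 0 < eps -> exists J, (n <= J)%nat /\ 2 * tau J < eps).
  { intros eps n He. destruct (Ht0 (eps / 2) n ltac:(lra)) as (J & H1 & H2). exists J. split; [auto|lra]. }
  assert (HcP : forall J, ccont d (P J)) by (intros J; apply ccont_trigpoly, HPl).
  assert (HcL : ccont d L).
  { split.
    - apply cont_uniform_limit with (P := fun J x => Re (P J x)) (tau := fun J => 2 * tau J); auto.
      + intros J; apply HcP.
      + intros J x. rewrite <- Re_minus. eapply Rle_trans; [apply Re_le_Cmod|apply HL].
    - apply cont_uniform_limit with (P := fun J x => Im (P J x)) (tau := fun J => 2 * tau J); auto.
      + intros J; apply HcP.
      + intros J x. rewrite <- Im_minus. eapply Rle_trans; [apply Im_le_Cmod|apply HL]. }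
  assert (Hcc : forall k, length k = d -> ccont d (fun x => Cconj (charac k x))).
  { intros k Hk. apply ccont_conj, ccont_charac_len, Hk. }
  (* A partial sum beyond the level of [k] has exactly the coefficient of [f] at [k] and is
     uniformly close to [L]. *)
  assert (Hz : forall k, length k = d -> fhat d (fun x => f x - L x)%C k = RtoC 0).
  { intros k Hk. apply Cmod_eq_0. apply Rle_antisym; [|apply Cmod_ge_0].
    apply Rnot_lt_le. intros Hlt.
    destruct (Ht0' _ (lev k) Hlt) as (J & HJ & HtJ).
    revert HtJ. apply Rle_not_lt.
    assert (E : fhat d (fun x => f x - L x)%C k
                = cmean d (fun x => (P J x - L x) * Cconj (charac k x))%C).
    { rewrite fhat_cmean.
      rewrite (cmean_ext _ _ (fun x => f x * Cconj (charac k x) - L x * Cconj (charac k x))%C)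
        by (intros; ring).
      rewrite (cmean_ext d (fun x => (P J x - L x) * Cconj (charac k x))%C
        (fun x => P J x * Cconj (charac k x) - L x * Cconj (charac k x))%C) by (intros; ring).
      rewrite !cmean_minus by (apply ccont_mult; auto). f_equal.
      rewrite <- !fhat_cmean. symmetry. apply fhat_trigpoly.
      - apply NoDup_layers.
      - apply HPl.
      - apply in_layers. split; auto. lia. }
    rewrite E. rewrite <- (mean_const d (2 * tau J)). apply Cmod_cmean_le.
    - apply ccont_mult; auto using ccont_minus.
    - apply cont_const.
    - intros x _ _. rewrite Cmod_mult, Cmod_conj, Cmod_charac, Rmult_1_r.
      rewrite <- Cmod_opp. replace (- (P J x - L x))%C with (L x - P J x)%C by ring. apply HL. }
  intros J x Hx Hb.
  pose proof (fourier_uniqueness d _ (ccont_minus d _ _ Hf HcL) Hz x Hx Hb) as E.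
  replace (f x) with (L x).
  - apply HL.
  - replace (f x) with (f x - L x + L x)%C by ring. simpl in E. rewrite E. ring.
Qed.

(** * Derandomised choices *)

Lemma exp_monotone x y : x <= y -> exp x <= exp y.
Proof. intros [H| ->]; [left; apply exp_increasing, H|lra]. Qed.

Lemma cosh_pos x : 0 < cosh x.
Proof. unfold cosh. pose proof (exp_pos x). pose proof (exp_pos (- x)). lra. Qed.

Lemma cosh_neg x : cosh (- x) = cosh x.
Proof. unfold cosh. rewrite Ropp_involutive. field. Qed.

Lemma cosh_abs x : cosh (Rabs x) = cosh x.
Proof. unfold Rabs. destruct Rcase_abs; auto using cosh_neg. Qed.

Lemma cosh_ge_half_exp x : exp (Rabs x) / 2 <= cosh x.
Proof.
  rewrite <- cosh_abs. unfold cosh. pose proof (exp_pos (- Rabs x)). lra.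
Qed.

(** The constant 2 in place of the sharp 1/2 allows an elementary proof: for [b >= 1/2] already
    [b <= 2 * b ^ 2], and for smaller [b] the bounds [1 / (1 - b)] and [1 / (1 + b)] for the two
    exponentials average to [1 / (1 - b ^ 2)]. *)
Lemma cosh_le_exp_sqr x : cosh x <= exp (2 * x ^ 2).
Proof.
  rewrite <- cosh_abs. rewrite <- (pow2_abs x). pose proof (Rabs_pos x) as H0.
  set (b := Rabs x) in *. destruct (Rle_dec (1 / 2) b) as [Hb|Hb].
  - apply Rle_trans with (exp b).
    + unfold cosh. assert (exp (- b) <= exp b) by (apply exp_monotone; lra). lra.
    + apply exp_monotone. nra.
  - assert (H1 : exp b <= / (1 - b)).
    { rewrite <- (Ropp_involutive b) at 1. rewrite exp_Ropp. apply Rinv_le_contravar; [lra|].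
      pose proof (exp_ineq1_le (- b)). lra. }
    assert (H2 : exp (- b) <= / (1 + b)).
    { rewrite exp_Ropp. apply Rinv_le_contravar; [lra|]. apply exp_ineq1_le. }
    apply Rle_trans with (/ (1 - b ^ 2)).
    + unfold cosh. apply Rle_trans with ((/ (1 - b) + / (1 + b)) / 2); [lra|].
      right. field. nra.
    + rewrite <- (Ropp_involutive (2 * b ^ 2)). rewrite exp_Ropp. apply Rinv_le_contravar; [apply exp_pos|].
      pose proof (exp_ineq1_le (2 * b ^ 2)) as H3. rewrite exp_Ropp.
      pose proof (exp_pos (2 * b ^ 2)) as H4.
      apply Rmult_le_reg_r with (exp (2 * b ^ 2)); [exact H4|]. rewrite Rinv_l by lra.
      assert (Hc : 0 <= b ^ 2 <= 1 / 4) by (simpl; nra).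
      set (c := b ^ 2) in *.
      apply Rle_trans with ((1 - c) * (1 + 2 * c)); [nra|].
      apply Rmult_le_compat_l; lra.
Qed.

Lemma cosh_plus_minus a b : cosh (a + b) + cosh (a - b) = 2 * (cosh a * cosh b).
Proof.
  unfold cosh, Rminus. rewrite !Ropp_plus_distr, !exp_plus, !Ropp_involutive. field.
Qed.

Section Balancing.
Context {T Y : Type}.
Variables (Ts : list T) (w : T -> Y -> R) (mu kap : T -> R).
Hypothesis kap_pos : forall t, 0 <= kap t.

Definition signed_sum (I I' : list Y) (F : Y -> R) : R := Rsum I F - Rsum I' F.

(* Derandomised choice of signs: the potential averaged over the next sign does not exceed its bound. *)
Lemma balance_potential Ys : forall acc : T -> R, exists I I', Permutation Ys (I ++ I') /\
  Rsum Ts (fun t => kap t * cosh (mu t * (acc t + signed_sum I I' (w t))))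
  <= Rsum Ts (fun t => kap t * (cosh (mu t * acc t)
                               * exp (2 * mu t ^ 2 * Rsum Ys (fun y => w t y ^ 2)))).
Proof.
  induction Ys as [|y Ys IH]; intros acc.
  - exists [], []. split; [constructor|]. apply Req_le, Rsum_ext. intros t _.
    unfold signed_sum. simpl. rewrite Rminus_0_r, Rplus_0_r, Rmult_0_r, exp_0. ring.
  - set (Q := fun t => exp (2 * mu t ^ 2 * Rsum Ys (fun y => w t y ^ 2))).
    set (pot := fun acc => Rsum Ts (fun t => kap t * (cosh (mu t * acc t) * Q t))).
    set (B := Rsum Ts (fun t => kap t * (cosh (mu t * acc t)
                * exp (2 * mu t ^ 2 * Rsum (y :: Ys) (fun y => w t y ^ 2))))).
    assert (HB : pot (fun t => acc t + w t y) + pot (fun t => acc t - w t y) <= 2 * B).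
    { unfold pot, B. rewrite <- Rsum_plus, <- Rsum_scal. apply Rsum_le. intros t _.
      rewrite Rsum_cons, (Rmult_plus_distr_l (2 * mu t ^ 2)), exp_plus. fold (Q t).
      replace (mu t * (acc t + w t y)) with (mu t * acc t + mu t * w t y) by ring.
      replace (mu t * (acc t - w t y)) with (mu t * acc t - mu t * w t y) by ring.
      apply Rle_trans with (kap t * ((cosh (mu t * acc t + mu t * w t y)
                                      + cosh (mu t * acc t - mu t * w t y)) * Q t)); [lra|].
      rewrite cosh_plus_minus.
      replace (2 * (kap t * (cosh (mu t * acc t) * (exp (2 * mu t ^ 2 * w t y ^ 2) * Q t))))
        with (kap t * (2 * (cosh (mu t * acc t) * exp (2 * mu t ^ 2 * w t y ^ 2)) * Q t)) by ring.
      apply Rmult_le_compat_l; [apply kap_pos|].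
      apply Rmult_le_compat_r; [left; apply exp_pos|].
      apply Rmult_le_compat_l; [lra|]. apply Rmult_le_compat_l; [left; apply cosh_pos|].
      eapply Rle_trans; [apply cosh_le_exp_sqr|]. right. f_equal. ring. }
    destruct (Rle_dec (pot (fun t => acc t + w t y)) B) as [H1|H1].
    + destruct (IH (fun t => acc t + w t y)) as (I & I' & HP & H).
      exists (y :: I), I'. split; [simpl; constructor; exact HP|].
      eapply Rle_trans; [|exact H1]. eapply Rle_trans; [|exact H].
      apply Req_le, Rsum_ext. intros t _. unfold signed_sum. rewrite Rsum_cons. do 3 f_equal. ring.
    + destruct (IH (fun t => acc t - w t y)) as (I & I' & HP & H).
      exists I, (y :: I'). split; [rewrite HP; apply Permutation_middle|].
      eapply Rle_trans; [|apply (Rle_trans _ (pot (fun t => acc t - w t y))); [exact H|lra]].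
      apply Req_le, Rsum_ext. intros t _. unfold signed_sum. rewrite Rsum_cons. do 3 f_equal. ring.
Qed.

End Balancing.

(** The value [mu = lam / (4 V)] minimizes [- mu lam + 2 mu ^ 2 V], with minimum
    [- lam ^ 2 / (8 V)]. The final potential is therefore below 1/2, while a single test exceeding
    [lam] would contribute at least 1/2. *)
Lemma balance {T Y} (Ts : list T) (w : T -> Y -> R) (V : T -> R) (lam : R) (Ys : list Y) :
  0 < lam -> (forall t, 0 < V t) ->
  (forall t, In t Ts -> Rsum Ys (fun y => w t y ^ 2) <= V t) ->
  Rsum Ts (fun t => exp (- (lam ^ 2 / (8 * V t)))) < 1 / 2 ->
  exists I I', Permutation Ys (I ++ I') /\
    forall t, In t Ts -> Rabs (signed_sum I I' (w t)) <= lam.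
Proof.
  intros Hl HV Hw Hs.
  set (mu := fun t => lam / (4 * V t)).
  assert (Hmu : forall t, 0 < mu t) by (intros t; specialize (HV t); apply Rdiv_lt_0_compat; lra).
  set (kap := fun t => exp (- (mu t * lam))).
  destruct (balance_potential Ts w mu kap (fun t => Rlt_le _ _ (exp_pos _)) Ys (fun _ => 0))
    as (I & I' & HP & H).
  exists I, I'. split; auto. intros t Ht.
  assert (HU : Rsum Ts (fun t => kap t * cosh (mu t * (0 + signed_sum I I' (w t)))) < 1 / 2).
  { eapply Rle_lt_trans; [exact H|]. eapply Rle_lt_trans; [|exact Hs].
    apply Rsum_le. intros s Hin. specialize (HV s).
    rewrite Rmult_0_r, cosh_0, Rmult_1_l. unfold kap. rewrite <- exp_plus. apply exp_monotone.
    apply Rle_trans with (- (mu s * lam) + 2 * mu s ^ 2 * V s).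
    - apply Rplus_le_compat_l, Rmult_le_compat_l; auto. pose proof (pow2_ge_0 (mu s)); lra.
    - right. unfold mu. field. lra. }
  apply Rnot_lt_le. intros Hlt. revert HU. apply Rle_not_lt.
  eapply Rle_trans; [|apply (Rsum_elem Ts (fun t => kap t * cosh (mu t * (0 + signed_sum I I' (w t)))) t)]; auto.
  - apply Rle_trans with (kap t * (exp (mu t * lam) / 2)).
    + unfold kap. unfold Rdiv. rewrite <- Rmult_assoc, <- exp_plus, Rplus_opp_l, exp_0. lra.
    + apply Rmult_le_compat_l; [left; apply exp_pos|].
      eapply Rle_trans; [|apply cosh_ge_half_exp]. apply Rmult_le_compat_r; [lra|].
      apply exp_monotone. rewrite Rplus_0_l, Rabs_mult, (Rabs_pos_eq (mu t)) by (left; apply Hmu).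
      apply Rmult_le_compat_l; [left; apply Hmu|lra].
  - intros s _. apply Rmult_le_pos; left; [apply exp_pos|apply cosh_pos].
Qed.

Lemma exp_convex th a b : 0 <= th <= 1 ->
  exp (th * a + (1 - th) * b) <= th * exp a + (1 - th) * exp b.
Proof.
  intros Hth. set (m := th * a + (1 - th) * b).
  assert (H : forall c, exp m * (1 + (c - m)) <= exp c).
  { intros c. replace c with (m + (c - m)) at 2 by ring. rewrite exp_plus.
    apply Rmult_le_compat_l; [left; apply exp_pos|apply exp_ineq1_le]. }
  pose proof (H a). pose proof (H b).
  apply Rle_trans with (th * (exp m * (1 + (a - m))) + (1 - th) * (exp m * (1 + (b - m)))).
  - right. transitivity (exp m * (1 + (th * a + (1 - th) * b - m))); [fold m|]; ring.
  - apply Rplus_le_compat; apply Rmult_le_compat_l; lra.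
Qed.

Section Maurey.
Context {A Z : Type}.
Variables (At : list A) (p : A -> R) (b : A -> Z -> R) (B : R).
Hypothesis p_pos : forall a, In a At -> 0 <= p a.
Hypothesis p_sum : Rsum At p = 1.
Hypothesis B_pos : 0 < B.
Hypothesis b_le : forall a z, Rabs (b a z) <= B.

Let avg (z : Z) : R := Rsum At (fun a => p a * b a z).

Lemma avg_bound z : Rabs (avg z) <= B.
Proof.
  unfold avg. eapply Rle_trans; [apply Rsum_Rabs|].
  apply Rle_trans with (Rsum At (fun a => B * p a)).
  - apply Rsum_le. intros a Ha. rewrite Rabs_mult, (Rabs_pos_eq (p a)) by auto.
    rewrite Rmult_comm. apply Rmult_le_compat_r; auto.
  - rewrite Rsum_scal, p_sum. lra.
Qed.

(** Hoeffding's lemma: on [[-2B, 2B]] the exponential lies below its chord, whose linear part has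
    mean zero. *)
Lemma centered_mgf z s : Rsum At (fun a => p a * exp (s * (b a z - avg z))) <= cosh (2 * B * s).
Proof.
  pose proof (avg_bound z) as Ha.
  apply Rle_trans with (Rsum At (fun a => p a * (cosh (2 * B * s)
      + (b a z - avg z) / (2 * B) * sinh (2 * B * s)))).
  - apply Rsum_le. intros a Hin. apply Rmult_le_compat_l; auto.
    pose proof (b_le a z) as Hb. apply Rabs_le_between in Ha, Hb.
    set (yy := b a z - avg z). set (th := (yy + 2 * B) / (4 * B)).
    assert (Hth : 0 <= th <= 1).
    { unfold th. split; [apply Rdiv_le_0_compat; unfold yy; lra|].
      apply Rmult_le_reg_r with (4 * B); [lra|]. unfold Rdiv. rewrite Rmult_assoc, Rinv_l; unfold yy; lra. }
    pose proof (exp_convex th (2 * B * s) (- (2 * B * s)) Hth) as HE.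
    replace (th * (2 * B * s) + (1 - th) * - (2 * B * s)) with (s * yy) in HE
      by (unfold th; field; lra).
    eapply Rle_trans; [exact HE|]. right. unfold cosh, sinh, th. field. lra.
  - rewrite (Rsum_ext _ _ (fun a => cosh (2 * B * s) * p a + sinh (2 * B * s) / (2 * B) * (p a * b a z)
       - sinh (2 * B * s) / (2 * B) * avg z * p a)) by (intros; field; lra).
    rewrite Rsum_minus, Rsum_plus, !Rsum_scal, p_sum. fold (avg z). lra.
Qed.

(* Empirical method of Maurey, derandomised: each new atom is chosen so as not to exceed the
   average of the potential. *)
Lemma maurey_potential (Zs : list Z) mu r : exists tau, length tau = r /\ incl tau At /\
  Rsum Zs (fun z => cosh (mu * (Rsum tau (fun a => b a z) - INR r * avg z)))
  <= INR (length Zs) * exp (8 * INR r * (mu * B) ^ 2).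
Proof.
  induction r as [|r (tau & Hl & Hi & H)].
  - exists []. split; [reflexivity|]. split; [intros a []|].
    rewrite (Rsum_ext _ _ (fun _ => 1)).
    + rewrite Rsum_const. simpl INR at 2. rewrite Rmult_0_r, Rmult_0_l, exp_0. lra.
    + intros z _. simpl. rewrite Rmult_0_l, Rminus_0_r, Rmult_0_r. apply cosh_0.
  - set (D := fun z => mu * (Rsum tau (fun a => b a z) - INR r * avg z)).
    destruct (exists_below_average At p
      (fun a => Rsum Zs (fun z => cosh (D z + mu * (b a z - avg z))))
      (cosh (2 * B * mu) * Rsum Zs (fun z => cosh (D z)))) as (a & Ha & HX); auto.
    + rewrite (Rsum_ext _ _ (fun a => Rsum Zs (fun z => p a * cosh (D z + mu * (b a z - avg z)))))
        by (intros; symmetry; apply Rsum_scal).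
      rewrite Rsum_swap, <- Rsum_scal. apply Rsum_le. intros z _.
      (* The hyperbolic cosine is split into two exponentials; averaging either of them over the new
         atom costs at most the factor [cosh (2 * B * mu)]. *)
      pose proof (centered_mgf z mu) as H1. pose proof (centered_mgf z (- mu)) as H2.
      rewrite (Rsum_ext _ _ (fun a => exp (D z) / 2 * (p a * exp (mu * (b a z - avg z)))
         + exp (- D z) / 2 * (p a * exp (- mu * (b a z - avg z))))).
      * rewrite Rsum_plus, !Rsum_scal.
        replace (2 * B * - mu) with (- (2 * B * mu)) in H2 by ring. rewrite cosh_neg in H2.
        pose proof (exp_pos (D z)). pose proof (exp_pos (- D z)).
        unfold cosh at 2.
        apply Rle_trans with (exp (D z) / 2 * cosh (2 * B * mu) + exp (- D z) / 2 * cosh (2 * B * mu));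
          [|right; field].
        apply Rplus_le_compat; apply Rmult_le_compat_l; lra.
      * intros a _. unfold cosh. rewrite Ropp_plus_distr, !exp_plus.
        replace (- (mu * (b a z - avg z))) with (- mu * (b a z - avg z)) by ring. field.
    + exists (a :: tau). split; [simpl; congruence|]. split; [intros c [<-|Hc]; auto|].
      rewrite (Rsum_ext _ _ (fun z => cosh (D z + mu * (b a z - avg z)))).
      * eapply Rle_trans; [exact HX|].
        apply Rle_trans with (exp (2 * (2 * B * mu) ^ 2) *
           (INR (length Zs) * exp (8 * INR r * (mu * B) ^ 2))).
        -- apply Rmult_le_compat; [left; apply cosh_pos| |apply cosh_le_exp_sqr|exact H].
           apply Rsum_ge0. intros; left; apply cosh_pos.
        -- right. rewrite S_INR.
           replace (8 * (INR r + 1) * (mu * B) ^ 2)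
             with (2 * (2 * B * mu) ^ 2 + 8 * INR r * (mu * B) ^ 2) by ring.
           rewrite exp_plus. ring.
      * intros z _. f_equal. unfold D. rewrite Rsum_cons, S_INR. ring.
Qed.

Lemma maurey_sup (Zs : list Z) rho r : 0 < rho ->
  32 * B ^ 2 * ln (2 * INR (length Zs)) <= rho ^ 2 * INR r ->
  exists tau, length tau = r /\ incl tau At /\
    forall z, In z Zs -> Rabs (Rsum tau (fun a => b a z) - INR r * avg z) <= INR r * rho.
Proof.
  intros Hr HL. set (mu := rho / (16 * B ^ 2)).
  assert (HB2 : 0 < B ^ 2) by (apply pow_lt, B_pos).
  assert (Hmu : 0 < mu) by (apply Rdiv_lt_0_compat; lra).
  destruct (maurey_potential Zs mu r) as (tau & Hl & Hi & H).
  exists tau. split; [auto|]. split; [auto|]. intros z Hz.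
  set (Dz := Rsum tau (fun a => b a z) - INR r * avg z).
  assert (Hn : 0 < INR (length Zs)) by (apply lt_0_INR; destruct Zs; [destruct Hz|simpl; lia]).
  assert (H1 : exp (Rabs (mu * Dz)) / 2 <= INR (length Zs) * exp (8 * INR r * (mu * B) ^ 2)).
  { eapply Rle_trans; [apply cosh_ge_half_exp|]. eapply Rle_trans; [|exact H].
    apply (Rsum_elem Zs (fun z => cosh (mu * (Rsum tau (fun a => b a z) - INR r * avg z))) z); auto.
    intros; left; apply cosh_pos. }
  assert (H2 : Rabs (mu * Dz) <= ln (2 * INR (length Zs)) + 8 * INR r * (mu * B) ^ 2).
  { rewrite <- (ln_exp (Rabs (mu * Dz))), <- (ln_exp (8 * INR r * (mu * B) ^ 2)), <- ln_mult
      by (try apply exp_pos; lra).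
    apply ln_le; [apply exp_pos|]. lra. }
  rewrite Rabs_mult, (Rabs_pos_eq mu) in H2 by lra.
  apply Rmult_le_reg_l with mu; [exact Hmu|].
  eapply Rle_trans; [exact H2|].
  apply Rle_trans with (rho ^ 2 * INR r / (32 * B ^ 2) + 8 * INR r * (mu * B) ^ 2).
  - apply Rplus_le_compat_r. apply Rmult_le_reg_l with (32 * B ^ 2); [lra|].
    eapply Rle_trans; [exact HL|]. right. field. lra.
  - right. unfold mu. field. lra.
Qed.

End Maurey.

(** * Discretization for sparse polynomials *)

Section Sparse.
Variables (Lam : list (list Z)) (v : nat).
Hypothesis v_pos : (1 <= v)%nat.

Definition sparse (S : list (list Z)) : Prop := NoDup S /\ incl S Lam /\ (length S <= v)%nat.

(** A union of balls, in general not convex, but contained in the convex hull of the atoms below;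
    this containment is what Maurey's method uses. *)
Definition sparse_ball (u : list R -> C) : Prop :=
  exists S c, sparse S /\ Rsum S (fun k => Cmod (c k) ^ 2) <= 1 /\ forall y, u y = trigpoly S c y.

Lemma INR_v_pos : 1 <= INR v.
Proof. apply (le_INR 1), v_pos. Qed.

Lemma sparse_ball_0 : sparse_ball (fun _ => RtoC 0).
Proof.
  exists [], (fun _ => RtoC 0). repeat split; [constructor|intros k []|apply Nat.le_0_l|simpl; lra].
Qed.

Lemma Cmod_trigpoly_le S c y : Cmod (trigpoly S c y) <= Rsum S (fun k => Cmod (c k)).
Proof.
  eapply Rle_trans; [apply Cmod_Csum|]. apply Rsum_le. intros k _.
  rewrite Cmod_mult, Cmod_charac. lra.
Qed.

Lemma sparse_ball_sup u y : sparse_ball u -> Cmod (u y) <= sqrt (INR v).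
Proof.
  intros (S & c & (Hd & Hi & Hl) & Hn & E). rewrite E.
  eapply Rle_trans; [apply Cmod_trigpoly_le|].
  pose proof (Rsum_sq_le S (fun k => Cmod (c k)) (fun k _ => Cmod_ge_0 _)) as H.
  rewrite <- (sqrt_pow2 (Rsum S _)) by (apply Rsum_ge0; intros; apply Cmod_ge_0).
  apply sqrt_le_1_alt. eapply Rle_trans; [exact H|].
  apply le_INR in Hl. pose proof (pos_INR (length S)).
  assert (0 <= Rsum S (fun k => Cmod (c k) ^ 2)) by (apply Rsum_ge0; intros; apply pow2_ge_0).
  nra.
Qed.

(** By Cauchy-Schwarz, [v] coefficients of unit l2 norm have real and imaginary parts of total
    modulus at most [beta]. *)
Let beta := sqrt (2 * INR v).

Lemma beta_pos : 0 < beta.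
Proof. apply sqrt_lt_R0. pose proof INR_v_pos. lra. Qed.

Lemma beta_sqr : beta ^ 2 = 2 * INR v.
Proof. apply pow2_sqrt. pose proof INR_v_pos. lra. Qed.

(** [Some (k, e)] is the character of frequency [k] times [beta], [- beta], [i beta] or [- i beta].
    [None] is the zero function; it takes the probability left over when the l1 norm stays below
    [beta]. *)
Definition atom : Type := option (list Z * nat).

Definition atoms (S : list (list Z)) : list atom :=
  None :: flat_map (fun k => map (fun e => Some (k, e)) [0; 1; 2; 3]%nat) S.

Definition unit4 (e : nat) : C :=
  match e with 0%nat => RtoC 1 | 1%nat => RtoC (-1) | 2%nat => Ci | _ => (- Ci)%C end.

Definition part4 (e : nat) (c : C) : R :=
  match e with
  | 0%nat => Rmax (Re c) 0 | 1%nat => Rmax (- Re c) 0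
  | 2%nat => Rmax (Im c) 0 | _ => Rmax (- Im c) 0
  end.

Definition atom_val (a : atom) (y : list R) : C :=
  match a with None => RtoC 0 | Some (k, e) => (RtoC beta * unit4 e * charac k y)%C end.

Lemma Cmod_atom_val a y : Cmod (atom_val a y) <= beta.
Proof.
  pose proof beta_pos. destruct a as [[k e]|]; simpl; [|rewrite Cmod_0; lra].
  rewrite !Cmod_mult, Cmod_charac, Cmod_R, Rabs_pos_eq by lra.
  assert (E : Cmod (unit4 e) = 1).
  { assert (HCi : Cmod Ci = 1).
    { unfold Cmod, Ci; simpl. replace (0 * (0 * 1) + 1 * (1 * 1)) with 1 by ring. apply sqrt_1. }
    destruct e as [|[|[|e]]]; simpl; rewrite ?Cmod_opp, ?HCi, ?Cmod_R; auto.
    - apply Rabs_R1.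
    - rewrite Rabs_left; lra. }
  rewrite E. lra.
Qed.

Lemma length_atoms S : length (atoms S) = (4 * length S + 1)%nat.
Proof.
  unfold atoms. simpl length. rewrite (flat_map_constant_length (c := 4%nat)); [lia|auto].
Qed.

Lemma Rmax_0_parts x : Rmax x 0 - Rmax (- x) 0 = x /\ Rmax x 0 + Rmax (- x) 0 = Rabs x.
Proof. unfold Rmax, Rabs. destruct (Rle_dec x 0), (Rle_dec (- x) 0), (Rcase_abs x); lra. Qed.

(** Real and imaginary part at each point are separate tests, since Maurey's method is carried out
    for real values. *)
Definition coords (Ys : list (list R)) : list (list R * bool) :=
  flat_map (fun y => [(y, true); (y, false)]) Ys.

(** In the hypothesis, [64 * INR v] is [32 * beta ^ 2], and the 4 under the logarithm includes the
    two tests per point. The radius doubles because the errors of the real and imaginary parts are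
    added. *)
Lemma sparse_ball_approx u Ys rho r : sparse_ball u -> 0 < rho ->
  64 * INR v * ln (4 * INR (length Ys)) <= rho ^ 2 * INR r ->
  exists tau, length tau = r /\ incl tau (atoms Lam) /\
    forall y, In y Ys ->
      Cmod (Csum tau (fun a => atom_val a y) - RtoC (INR r) * u y) <= INR r * (2 * rho).
Proof.
  intros (S & c & (Hd & Hi & Hl) & Hn & E) Hr HL.
  pose proof beta_pos as Hb. pose proof beta_sqr as Hb2.
  (* The weights that write [u] as a convex combination of the atoms. *)
  set (p := fun a : atom => match a with
     | None => 1 - Rsum S (fun k => (Rabs (Re (c k)) + Rabs (Im (c k))) / beta)
     | Some (k, e) => part4 e (c k) / beta end).
  set (b := fun (a : atom) (z : list R * bool) =>
     if snd z then Re (atom_val a (fst z)) else Im (atom_val a (fst z))).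
  assert (Hl1 : Rsum S (fun k => Rabs (Re (c k)) + Rabs (Im (c k))) <= beta).
  { rewrite <- (sqrt_pow2 (Rsum S _))
      by (apply Rsum_ge0; intros k _; pose proof (Rabs_pos (Re (c k))); pose proof (Rabs_pos (Im (c k))); lra).
    apply sqrt_le_1_alt. eapply Rle_trans; [apply Rsum_sq_le|].
    - intros k _; pose proof (Rabs_pos (Re (c k))); pose proof (Rabs_pos (Im (c k))); lra.
    - apply Rle_trans with (INR v * (2 * Rsum S (fun k => Cmod (c k) ^ 2))).
      + apply Rmult_le_compat; [apply pos_INR| |apply le_INR, Hl|].
        * apply Rsum_ge0; intros; apply pow2_ge_0.
        * rewrite <- Rsum_scal. apply Rsum_le. intros k _. rewrite Cmod_sqr.
          rewrite <- (pow2_abs (Re (c k))), <- (pow2_abs (Im (c k))).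
          pose proof (pow2_ge_0 (Rabs (Re (c k)) - Rabs (Im (c k)))). nra.
      + pose proof INR_v_pos. nra. }
  assert (Hsum4 : forall F : atom -> R, Rsum (atoms S) F
     = F None + Rsum S (fun k => F (Some (k, 0%nat)) + F (Some (k, 1%nat))
                               + F (Some (k, 2%nat)) + F (Some (k, 3%nat)))).
  { intros F. unfold atoms. rewrite Rsum_cons, Rsum_flat_map. f_equal.
    apply Rsum_ext. intros k _. simpl. ring. }
  assert (Hp0 : forall a, In a (atoms S) -> 0 <= p a).
  { intros [[k e]|] _; simpl.
    - apply Rdiv_le_0_compat; auto. destruct e as [|[|[|e]]]; apply Rmax_r.
    - unfold Rdiv. rewrite (Rsum_ext _ _ (fun k => / beta * (Rabs (Re (c k)) + Rabs (Im (c k)))))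
        by (intros; ring).
      rewrite Rsum_scal. apply Rmult_le_compat_l with (r := / beta) in Hl1;
        [rewrite Rinv_l in Hl1; lra|left; apply Rinv_0_lt_compat, Hb]. }
  assert (Hp1 : Rsum (atoms S) p = 1).
  { rewrite Hsum4. simpl. rewrite (Rsum_ext S (fun k => (Rabs (Re (c k)) + Rabs (Im (c k))) / beta)
      (fun k => Rmax (Re (c k)) 0 / beta + Rmax (- Re (c k)) 0 / beta
                + Rmax (Im (c k)) 0 / beta + Rmax (- Im (c k)) 0 / beta)); [ring|].
    intros k _. rewrite <- (proj2 (Rmax_0_parts (Re (c k)))), <- (proj2 (Rmax_0_parts (Im (c k)))).
    field. lra. }
  assert (Hbb : forall a z, Rabs (b a z) <= beta).
  { intros a [y s]. unfold b. simpl. pose proof (Cmod_atom_val a y).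
    destruct s; [pose proof (Re_le_Cmod (atom_val a y))|pose proof (Im_le_Cmod (atom_val a y))]; lra. }
  assert (HC : length (coords Ys) = (2 * length Ys)%nat).
  { unfold coords. rewrite (flat_map_constant_length (c := 2%nat)); [lia|auto]. }
  destruct (maurey_sup (atoms S) p b beta Hp0 Hp1 Hb Hbb (coords Ys) rho r Hr) as (tau & H1 & H2 & H3).
  { rewrite HC, mult_INR, Hb2. simpl (INR 2).
    replace (2 * ((1 + 1) * INR (length Ys))) with (4 * INR (length Ys)) by ring. lra. }
  exists tau. split; [auto|]. split.
  { intros a Ha. apply H2 in Ha. destruct Ha as [<-|Ha]; [left; auto|]. right.
    apply in_flat_map in Ha. destruct Ha as (k & Hk & Ha). apply in_flat_map. eauto. }
  intros y Hy.
  assert (Hur : Rsum (atoms S) (fun a => p a * b a (y, true)) = Re (u y) /\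
                Rsum (atoms S) (fun a => p a * b a (y, false)) = Im (u y)).
  { rewrite !Hsum4, E. unfold trigpoly. rewrite Re_Csum, Im_Csum. unfold b; simpl.
    rewrite !Rmult_0_r, !Rplus_0_l. split; apply Rsum_ext; intros k _;
      pose proof (proj1 (Rmax_0_parts (Re (c k)))) as ER;
      pose proof (proj1 (Rmax_0_parts (Im (c k)))) as EI.
    - unfold Re, Im in *; simpl.
      transitivity ((Rmax (fst (c k)) 0 - Rmax (- fst (c k)) 0) * cos (dotZR k y)
                   - (Rmax (snd (c k)) 0 - Rmax (- snd (c k)) 0) * sin (dotZR k y)); [field; lra|].
      rewrite ER, EI. reflexivity.
    - unfold Re, Im in *; simpl.
      transitivity ((Rmax (fst (c k)) 0 - Rmax (- fst (c k)) 0) * sin (dotZR k y)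
                   + (Rmax (snd (c k)) 0 - Rmax (- snd (c k)) 0) * cos (dotZR k y)); [field; lra|].
      rewrite ER, EI. reflexivity. }
  assert (Hin : forall s, In (y, s) (coords Ys)).
  { intros s. apply in_flat_map. exists y. split; auto. destruct s; simpl; auto. }
  pose proof (H3 _ (Hin true)) as HR. pose proof (H3 _ (Hin false)) as HI.
  destruct Hur as [UR UI]. rewrite UR in HR. rewrite UI in HI.
  eapply Rle_trans; [apply Cmod_le_Re_Im|].
  rewrite Re_minus, Im_minus, Re_Csum, Im_Csum, Re_mult, Im_mult. simpl (Re (RtoC _)). simpl (Im (RtoC _)).
  unfold b in HR, HI. simpl in HR, HI.
  rewrite !Rmult_0_l, Rminus_0_r, Rplus_0_r. lra.
Qed.

Definition covers (Ys : list (list R)) (Net : list (list R -> C)) (rho : R) : Prop :=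
  (forall z, In z Net -> sparse_ball z) /\
  forall u, sparse_ball u -> exists z, In z Net /\ forall y, In y Ys -> Cmod (u y - z y) <= rho.

(** Averages of atoms need not be [v]-sparse. To obtain a net inside the ball, each tuple of atoms
    is replaced by some element of the ball near its average, if there is one; this doubles the
    radius once more. *)
Lemma exists_net Ys rho r : 0 < rho -> (1 <= r)%nat ->
  64 * INR v * ln (4 * INR (length Ys)) <= rho ^ 2 * INR r ->
  exists Net, length Net = ((4 * length Lam + 1) ^ r)%nat /\ covers Ys Net (4 * rho).
Proof.
  intros Hr Hr1 HL.
  set (near := fun (tau : list atom) (u : list R -> C) => sparse_ball u /\ forall y, In y Ys ->
     Cmod (Csum tau (fun a => atom_val a y) - RtoC (INR r) * u y) <= INR r * (2 * rho)).
  set (pick := fun tau => match excluded_middle_informative (exists u, near tau u) with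
     | left H => proj1_sig (constructive_indefinite_description _ H)
     | right _ => fun _ => RtoC 0 end).
  assert (HR : 0 < INR r) by (apply lt_0_INR; lia).
  exists (map pick (cart (repeat (atoms Lam) r))). split; [|split].
  - rewrite length_map, length_cart_repeat, length_atoms. reflexivity.
  - intros z Hz. apply in_map_iff in Hz. destruct Hz as (tau & <- & _). unfold pick.
    destruct excluded_middle_informative as [H|H]; [|apply sparse_ball_0].
    destruct constructive_indefinite_description as [z Hz]. apply Hz.
  - intros u Hu. destruct (sparse_ball_approx u Ys rho r Hu Hr HL) as (tau & H1 & H2 & H3).
    exists (pick tau). split.
    + apply in_map, in_cart_repeat. auto.
    + intros y Hy. unfold pick. destruct excluded_middle_informative as [H|H].
      * destruct constructive_indefinite_description as [z [Hz1 Hz2]]. simpl.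
        specialize (Hz2 y Hy). specialize (H3 y Hy).
        apply Rmult_le_reg_l with (INR r); [exact HR|].
        rewrite <- (Rabs_pos_eq (INR r)) at 1 by lra. rewrite <- Cmod_R, <- Cmod_mult.
        set (s := Csum tau (fun a => atom_val a y)) in *.
        replace (RtoC (INR r) * (u y - z y))%C
          with ((s - RtoC (INR r) * z y) + - (s - RtoC (INR r) * u y))%C by ring.
        eapply Rle_trans; [apply Cmod_triangle|]. rewrite Cmod_opp. lra.
      * exfalso. apply H. exists u. split; auto.
Qed.

End Sparse.

Lemma exists_nat_between x : 1 <= x -> exists r : nat, (1 <= r)%nat /\ x <= INR r <= 2 * x.
Proof.
  intros Hx. destruct (nfloor_ex x ltac:(lra)) as [n Hn]. exists (S n).
  rewrite S_INR. split; [lia|]. lra.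
Qed.

Lemma exp_1_ge_2 : 2 <= exp 1.
Proof. pose proof (exp_ineq1_le 1). lra. Qed.

Lemma ln_ge_1 x : 3 <= x -> 1 <= ln x.
Proof.
  intros Hx. rewrite <- (ln_exp 1). apply ln_le; [apply exp_pos|]. pose proof exp_le_3. lra.
Qed.

Lemma geometric_half L : Rsum (seq 0 L) (fun l => (1 / 2) ^ (l + 2)) = 1 / 2 - (1 / 2) ^ (L + 1).
Proof.
  induction L as [|L IH]; [simpl; lra|].
  rewrite seq_S, Rsum_app, IH, Rsum_cons. simpl (Rsum [] _).
  replace (0 + L + 2)%nat with (S (L + 1)) by lia. replace (S L + 1)%nat with (S (L + 1)) by lia.
  simpl. field.
Qed.

Lemma exp_neg_le_half n x : INR n <= x -> exp (- x) <= (1 / 2) ^ n.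
Proof.
  intros H. apply Rle_trans with (exp (- INR n)); [apply exp_monotone; lra|].
  replace (1 / 2) with (/ 2) by field. rewrite pow_inv, exp_Ropp.
  apply Rinv_le_contravar; [apply pow_lt; lra|].
  clear H. induction n as [|n IH]; [simpl; rewrite exp_0; lra|].
  rewrite S_INR, exp_plus. simpl. pose proof exp_1_ge_2.
  assert (0 < 2 ^ n) by (apply pow_lt; lra). nra.
Qed.

(** * Splitting a point set into two halves by chaining *)

Section Halving.
Variables (Lam : list (list Z)) (v : nat).
Hypothesis v_pos : (1 <= v)%nat.
Hypothesis Lam_ne : (1 <= length Lam)%nat.

Notation ball := (sparse_ball Lam v).

Lemma signed_sum_minus {Y} (I I' : list Y) F G :
  signed_sum I I' (fun y => F y - G y) = signed_sum I I' F - signed_sum I I' G.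
Proof. unfold signed_sum. rewrite !Rsum_minus. ring. Qed.

Lemma signed_sum_le {Y} (Ys I I' : list Y) F : Permutation Ys (I ++ I') ->
  Rabs (signed_sum I I' F) <= Rsum Ys (fun y => Rabs (F y)).
Proof.
  intros HP. rewrite (Rsum_perm _ _ _ HP), Rsum_app. unfold signed_sum, Rminus.
  eapply Rle_trans; [apply Rabs_triang|]. rewrite Rabs_Ropp.
  apply Rplus_le_compat; apply Rsum_Rabs.
Qed.

(** Up to a constant and the factor [4 ^ l], the entropy of the net of level [l]: about
    [4 ^ l * ln (4 n)] atoms have to be chosen, each among [4 * length Lam + 1]. *)
Definition logs (n : nat) : R := ln (4 * INR n) * ln (4 * INR (length Lam) + 1).

Lemma logs_ge_1 n : (1 <= n)%nat -> 1 <= ln (4 * INR n) /\ 1 <= ln (4 * INR (length Lam) + 1) /\ 1 <= logs n.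
Proof.
  intros Hn. apply le_INR in Hn. pose proof (le_INR _ _ Lam_ne) as HN. simpl INR in Hn, HN.
  assert (H1 : 1 <= ln (4 * INR n)) by (apply ln_ge_1; lra).
  assert (H2 : 1 <= ln (4 * INR (length Lam) + 1)) by (apply ln_ge_1; lra).
  unfold logs. repeat split; auto. nra.
Qed.

(** The net of level 0 can be the zero function alone because [sqrt (INR v)] bounds the ball
    uniformly; chains therefore start at a function without discrepancy. *)
Lemma net_level Ys l : (1 <= length Ys)%nat -> exists Net,
  INR (length Net) <= exp (2048 * 4 ^ l * logs (length Ys)) /\
  covers Lam v Ys Net (sqrt (INR v) / 2 ^ l) /\
  (l = 0%nat -> forall z, In z Net -> z = (fun _ => RtoC 0)).
Proof.
  intros Hn. destruct (logs_ge_1 _ Hn) as (L1 & L2 & L3).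
  assert (H4 : 1 <= 4 ^ l) by (apply pow_R1_Rle; lra).
  pose proof (INR_v_pos v v_pos) as Hv.
  destruct l as [|l].
  - exists [fun _ => RtoC 0]. split; [|split].
    + simpl length. simpl INR. rewrite <- exp_0. apply exp_monotone. simpl. lra.
    + split; [intros z [<-|[]]; apply sparse_ball_0|].
      intros u Hu. exists (fun _ => RtoC 0). split; [left; auto|]. intros y _.
      simpl. rewrite Rdiv_1_r. replace (u y - 0)%C with (u y) by ring.
      eapply sparse_ball_sup; eauto.
    + intros _ z [<-|[]]. reflexivity.
  - set (Lg := ln (4 * INR (length Ys))) in *. set (m := S l) in *.
    (* With the radius [rho] below, [64 * INR v = rho ^ 2 * (1024 * 4 ^ m)]. Rounding at most
       doubles the number of atoms, whence 2048 in the statement. *)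
    destruct (exists_nat_between (1024 * 4 ^ m * Lg)) as (r & Hr1 & Hr2 & Hr3); [nra|].
    set (rho := sqrt (INR v) / 2 ^ m / 4).
    assert (Hsv : 0 < sqrt (INR v)) by (apply sqrt_lt_R0; lra).
    assert (H2 : 0 < 2 ^ m) by (apply pow_lt; lra).
    assert (Hrho : 0 < rho) by (unfold rho; repeat apply Rdiv_lt_0_compat; lra).
    assert (E2 : rho ^ 2 * (1024 * 4 ^ m) = 64 * INR v).
    { unfold rho. replace 4 with (2 ^ 2) at 2 by ring. rewrite pow_pow_comm.
      replace ((sqrt (INR v) / 2 ^ m / 4) ^ 2) with (sqrt (INR v) ^ 2 / (2 ^ m) ^ 2 / 16) by (field; lra).
      rewrite pow2_sqrt by lra. field. lra. }
    destruct (exists_net Lam v v_pos Ys rho r Hrho Hr1) as (Net & HN & HC).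
    + fold Lg. rewrite <- E2.
      apply Rle_trans with (rho ^ 2 * (1024 * 4 ^ m * Lg)); [right; ring|].
      apply Rmult_le_compat_l; [apply pow2_ge_0|exact Hr2].
    + exists Net. split; [|split].
      * rewrite HN, pow_INR, plus_INR, mult_INR. simpl (INR 4). simpl (INR 1).
        replace ((1 + 1 + 1 + 1) * INR (length Lam) + 1) with (4 * INR (length Lam) + 1) by ring.
        rewrite <- Rpower_pow by (pose proof (pos_INR (length Lam)); lra).
        unfold Rpower. apply exp_monotone. unfold logs. fold Lg.
        replace (2048 * 4 ^ m * (Lg * ln (4 * INR (length Lam) + 1)))
          with (2 * (1024 * 4 ^ m * Lg) * ln (4 * INR (length Lam) + 1)) by ring.
        apply Rmult_le_compat_r; lra.
      * replace (sqrt (INR v) / 2 ^ m) with (4 * rho) by (unfold rho; field; lra). exact HC.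
      * discriminate.
Qed.

Lemma sqr_diff_bounds (z w : C) rho : 0 <= rho -> Cmod (z - w) <= rho ->
  Rabs (Cmod z ^ 2 - Cmod w ^ 2) <= rho * (Cmod z + Cmod w).
Proof.
  intros Hr H. pose proof (Cmod_ge_0 z). pose proof (Cmod_ge_0 w).
  replace (Cmod z ^ 2 - Cmod w ^ 2) with ((Cmod z - Cmod w) * (Cmod z + Cmod w)) by ring.
  rewrite Rabs_mult, (Rabs_pos_eq (Cmod z + Cmod w)) by lra.
  apply Rmult_le_compat_r; [lra|]. eapply Rle_trans; [|exact H].
  assert (T1 : Cmod w <= Cmod (z - w) + Cmod z).
  { rewrite <- (Cmod_opp (z - w)). replace w with (- (z - w) + z)%C at 1 by ring.
    apply Cmod_triangle. }
  assert (T2 : Cmod z <= Cmod (z - w) + Cmod w).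
  { replace z with (z - w + w)%C at 1 by ring. apply Cmod_triangle. }
  apply Rabs_le. lra.
Qed.

(** At level [l] there are at most [exp (10240 * 4 ^ l * logs n)] links, as
    [10240 = 2048 * (1 + 4)], while [balance] gives each the weight
    [exp (- 10242 * 4 ^ l * logs n)]; the surplus 2 makes the total converge. The factor
    [128 = 8 * 16] comes from [8 * V] with [V = 16 * rl l ^ 2 * Rr]. *)
Definition kappa : R := 128 * 10242.

(* Chaining along nets of scale [sqrt v / 2 ^ l]; every link has discrepancy at most
   [lam], independently of its level. *)
Lemma halving_step Ys Rr L : (1 <= length Ys)%nat -> INR v <= Rr ->
  (forall u, ball u -> Rsum Ys (fun y => Cmod (u y) ^ 2) <= Rr) ->
  2 * INR (length Ys) <= 2 ^ L ->
  exists I I', Permutation Ys (I ++ I') /\ forall u, ball u ->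
    Rabs (signed_sum I I' (fun y => Cmod (u y) ^ 2))
    <= INR (L + 1) * sqrt (kappa * INR v * Rr * logs (length Ys)).
Proof.
  intros Hn HRv HR HL. destruct (logs_ge_1 _ Hn) as (L1 & L2 & L3).
  set (Lg := logs (length Ys)) in *.
  pose proof (INR_v_pos v v_pos) as Hv.
  set (lam := sqrt (kappa * INR v * Rr * Lg)).
  assert (HvR : INR v * INR v <= INR v * Rr) by nra.
  assert (HX : INR v * INR v <= kappa * INR v * Rr * Lg).
  { unfold kappa. assert (INR v * Rr <= INR v * Rr * Lg) by nra. nra. }
  assert (Hlam : INR v <= lam).
  { unfold lam. rewrite <- (sqrt_square (INR v)) at 1 by lra. apply sqrt_le_1_alt, HX. }
  assert (Hlam2 : lam ^ 2 = kappa * INR v * Rr * Lg) by (apply pow2_sqrt; nra).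
  set (Net := fun l => proj1_sig (constructive_indefinite_description _ (net_level Ys l Hn))).
  assert (HNet : forall l, INR (length (Net l)) <= exp (2048 * 4 ^ l * Lg) /\
     covers Lam v Ys (Net l) (sqrt (INR v) / 2 ^ l) /\
     (l = 0%nat -> forall z, In z (Net l) -> z = (fun _ => RtoC 0))).
  { intros l. unfold Net. destruct constructive_indefinite_description as [N0 HN0]. exact HN0. }
  clearbody Net.
  set (rl := fun l => sqrt (INR v) / 2 ^ l).
  assert (Hsv : 0 < sqrt (INR v)) by (apply sqrt_lt_R0; lra).
  assert (Hrl : forall l, 0 < rl l) by (intros; apply Rdiv_lt_0_compat; [auto|apply pow_lt; lra]).
  assert (Hrl2 : forall l, rl l ^ 2 * 4 ^ l = INR v).
  { intros l. unfold rl. assert (0 < 2 ^ l) by (apply pow_lt; lra).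
    replace 4 with (2 ^ 2) by ring. rewrite pow_pow_comm.
    replace ((sqrt (INR v) / 2 ^ l) ^ 2) with (sqrt (INR v) ^ 2 / (2 ^ l) ^ 2) by (field; lra).
    rewrite pow2_sqrt by lra. field. lra. }
  assert (HrS : forall l, rl (S l) <= rl l).
  { intros l. unfold rl. simpl. assert (0 < 2 ^ l) by (apply pow_lt; lra).
    apply Rmult_le_compat_l; [lra|]. apply Rinv_le_contravar; lra. }
  set (Ts := flat_map (fun l => map (pair l) (list_prod (Net l) (Net (S l)))) (seq 0 L)).
  set (close := fun t : nat * ((list R -> C) * (list R -> C)) => forall y, In y Ys ->
     Cmod (snd (snd t) y - fst (snd t) y) <= 2 * rl (fst t)).
  (* All pairs from consecutive nets serve as tests; pairs that are not close get the weight 0, so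
     that the variance bound holds for them as well. *)
  set (w := fun t y => if excluded_middle_informative (close t)
     then Cmod (snd (snd t) y) ^ 2 - Cmod (fst (snd t) y) ^ 2 else 0).
  (* For a close pair the squared difference of squares is at most [(2 rl) ^ 2 (|z| + |z'|) ^ 2],
     hence [8 rl ^ 2 (|z| ^ 2 + |z'| ^ 2)], and each square sums to at most [Rr]. *)
  set (V := fun t : nat * ((list R -> C) * (list R -> C)) => 16 * rl (fst t) ^ 2 * Rr).
  assert (HVp : forall t, 0 < V t).
  { intros t. unfold V. pose proof (pow_lt _ 2 (Hrl (fst t))). nra. }
  destruct (balance Ts w V lam Ys) as (I & I' & HP & HD).
  - lra.
  - exact HVp.
  - intros [l [z z']] Ht. unfold Ts in Ht. apply in_flat_map in Ht.
    destruct Ht as (l' & Hl' & Ht). apply in_map_iff in Ht. destruct Ht as (zz & E & Hz).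
    injection E as -> ->. apply in_prod_iff in Hz. destruct Hz as [Hz Hz'].
    apply (proj1 (proj2 (HNet l))) in Hz. apply (proj1 (proj2 (HNet (S l)))) in Hz'.
    unfold w, V. cbn [fst snd]. destruct excluded_middle_informative as [Hc|Hc].
    + apply Rle_trans with (Rsum Ys (fun y => 8 * rl l ^ 2 * (Cmod (z' y) ^ 2 + Cmod (z y) ^ 2))).
      * apply Rsum_le. intros y Hy. specialize (Hc y Hy). cbn [fst snd] in Hc.
        pose proof (sqr_diff_bounds (z' y) (z y) (2 * rl l) ltac:(pose proof (Hrl l); lra) Hc) as Hb.
        rewrite <- (pow2_abs (Cmod (z' y) ^ 2 - Cmod (z y) ^ 2)).
        apply Rle_trans with ((2 * rl l * (Cmod (z' y) + Cmod (z y))) ^ 2).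
        -- apply pow_incr. split; [apply Rabs_pos|exact Hb].
        -- rewrite Rpow_mult_distr.
           replace (8 * rl l ^ 2 * (Cmod (z' y) ^ 2 + Cmod (z y) ^ 2))
             with ((2 * rl l) ^ 2 * (2 * (Cmod (z' y) ^ 2 + Cmod (z y) ^ 2))) by ring.
           apply Rmult_le_compat_l; [apply pow2_ge_0|].
           pose proof (pow2_ge_0 (Cmod (z' y) - Cmod (z y))). nra.
      * rewrite Rsum_scal, Rsum_plus. pose proof (HR z Hz). pose proof (HR z' Hz').
        pose proof (pow_lt _ 2 (Hrl l)). simpl in *. nra.
    + rewrite Rsum_zero by (intros; ring). pose proof (HVp (l, (z, z'))). unfold V in H. simpl in *. lra.
  - apply Rle_lt_trans with (Rsum (seq 0 L) (fun l => (1 / 2) ^ (l + 2))).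
    + unfold Ts. rewrite Rsum_flat_map. apply Rsum_le. intros l _. rewrite Rsum_map.
      rewrite (Rsum_ext _ _ (fun _ => exp (- (10242 * 4 ^ l * Lg)))).
      * rewrite Rsum_const, length_prod, mult_INR.
        apply Rle_trans with (exp (- (2 * 4 ^ l * Lg))).
        -- apply Rle_trans with (exp (2048 * 4 ^ l * Lg) * exp (2048 * 4 ^ S l * Lg)
                                 * exp (- (10242 * 4 ^ l * Lg))).
           ++ apply Rmult_le_compat_r; [left; apply exp_pos|].
              apply Rmult_le_compat; try apply pos_INR; apply HNet.
           ++ rewrite <- !exp_plus. apply exp_monotone. simpl. lra.
        -- apply exp_neg_le_half.
           (* Bernoulli's inequality [4 ^ l >= 1 + 3 l] gives [2 * 4 ^ l >= l + 2]. *)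
           pose proof (poly l 3 ltac:(lra)) as H4. replace (1 + 3) with 4 in H4 by ring.
           rewrite plus_INR. simpl (INR 2). pose proof (pos_INR l).
           assert (4 ^ l * 1 <= 4 ^ l * Lg) by (apply Rmult_le_compat_l; lra). lra.
      * intros [z z'] _. unfold V. simpl fst. f_equal. f_equal. rewrite Hlam2.
        pose proof (Hrl2 l) as E. assert (0 < 4 ^ l) by (apply pow_lt; lra).
        rewrite <- E. unfold kappa. pose proof (Hrl l). field. repeat split; lra.
    + rewrite geometric_half. assert (0 < (1 / 2) ^ (L + 1)) by (apply pow_lt; lra). lra.
  - exists I, I'. split; [exact HP|]. intros u Hu.
    assert (Hchain : forall l, (l <= L)%nat -> forall z, In z (Net l) ->
       (forall y, In y Ys -> Cmod (u y - z y) <= rl l) ->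
       Rabs (signed_sum I I' (fun y => Cmod (z y) ^ 2)) <= INR l * lam).
    { induction l as [|l IH]; intros Hl z Hz Hcl.
      - rewrite (proj2 (proj2 (HNet 0%nat)) eq_refl z Hz).
        unfold signed_sum. rewrite !Rsum_zero by (intros; rewrite Cmod_0; ring).
        simpl. rewrite Rminus_0_r, Rabs_R0. lra.
      - destruct (proj2 (proj1 (proj2 (HNet l))) u Hu) as (z0 & Hz0 & Hcl0).
        specialize (IH ltac:(lia) z0 Hz0 Hcl0).
        assert (Ht : In (l, (z0, z)) Ts).
        { apply in_flat_map. exists l. split; [apply in_seq; lia|].
          apply in_map, in_prod; auto. }
        specialize (HD _ Ht).
        assert (Hc : close (l, (z0, z))).
        { intros y Hy. simpl. specialize (Hcl y Hy). specialize (Hcl0 y Hy). pose proof (HrS l).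
          replace (z y - z0 y)%C with ((u y - z0 y) + - (u y - z y))%C by ring.
          eapply Rle_trans; [apply Cmod_triangle|]. rewrite Cmod_opp. fold (rl l) in Hcl0. lra. }
        unfold w in HD. destruct excluded_middle_informative; [|tauto]. cbn [fst snd] in HD.
        rewrite (signed_sum_minus I I' (fun y => Cmod (z y) ^ 2) (fun y => Cmod (z0 y) ^ 2)) in HD.
        rewrite S_INR. apply Rabs_le_between in HD, IH. apply Rabs_le. lra. }
    destruct (proj2 (proj1 (proj2 (HNet L))) u Hu) as (z & Hz & Hcl).
    specialize (Hchain L (Nat.le_refl _) z Hz Hcl).
    (* The depth [L] makes the remainder trivial: the points contribute at most [rl L * 2 sqrt v]
       each, in total [2 n v / 2 ^ L <= v <= lam]. *)
    assert (Hres : Rabs (signed_sum I I' (fun y => Cmod (u y) ^ 2 - Cmod (z y) ^ 2)) <= lam).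
    { eapply Rle_trans; [apply (signed_sum_le Ys _ _ _ HP)|].
      apply Rle_trans with (INR (length Ys) * (rl L * (2 * sqrt (INR v)))).
      - apply Rsum_le_const. intros y Hy.
        eapply Rle_trans; [apply sqr_diff_bounds; [left; apply (Hrl L)|apply Hcl, Hy]|].
        apply Rmult_le_compat_l; [left; apply Hrl|].
        pose proof (sparse_ball_sup Lam v u y Hu).
        pose proof (sparse_ball_sup Lam v z y (proj1 (proj1 (proj2 (HNet L))) z Hz)). lra.
      - eapply Rle_trans; [|exact Hlam]. unfold rl.
        assert (H2 : 0 < 2 ^ L) by (apply pow_lt; lra).
        replace (INR (length Ys) * (sqrt (INR v) / 2 ^ L * (2 * sqrt (INR v))))
          with (2 * INR (length Ys) / 2 ^ L * (sqrt (INR v) * sqrt (INR v))) by (field; lra).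
        rewrite sqrt_sqrt by lra. rewrite <- (Rmult_1_l (INR v)) at 2.
        apply Rmult_le_compat_r; [lra|]. apply Rmult_le_reg_r with (2 ^ L); [lra|].
        unfold Rdiv. rewrite Rmult_assoc, Rinv_l by lra. lra. }
    rewrite (signed_sum_minus I I' (fun y => Cmod (u y) ^ 2) (fun y => Cmod (z y) ^ 2)) in Hres.
    rewrite plus_INR. simpl (INR 1). fold lam.
    apply Rabs_le_between in Hres, Hchain. apply Rabs_le. lra.
Qed.

End Halving.

(** * Repeated halving of an exact point set *)

Section Iterate.
Variables (Lam : list (list Z)) (v : nat) (Y0 : list (list R)) (L : nat).
Hypothesis v_pos : (1 <= v)%nat.
Hypothesis Lam_ne : (1 <= length Lam)%nat.
Hypothesis Y0_ne : (1 <= length Y0)%nat.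
Hypothesis L_big : 2 * INR (length Y0) <= 2 ^ L.
Hypothesis exact : forall S c, sparse Lam v S ->
  Rsum Y0 (fun y => Cmod (trigpoly S c y) ^ 2)
  = INR (length Y0) * Rsum S (fun k => Cmod (c k) ^ 2).

(** Chosen so that the discrepancy of [halving_step] with [Rr = 2 * W] is at most
    [W * sqrt (cost / W)]. *)
Definition cost : R := 2 * kappa * INR (L + 1) ^ 2 * INR v * logs Lam (length Y0).

(** [W] is the nominal number of points: it is halved exactly at every step, while the actual number
    only stays close to it. *)
Definition discretizes (Ys : list (list R)) (W err : R) : Prop :=
  incl Ys Y0 /\ (length Ys <= length Y0)%nat /\
  forall S c, sparse Lam v S -> Rsum S (fun k => Cmod (c k) ^ 2) <= 1 ->
    Rabs (Rsum Ys (fun y => Cmod (trigpoly S c y) ^ 2)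
          - W * Rsum S (fun k => Cmod (c k) ^ 2)) <= W * err.

Lemma cost_pos : INR v <= cost.
Proof.
  destruct (logs_ge_1 Lam Lam_ne _ Y0_ne) as (_ & _ & H).
  pose proof (INR_v_pos v v_pos).
  assert (1 <= INR (L + 1) ^ 2).
  { apply pow_R1_Rle. rewrite plus_INR. simpl. pose proof (pos_INR L). lra. }
  unfold cost, kappa.
  apply Rle_trans with (1 * INR v * 1); [lra|].
  apply Rmult_le_compat; try lra. apply Rmult_le_compat_r; lra.
Qed.

(** A single character has modulus 1 everywhere, so its empirical sum counts the points. *)
Lemma discretizes_count Ys W err : discretizes Ys W err ->
  Rabs (INR (length Ys) - W) <= W * err.
Proof.
  intros (_ & _ & H). destruct Lam as [|k Lam'] eqn:E; [simpl in Lam_ne; lia|].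
  assert (Hs : sparse (k :: Lam') v [k]).
  { split; [repeat constructor; auto|]. split; [intros a [<-|[]]; apply in_eq|simpl; lia]. }
  specialize (H [k] (fun _ => RtoC 1) Hs).
  simpl in H. rewrite Cmod_1, Rmult_1_r, Rmult_1_r, Rplus_0_r, Rmult_1_r in H.
  specialize (H (Rle_refl 1)).
  rewrite (Rsum_ext _ _ (fun _ => 1)), Rsum_const, Rmult_1_r in H; [exact H|].
  intros y _. replace (1 * charac k y + 0)%C with (charac k y) by ring.
  rewrite Cmod_charac. ring.
Qed.

(** The error [3 s] with [s = sqrt (cost / W)] reproduces itself. The half [I] inherits the relative
    error [3 s] and adds the discrepancy [s], while halving [W] multiplies [s] by [sqrt 2]; and
    [4 <= 3 * sqrt 2]. The threshold [36 * cost] keeps [3 s <= 1/2], so that sums over the ball stay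
    below [2 * W]. *)
Lemma discretizes_half Ys W : discretizes Ys W (3 * sqrt (cost / W)) -> 36 * cost <= W ->
  exists Ys', discretizes Ys' (W / 2) (3 * sqrt (cost / (W / 2))).
Proof.
  intros HY HW. pose proof cost_pos as HG. pose proof (INR_v_pos v v_pos) as Hv.
  set (s := sqrt (cost / W)) in *.
  assert (Hs0 : 0 <= s) by apply sqrt_pos.
  assert (Hs2 : s ^ 2 = cost / W).
  { apply pow2_sqrt. apply Rdiv_le_0_compat; lra. }
  assert (Hs : 3 * s <= 1 / 2).
  { assert (9 * (cost / W) <= 1 / 4).
    { apply Rmult_le_reg_r with W; [lra|]. field_simplify; lra. }
    nra. }
  pose proof (discretizes_count Ys W _ HY) as Hc. destruct HY as (Hi & Hl & HY).
  apply Rabs_le_between in Hc.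
  assert (Hn : (1 <= length Ys)%nat).
  { destruct (length Ys); [simpl in Hc; nra|lia]. }
  assert (HR : forall u, sparse_ball Lam v u -> Rsum Ys (fun y => Cmod (u y) ^ 2) <= 2 * W).
  { intros u (S & c & HS & H1 & E). specialize (HY S c HS H1).
    rewrite (Rsum_ext _ _ (fun y => Cmod (trigpoly S c y) ^ 2)) by (intros; rewrite E; auto).
    apply Rabs_le_between in HY. nra. }
  destruct (halving_step Lam v v_pos Lam_ne Ys (2 * W) L Hn) as (I & I' & HP & HD); auto.
  { lra. }
  { eapply Rle_trans; [|exact L_big]. apply le_INR in Hl. lra. }
  exists I. split; [|split].
  - intros y Hy. apply Hi. rewrite HP. apply in_or_app; auto.
  - apply Permutation_length in HP. rewrite length_app in HP. lia.
  - intros S c HS H1. specialize (HY S c HS H1).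
    assert (Hu : sparse_ball Lam v (trigpoly S c)) by (exists S, c; auto).
    specialize (HD _ Hu). unfold signed_sum in HD.
    rewrite (Rsum_perm _ _ _ HP), Rsum_app in HY.
    set (q := Rsum S (fun k => Cmod (c k) ^ 2)) in *.
    set (A := Rsum I (fun y => Cmod (trigpoly S c y) ^ 2)) in *.
    set (B := Rsum I' (fun y => Cmod (trigpoly S c y) ^ 2)) in *.
    assert (HE : INR (L + 1) * sqrt (kappa * INR v * (2 * W) * logs Lam (length Ys)) <= W * s).
    { rewrite <- (sqrt_pow2 (INR (L + 1))) by apply pos_INR.
      replace (W * s) with (sqrt ((W * s) ^ 2)) by (apply sqrt_pow2; nra).
      rewrite <- sqrt_mult_alt by apply pow2_ge_0. apply sqrt_le_1_alt.
      rewrite Rpow_mult_distr, Hs2.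
      replace (W ^ 2 * (cost / W)) with (cost * W) by (field; lra). unfold cost.
      replace (INR (L + 1) ^ 2 * (kappa * INR v * (2 * W) * logs Lam (length Ys)))
        with (2 * kappa * INR (L + 1) ^ 2 * INR v * W * logs Lam (length Ys)) by ring.
      replace (2 * kappa * INR (L + 1) ^ 2 * INR v * logs Lam (length Y0) * W)
        with (2 * kappa * INR (L + 1) ^ 2 * INR v * W * logs Lam (length Y0)) by ring.
      apply Rmult_le_compat_l.
      - pose proof (pos_INR (L + 1)). unfold kappa. repeat apply Rmult_le_pos; lra.
      - unfold logs. destruct (logs_ge_1 Lam Lam_ne _ Hn) as (_ & H2 & _).
        apply Rmult_le_compat_r; [lra|]. apply ln_le.
        + apply le_INR in Hn. simpl in Hn. lra.
        + apply le_INR in Hl. lra. }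
    assert (H4 : 4 * s <= 3 * sqrt (cost / (W / 2))).
    { replace (cost / (W / 2)) with (2 * (cost / W)) by (field; lra).
      set (s' := sqrt (2 * (cost / W))).
      assert (s' ^ 2 = 2 * s ^ 2).
      { rewrite Hs2. apply pow2_sqrt. rewrite <- Hs2. nra. }
      assert (0 <= s') by apply sqrt_pos. nra. }
    assert (HD' : Rabs (A - B) <= W * s) by lra.
    apply Rabs_le_between in HD', HY. apply Rabs_le. nra.
Qed.

(** Halving goes on until [W] lies between [36 * cost] and [72 * cost]; it must stop because
    [n0 / 2 ^ t] falls below 1. If [Y0] is smaller from the start it is kept whole, being exact. *)
Lemma exists_discretizes : exists Ys W,
  discretizes Ys W (1 / 2) /\ 0 < W <= 72 * cost.
Proof.
  pose proof cost_pos as HG. pose proof (INR_v_pos v v_pos) as Hv.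
  set (n0 := INR (length Y0)).
  assert (Hn0 : 1 <= n0) by (apply (le_INR 1), Y0_ne).
  assert (Hsq : forall W, 36 * cost <= W -> 3 * sqrt (cost / W) <= 1 / 2).
  { intros W HW. assert (H : cost / W <= 1 / 36).
    { apply Rmult_le_reg_r with W; [lra|]. field_simplify; lra. }
    apply sqrt_le_1_alt in H. replace (1 / 36) with ((1 / 6) ^ 2) in H by field.
    rewrite sqrt_pow2 in H; lra. }
  assert (Hex : forall err, 0 <= err -> discretizes Y0 n0 err).
  { intros err He. split; [apply incl_refl|]. split; [lia|]. intros S c HS _.
    rewrite exact by auto. fold n0. rewrite Rminus_diag, Rabs_R0. nra. }
  assert (H : forall t : nat, (exists Ys W, discretizes Ys W (1 / 2) /\ 0 < W <= 72 * cost) \/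
    ((exists Ys, discretizes Ys (n0 / 2 ^ t) (3 * sqrt (cost / (n0 / 2 ^ t)))) /\
     36 * cost <= n0 / 2 ^ t)).
  { induction t as [|t [IH|[[Ys HY] HW]]]; [|left; exact IH|].
    - simpl. rewrite Rdiv_1_r. destruct (Rle_dec (36 * cost) n0) as [Hle|Hle].
      + right. split; auto. exists Y0. apply Hex. pose proof (sqrt_pos (cost / n0)); lra.
      + left. exists Y0, n0. split; [apply Hex; lra|lra].
    - set (W := n0 / 2 ^ t) in *.
      destruct (Rle_dec W (72 * cost)) as [Hle|Hle].
      + left. exists Ys, W. split; [|lra]. destruct HY as (H1 & H2 & H3).
        split; [auto|]. split; [auto|]. intros S c HS Hc.
        eapply Rle_trans; [apply H3; auto|]. apply Rmult_le_compat_l; [lra|]. apply Hsq, HW.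
      + right. replace (n0 / 2 ^ S t) with (W / 2)
          by (unfold W; simpl; field; apply pow_nonzero; lra).
        split; [|lra]. apply discretizes_half with Ys; auto. }
  destruct (INR_unbounded n0) as [t Ht]. destruct (H t) as [|[_ Hbad]]; auto. exfalso.
  assert (Hp : INR t < 2 ^ t).
  { clear. induction t as [|t IH]; [simpl; lra|]. rewrite S_INR. simpl.
    pose proof (pow_R1_Rle 2 t ltac:(lra)). lra. }
  assert (n0 / 2 ^ t < 1).
  { apply Rmult_lt_reg_r with (2 ^ t); [lra|]. unfold Rdiv. rewrite Rmult_assoc, Rinv_l; lra. }
  lra.
Qed.

End Iterate.

(** * Equidistant grids and extraction of sample points *)

Definition grid1 (P : nat) : list R := map (fun a => 2 * PI * INR a / INR P) (seq 0 P).
Definition grid (d P : nat) : list (list R) := cart (repeat (grid1 P) d).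

Lemma Csum_grid1 P m : (0 < P)%nat -> (Z.abs m < Z.of_nat P)%Z ->
  Csum (grid1 P) (fun t => cexpi (IZR m * t)) = RtoC (if Z.eq_dec m 0 then INR P else 0).
Proof.
  intros HP Hm. unfold grid1. rewrite Csum_map.
  assert (HPR : 0 < INR P) by (apply lt_0_INR, HP).
  destruct (Z.eq_dec m 0) as [->|Hm0].
  - rewrite (Csum_ext _ _ (fun _ => RtoC 1)) by (intros; rewrite Rmult_0_l; apply cexpi_0).
    rewrite <- (RtoC_Rsum (seq 0 P) (fun _ => 1)), Rsum_const, length_seq, Rmult_1_r. reflexivity.
  - set (th := IZR m * (2 * PI) / INR P).
    assert (E : forall a, cexpi (IZR m * (2 * PI * INR a / INR P)) = cexpi (th * INR a)).
    { intros a. f_equal. unfold th. field. lra. }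
    rewrite (Csum_ext _ _ (fun a => cexpi (th * INR a))) by (intros; apply E).
    assert (Hgeo : forall n, ((cexpi th - 1) * Csum (seq 0 n) (fun a => cexpi (th * INR a))
                    = cexpi (th * INR n) - 1)%C).
    { induction n as [|n IH].
      - simpl. rewrite Rmult_0_r, cexpi_0. ring.
      - rewrite seq_S, Csum_app, Cmult_plus_distr_l, IH. simpl Csum.
        rewrite S_INR, Rmult_plus_distr_l, Rmult_1_r, cexpi_plus. ring. }
    specialize (Hgeo P).
    replace (th * INR P) with (IZR m * (2 * PI)) in Hgeo by (unfold th; field; lra).
    rewrite cexpi_2kPI in Hgeo.
    assert (Hne : (cexpi th - 1)%C <> RtoC 0).
    { intros H0. assert (Hc : cos th = 1).
      { apply (f_equal Re) in H0. rewrite Re_minus in H0. simpl in H0. unfold cexpi in H0. simpl in H0. lra. }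
      replace th with (2 * (th / 2)) in Hc by field. rewrite cos_2a_sin in Hc.
      assert (Hs : sin (th / 2) = 0) by nra.
      apply sin_eq_0_0 in Hs. destruct Hs as [k Hk].
      assert (HmP : IZR m = IZR (k * Z.of_nat P)).
      { rewrite mult_IZR, <- INR_IZR_INZ. unfold th in Hk. pose proof PI_RGT_0.
        apply Rmult_eq_reg_r with (PI / INR P); [|apply Rgt_not_eq, Rdiv_lt_0_compat; lra].
        transitivity (IZR m * (2 * PI) / INR P / 2); [field; lra|]. rewrite Hk. field. lra. }
      apply eq_IZR in HmP. subst m. rewrite Z.abs_mul in Hm.
      assert (k <> 0%Z) by (intros ->; apply Hm0; reflexivity).
      assert (1 <= Z.abs k)%Z by lia. nia. }
    set (G := Csum (seq 0 P) (fun a => cexpi (th * INR a))) in *.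
    replace G with (/ (cexpi th - 1) * ((cexpi th - 1) * G))%C by (field; auto).
    rewrite Hgeo. ring.
Qed.

Lemma Csum_grid d P m : (0 < P)%nat -> length m = d ->
  (forall z, In z m -> (Z.abs z < Z.of_nat P)%Z) ->
  Csum (grid d P) (charac m)
  = RtoC (if zl_eq_dec m (repeat 0%Z d) then INR (P ^ d) else 0).
Proof.
  intros HP. revert m. induction d as [|d IH]; intros m Hm Hz.
  - destruct m; [|discriminate]. destruct (zl_eq_dec _ _) as [_|H]; [|elim H; reflexivity].
    unfold grid, charac. simpl. rewrite cexpi_0. apply Cplus_0_r.
  - destruct m as [|a m]; [discriminate|]. unfold grid. cbn [repeat cart].
    rewrite Csum_flat_map.
    rewrite (Csum_ext _ _ (fun t => Csum (grid d P) (charac m) * cexpi (IZR a * t))%C).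
    + rewrite Csum_scal, Csum_grid1 by (auto; apply Hz, in_eq).
      rewrite IH; [|simpl in Hm; lia|intros; apply Hz, in_cons; auto].
      rewrite <- RtoC_mult. f_equal. cbn [repeat]. rewrite Nat.pow_succ_r', mult_INR.
      destruct (Z.eq_dec a 0), (zl_eq_dec m _), (zl_eq_dec (a :: m) _); try ring;
        exfalso; congruence.
    + intros t _. rewrite Csum_map. rewrite Cmult_comm, <- Csum_scal. apply Csum_ext.
      intros y _. apply charac_cons.
Qed.

Lemma length_grid d P : length (grid d P) = (P ^ d)%nat.
Proof. unfold grid. rewrite length_cart_repeat. unfold grid1. rewrite length_map, length_seq. reflexivity. Qed.

Lemma in_grid d P y : (0 < P)%nat -> In y (grid d P) ->
  length y = d /\ List.Forall (fun t => 0 <= t < 2 * PI) y.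
Proof.
  intros HP Hy. apply in_cart_repeat in Hy. destruct Hy as [Hl Hi]. split; auto.
  apply List.Forall_forall. intros t Ht. apply Hi in Ht. apply in_map_iff in Ht.
  destruct Ht as (a & <- & Ha). apply in_seq in Ha. pose proof two_PI_pos.
  assert (HPR : 0 < INR P) by (apply lt_0_INR, HP).
  assert (Ha' : INR a < INR P) by (apply lt_INR; lia). pose proof (pos_INR a).
  split.
  - apply Rdiv_le_0_compat; [nra|auto].
  - apply Rmult_lt_reg_r with (INR P); [auto|]. field_simplify; nra.
Qed.

Lemma bits_abs_lt z t : (bits z <= t)%nat -> (Z.abs z < 2 ^ Z.of_nat t)%Z.
Proof.
  unfold bits. destruct (Z.eq_dec z 0) as [->|Hz]; intros H.
  - simpl. apply Z.pow_pos_nonneg; lia.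
  - pose proof (Z.log2_nonneg (Z.abs z)).
    apply Z.log2_lt_pow2; lia.
Qed.

(** Coordinates of frequencies in the cube are below [2 ^ t] in modulus, so their differences stay
    below the grid size [2 ^ (t + 1)], and no nonzero difference is aliased to 0. *)
Lemma grid_exact d t v S c : sparse (box d t) v S ->
  Rsum (grid d (2 ^ (t + 1))) (fun y => Cmod (trigpoly S c y) ^ 2)
  = INR (length (grid d (2 ^ (t + 1)))) * Rsum S (fun k => Cmod (c k) ^ 2).
Proof.
  intros (Hd & Hi & _). set (P := (2 ^ (t + 1))%nat).
  assert (HP : (0 < P)%nat) by (apply Nat.neq_0_lt_0, Nat.pow_nonzero; lia).
  assert (HPZ : Z.of_nat P = (2 * 2 ^ Z.of_nat t)%Z).
  { unfold P. rewrite Nat2Z.inj_pow, Nat2Z.inj_add, Z.pow_add_r by lia. simpl (Z.of_nat 1).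
    change (Z.of_nat 2) with 2%Z. lia. }
  rewrite length_grid. apply RtoC_inj.
  rewrite RtoC_mult, !RtoC_Rsum, <- Csum_scal.
  rewrite (Csum_ext (grid d P) _ (fun y => Csum S (fun k => Csum S (fun l =>
     (c k * Cconj (c l)) * charac (zadd k (map Z.opp l)) y)%C))).
  - rewrite Csum_swap. apply Csum_ext. intros k Hk.
    rewrite Csum_swap.
    assert (Hin : forall l, In l S -> length l = d /\ forall z, In z l -> (Z.abs z < 2 ^ Z.of_nat t)%Z).
    { intros l Hl. apply Hi, in_box_list in Hl. destruct Hl as [H1 H2]. split; auto.
      intros z Hz. apply bits_abs_lt, H2, Hz. }
    destruct (Hin k Hk) as [Hkl Hkz].
    assert (E : forall l, In l S -> Csum (grid d P) (fun y =>
       (c k * Cconj (c l)) * charac (zadd k (map Z.opp l)) y)%C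
       = (c k * Cconj (c l) * RtoC (if zl_eq_dec k l then INR (P ^ d) else 0))%C).
    { intros l Hl. destruct (Hin l Hl) as [Hll Hlz]. rewrite Csum_scal, Csum_grid; auto.
      - f_equal. f_equal. pose proof (zadd_opp_zero k l ltac:(congruence)) as Z0. rewrite Hll in Z0.
        destruct (zl_eq_dec k l), (zl_eq_dec (zadd _ _) _); tauto.
      - rewrite length_zadd; rewrite length_map; congruence.
      - intros z Hz. unfold zadd in Hz. apply in_map_iff in Hz. destruct Hz as ([a b] & <- & Hab).
        pose proof (in_combine_l _ _ _ _ Hab) as Ha. pose proof (in_combine_r _ _ _ _ Hab) as Hb.
        apply in_map_iff in Hb. destruct Hb as (b' & <- & Hb'). simpl.
        specialize (Hkz a Ha). specialize (Hlz b' Hb'). lia. }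
    rewrite (Csum_ext S _ (fun l => c k * Cconj (c l) * RtoC (if zl_eq_dec k l then INR (P ^ d) else 0))%C)
      by (intros; apply E; auto).
    rewrite (Csum_single k); auto.
    + destruct (zl_eq_dec k k); [|congruence]. rewrite Cmod2_conj. ring.
    + intros b Hb Hne. destruct (zl_eq_dec k b); [congruence|]. ring.
  - intros y _. rewrite Cmod2_conj. unfold trigpoly. rewrite Cconj_Csum, Csum_mult.
    apply Csum_ext. intros k Hk. apply Csum_ext. intros l Hl.
    apply Hi, in_box_list in Hk. apply Hi, in_box_list in Hl.
    rewrite charac_zadd, charac_opp, Cmult_conj by (rewrite length_map; destruct Hk, Hl; congruence).
    ring.
Qed.

Lemma length_box d t : (1 <= length (box d t) <= 2 ^ ((t + 1) * d))%nat.
Proof.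
  split.
  - assert (H : In (repeat 0%Z d) (box d t)).
    { apply in_box_list. split; [apply repeat_length|]. intros z Hz. apply repeat_spec in Hz.
      subst. unfold bits. simpl. lia. }
    destruct (box d t); [destruct H|simpl; lia].
  - unfold box. rewrite length_cart_repeat, Nat.pow_mul_r. apply Nat.pow_le_mono_l.
    set (P := (2 ^ (t + 1))%nat).
    assert (HPZ : Z.of_nat P = (2 * 2 ^ Z.of_nat t)%Z).
    { unfold P. rewrite Nat2Z.inj_pow, Nat2Z.inj_add, Z.pow_add_r by lia. simpl (Z.of_nat 1).
      change (Z.of_nat 2) with 2%Z. lia. }
    assert (HL : length (map (fun n => (Z.of_nat n - 2 ^ Z.of_nat t)%Z) (seq 0 P)) = P)
      by (rewrite length_map, length_seq; auto).
    rewrite <- HL. apply NoDup_incl_length; [apply NoDup_vlist|].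
    intros z Hz. apply in_vlist, bits_abs_lt in Hz. apply in_map_iff.
    exists (Z.to_nat (z + 2 ^ Z.of_nat t)). split; [lia|]. apply in_seq. lia.
Qed.

Lemma rip_grid d t v : (1 <= v)%nat -> exists Ys W, 0 < W /\ (1 <= length Ys)%nat /\
  INR (length Ys) <= 216 * kappa * INR v * INR ((t + 1) * d + 3) ^ 4 /\
  W / 2 <= INR (length Ys) <= 3 * W / 2 /\
  (forall y, In y Ys -> length y = d /\ List.Forall (fun t => 0 <= t < 2 * PI) y) /\
  forall S c, sparse (box d t) v S ->
    W / 2 * Rsum S (fun k => Cmod (c k) ^ 2) <= Rsum Ys (fun y => Cmod (trigpoly S c y) ^ 2)
    <= 3 * W / 2 * Rsum S (fun k => Cmod (c k) ^ 2).
Proof.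
  intros Hv. set (P := (2 ^ (t + 1))%nat). set (e := ((t + 1) * d)%nat).
  assert (HP : (0 < P)%nat) by (apply Nat.neq_0_lt_0, Nat.pow_nonzero; lia).
  assert (Hlg : length (grid d P) = (2 ^ e)%nat).
  { rewrite length_grid. unfold P, e. rewrite Nat.pow_mul_r. reflexivity. }
  assert (Hlg1 : (1 <= length (grid d P))%nat).
  { rewrite Hlg. apply Nat.neq_0_lt_0, Nat.pow_nonzero. lia. }
  destruct (length_box d t) as [HB1 HB2]. fold e in HB2.
  assert (HL : 2 * INR (length (grid d P)) <= 2 ^ (e + 1)).
  { rewrite Hlg, pow_INR, pow_add, pow_1. replace (INR 2) with 2 by (simpl; ring). lra. }
  pose proof (grid_exact d t v) as Hex. fold P in Hex.
  destruct (exists_discretizes (box d t) v (grid d P) (e + 1) Hv HB1 Hlg1 HL Hex)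
    as (Ys & W & HY & HW).
  assert (Hc := HY). eapply discretizes_count in Hc; auto. apply Rabs_le_between in Hc.
  destruct HY as (Hi & _ & HY).
  exists Ys, W. split; [lra|].
  split. { destruct (length Ys); [simpl in Hc; lra|lia]. }
  split.
  (* Here [216 = 3/2 * 72 * 2]. The fourth power of [x] consists of the squared number of chaining
     levels and of the two logarithms in [logs], each at most [x]. *)
  { apply Rle_trans with (3 / 2 * (72 * cost (box d t) v (grid d P) (e + 1))); [lra|].
    unfold cost. replace (e + 1 + 1)%nat with (e + 2)%nat by lia.
    set (x := INR (e + 3)).
    assert (Hx : 3 <= x).
    { unfold x. rewrite plus_INR. simpl. pose proof (pos_INR e). lra. }
    assert (Hx2 : 0 <= INR (e + 2) <= x) by (split; [apply pos_INR|apply le_INR; lia]).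
    assert (Hln : forall y, 1 <= y -> y <= 2 ^ (e + 3) -> 0 <= ln y <= x).
    { intros y H1 H2. split; [rewrite <- ln_1; apply ln_le; lra|].
      apply Rle_trans with (ln (2 ^ (e + 3))); [apply ln_le; lra|].
      rewrite ln_pow by lra. fold x. rewrite <- (Rmult_1_r x) at 2.
      apply Rmult_le_compat_l; [lra|]. rewrite <- (ln_exp 1). apply ln_le; [lra|]. apply exp_1_ge_2. }
    assert (H2e : 1 <= 2 ^ e) by (apply pow_R1_Rle; lra).
    assert (Hlogs : logs (box d t) (length (grid d P)) <= x ^ 2).
    { unfold logs. rewrite Hlg, pow_INR. simpl (INR 2). replace (1 + 1) with 2 by ring.
      apply le_INR in HB1, HB2. rewrite pow_INR in HB2. simpl (INR 2) in HB2.
      replace (1 + 1) with 2 in HB2 by ring. simpl (INR 1) in HB1.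
      assert (E8 : 2 ^ (e + 3) = 8 * 2 ^ e) by (rewrite pow_add; ring).
      replace (x ^ 2) with (x * x) by ring.
      destruct (Hln (4 * 2 ^ e)) as [Ha Hb]; [lra|lra|].
      destruct (Hln (4 * INR (length (box d t)) + 1)) as [Hc1 Hc2]; [lra|lra|].
      apply Rmult_le_compat; auto. }
    assert (Hlogs0 : 1 <= logs (box d t) (length (grid d P))) by (apply logs_ge_1; auto).
    pose proof (INR_v_pos v Hv).
    assert (H4 : INR (e + 2) ^ 2 * logs (box d t) (length (grid d P)) <= x ^ 4).
    { replace (x ^ 4) with (x ^ 2 * x ^ 2) by ring.
      apply Rmult_le_compat; [apply pow2_ge_0|lra| |exact Hlogs]. apply pow_incr, Hx2. }
    replace (3 / 2 * (72 * (2 * kappa * INR (e + 2) ^ 2 * INR v * logs (box d t) (length (grid d P)))))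
      with (216 * kappa * INR v * (INR (e + 2) ^ 2 * logs (box d t) (length (grid d P)))) by field.
    apply Rmult_le_compat_l; [|exact H4]. unfold kappa. repeat apply Rmult_le_pos; lra. }
  split; [lra|].
  split. { intros y Hy. apply (in_grid d P); auto. }
  intros S c HS.
  set (q := Rsum S (fun k => Cmod (c k) ^ 2)).
  assert (Hq : 0 <= q) by (apply Rsum_ge0; intros; apply pow2_ge_0).
  destruct (Req_dec q 0) as [Hq0|Hq0].
  { rewrite Hq0, !Rmult_0_r. assert (Hz : forall k, In k S -> c k = RtoC 0).
    { intros k Hk. apply Cmod_eq_0.
      pose proof (Rsum_elem S (fun k => Cmod (c k) ^ 2) k (fun b _ => pow2_ge_0 _) Hk) as H.
      fold q in H. simpl in H. pose proof (Cmod_ge_0 (c k)). nra. }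
    rewrite Rsum_zero; [lra|]. intros y _. unfold trigpoly.
    rewrite Csum_zero; [rewrite Cmod_0; ring|]. intros k Hk. rewrite Hz by auto. ring. }
  (* The error in [discretizes] does not scale with the polynomial, so [c] is first normalized to
     unit l2 norm. *)
  set (s := sqrt q). assert (Hs : 0 < s) by (apply sqrt_lt_R0; lra).
  assert (Hs2 : s ^ 2 = q) by (apply pow2_sqrt; lra).
  set (c' := fun k => (RtoC (/ s) * c k)%C).
  assert (His : 0 < / s) by (apply Rinv_0_lt_compat, Hs).
  assert (Eq' : Rsum S (fun k => Cmod (c' k) ^ 2) = 1).
  { transitivity ((/ s) ^ 2 * q); [|rewrite pow_inv, Hs2; field; auto].
    unfold q. rewrite <- Rsum_scal. apply Rsum_ext. intros k _. unfold c'.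
    rewrite Cmod_mult, Cmod_R, Rabs_pos_eq by lra. apply Rpow_mult_distr. }
  assert (EY : Rsum Ys (fun y => Cmod (trigpoly S c y) ^ 2)
     = q * Rsum Ys (fun y => Cmod (trigpoly S c' y) ^ 2)).
  { rewrite <- Rsum_scal. apply Rsum_ext. intros y _. rewrite <- Hs2, <- Rpow_mult_distr. f_equal.
    rewrite <- (Rabs_pos_eq s) at 1 by lra. rewrite <- Cmod_R, <- Cmod_mult. f_equal.
    unfold trigpoly. rewrite <- Csum_scal. apply Csum_ext. intros k _. unfold c'.
    rewrite !Cmult_assoc, <- RtoC_mult, Rinv_r by lra. ring. }
  pose proof (HY S c' HS) as H. rewrite Eq' in H. specialize (H (Rle_refl 1)).
  rewrite EY. apply Rabs_le_between in H. split; nra.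
Qed.

(** * Least squares *)

(** Adapts the point set to a prescribed [m]. Each entry is repeated [q] or [q + 1] times with
    [q = m / n >= 1], so its multiplicity differs from the real quotient by a factor at most 2. *)
Lemma resample {A} (Ys : list A) m : (1 <= length Ys <= m)%nat ->
  exists xi, length xi = m /\ incl xi Ys /\
    forall F, (forall y, In y Ys -> 0 <= F y) ->
      INR m / (2 * INR (length Ys)) * Rsum Ys F <= Rsum xi F
      <= 2 * INR m / INR (length Ys) * Rsum Ys F.
Proof.
  intros Hm. set (n := length Ys) in *. set (q := (m / n)%nat). set (r := (m mod n)%nat).
  assert (Em : m = (q * n + r)%nat) by (unfold q, r; rewrite (Nat.div_mod_eq m n) at 1; lia).
  assert (Hr : (r < n)%nat) by (apply Nat.mod_upper_bound; lia).
  assert (Hq : (1 <= q)%nat) by (apply Nat.div_le_lower_bound; lia).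
  exists (concat (repeat Ys q) ++ firstn r Ys). split; [|split].
  - rewrite length_app, length_firstn.
    assert (E : forall i, length (concat (repeat Ys i)) = (i * n)%nat).
    { induction i as [|i IH]; simpl; [auto|]. rewrite length_app, IH. reflexivity. }
    rewrite E. lia.
  - intros y Hy. apply in_app_or in Hy. destruct Hy as [Hy|Hy].
    + apply in_concat in Hy. destruct Hy as (l & Hl & Hy). apply repeat_spec in Hl. subst l; auto.
    + rewrite <- (firstn_skipn r Ys). apply in_or_app; auto.
  - intros F HF. set (s := Rsum Ys F).
    assert (Hs : 0 <= s) by (apply Rsum_ge0, HF).
    assert (E : forall i, Rsum (concat (repeat Ys i)) F = INR i * s).
    { induction i as [|i IH]; [simpl; ring|]. simpl concat.
      rewrite Rsum_app, IH, S_INR. unfold s. ring. }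
    assert (Hf : 0 <= Rsum (firstn r Ys) F <= s).
    { assert (Es : s = Rsum (firstn r Ys) F + Rsum (skipn r Ys) F)
        by (rewrite <- Rsum_app, firstn_skipn; reflexivity).
      assert (0 <= Rsum (firstn r Ys) F /\ 0 <= Rsum (skipn r Ys) F); [|lra].
      split; apply Rsum_ge0; intros y Hy; apply HF; rewrite <- (firstn_skipn r Ys);
        apply in_or_app; auto. }
    rewrite Rsum_app, E.
    assert (Hn : 0 < INR n) by (apply lt_0_INR; lia).
    assert (HmR : INR m = INR q * INR n + INR r) by (rewrite Em at 1; rewrite plus_INR, mult_INR; ring).
    assert (HrR : INR r < INR n) by (apply lt_INR, Hr). pose proof (pos_INR r).
    assert (HqR : 1 <= INR q) by (apply (le_INR 1), Hq).
    split.
    + apply Rle_trans with (INR q * s); [|lra]. apply Rmult_le_compat_r; auto.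
      apply Rmult_le_reg_r with (2 * INR n); [lra|]. field_simplify; nra.
    + apply Rle_trans with ((INR q + 1) * s); [lra|]. apply Rmult_le_compat_r; auto.
      apply Rmult_le_reg_r with (INR n); [lra|]. field_simplify; nra.
Qed.

Definition emp (xi : list (list R)) (u : list R -> C) : R :=
  Rsum xi (fun y => Cmod (u y) ^ 2) / INR (length xi).

(** The constant 6 is the ratio of 3/2 to 1/2 from the discretization, times the 2 lost in
    [resample]. *)
Lemma good_points d t v m : (1 <= v)%nat ->
  216 * kappa * INR v * INR ((t + 1) * d + 3) ^ 4 <= INR m ->
  exists xi, sample_points d m xi /\ (1 <= length xi)%nat /\
  forall S c, sparse (box d t) v S ->
    Rsum S (fun k => Cmod (c k) ^ 2) / 6 <= emp xi (trigpoly S c)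
    <= 6 * Rsum S (fun k => Cmod (c k) ^ 2).
Proof.
  intros Hv Hm. destruct (rip_grid d t v Hv) as (Ys & W & HW & Hn & Hc & HnW & Hgr & HY).
  destruct (resample Ys m) as (xi & Hl & Hi & HF).
  { split; auto. apply INR_le. lra. }
  exists xi. split; [|split].
  - split; auto. apply List.Forall_forall. intros y Hy. apply Hgr, Hi, Hy.
  - rewrite Hl. apply INR_le. apply (le_INR 1) in Hn. simpl in *. lra.
  - intros S c HS. specialize (HY S c HS).
    specialize (HF (fun y => Cmod (trigpoly S c y) ^ 2) (fun y _ => pow2_ge_0 _)).
    unfold emp. rewrite Hl.
    set (q := Rsum S (fun k => Cmod (c k) ^ 2)) in *.
    set (A := Rsum Ys (fun y => Cmod (trigpoly S c y) ^ 2)) in *.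
    set (B := Rsum xi (fun y => Cmod (trigpoly S c y) ^ 2)) in *.
    assert (Hq : 0 <= q) by (apply Rsum_ge0; intros; apply pow2_ge_0).
    assert (HnR : 1 <= INR (length Ys)) by (apply (le_INR 1), Hn).
    assert (HmR : 1 <= INR m) by lra.
    set (n := INR (length Ys)) in *.
    assert (HB : A / (2 * n) <= B / INR m <= 2 * A / n).
    { split.
      - apply Rmult_le_reg_r with (INR m); [lra|].
        replace (B / INR m * INR m) with B by (field; lra).
        eapply Rle_trans; [|apply HF]. right. field. lra.
      - apply Rmult_le_reg_r with (INR m); [lra|].
        replace (B / INR m * INR m) with B by (field; lra).
        eapply Rle_trans; [apply HF|]. right. field. lra. }
    split.
    + eapply Rle_trans; [|apply HB]. apply Rmult_le_reg_r with (2 * n); [lra|].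
      replace (A / (2 * n) * (2 * n)) with A by (field; lra).
      apply Rle_trans with (W / 2 * q); [|apply HY]. nra.
    + eapply Rle_trans; [apply HB|]. apply Rmult_le_reg_r with n; [lra|].
      replace (2 * A / n * n) with (2 * A) by (field; lra).
      apply Rle_trans with (2 * (3 * W / 2 * q)); [apply Rmult_le_compat_l; [lra|apply HY]|]. nra.
Qed.

Lemma emp_ge0 xi u : (1 <= length xi)%nat -> 0 <= emp xi u.
Proof.
  intros H. apply Rdiv_le_0_compat; [|apply lt_0_INR; lia].
  apply Rsum_ge0. intros; apply pow2_ge_0.
Qed.

Lemma emp_triangle xi u w : (1 <= length xi)%nat ->
  sqrt (emp xi (fun y => u y + w y)%C) <= sqrt (emp xi u) + sqrt (emp xi w).
Proof.
  intros H. assert (Hn : 0 < INR (length xi)) by (apply lt_0_INR; lia).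
  unfold emp. rewrite !sqrt_div_alt by auto.
  assert (Hs : 0 < sqrt (INR (length xi))) by (apply sqrt_lt_R0, Hn).
  unfold Rdiv. rewrite <- Rmult_plus_distr_r.
  apply Rmult_le_compat_r; [left; apply Rinv_0_lt_compat, Hs|].
  eapply Rle_trans; [|apply Rsum_minkowski]. apply sqrt_le_1_alt, Rsum_le.
  intros y _. apply pow_incr. split; [apply Cmod_ge_0|apply Cmod_triangle].
Qed.

Lemma emp_ext xi u w : (forall y, In y xi -> u y = w y) -> emp xi u = emp xi w.
Proof. intros H. unfold emp. f_equal. apply Rsum_ext. intros y Hy. rewrite H; auto. Qed.

Lemma emp_le_sup xi u t : (1 <= length xi)%nat -> 0 <= t ->
  (forall y, In y xi -> Cmod (u y) <= t) -> sqrt (emp xi u) <= t.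
Proof.
  intros Hl Ht H. assert (Hn : 0 < INR (length xi)) by (apply lt_0_INR; lia).
  rewrite <- (sqrt_pow2 t) by auto. apply sqrt_le_1_alt. unfold emp.
  apply Rmult_le_reg_r with (INR (length xi)); [auto|].
  unfold Rdiv. rewrite Rmult_assoc, Rinv_l by lra. rewrite Rmult_1_r, Rmult_comm.
  apply Rsum_le_const. intros y Hy. apply pow_incr. split; [apply Cmod_ge_0|auto].
Qed.

Lemma trigpoly_app T1 T2 c y : trigpoly (T1 ++ T2) c y = (trigpoly T1 c y + trigpoly T2 c y)%C.
Proof. apply Csum_app. Qed.

(** * Empirical norms of polynomials that are not sparse *)

Section Bessel.
Variables (Lam : list (list Z)) (v : nat) (xi : list (list R)) (U : R).
Hypothesis v_pos : (1 <= v)%nat.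
Hypothesis xi_ne : (1 <= length xi)%nat.
Hypothesis U_pos : 0 <= U.
Hypothesis upper : forall S c, sparse Lam v S ->
  sqrt (emp xi (trigpoly S c)) <= U * sqrt (Rsum S (fun k => Cmod (c k) ^ 2)).
Variable c : list Z -> C.

Lemma top_block T : NoDup T -> incl T Lam -> (v < length T)%nat ->
  exists T1 T2, Permutation T (T1 ++ T2) /\ sparse Lam v T1 /\ NoDup T2 /\ incl T2 Lam /\
    (length T2 < length T)%nat /\
    forall k, In k T2 -> Cmod (c k) <= Rsum T1 (fun k => Cmod (c k)) / INR v.
Proof.
  intros Hd Hi Hl. destruct (exists_top (fun k => Cmod (c k)) v T) as (T1 & T2 & HP & H1 & H2); [lia|].
  assert (Hd' : NoDup (T1 ++ T2)) by (eapply Permutation_NoDup; eauto).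
  exists T1, T2. split; auto. split; [|split; [|split; [|split]]].
  - split; [eapply NoDup_app_remove_r; eauto|]. split; [|lia].
    intros k Hk. apply Hi. rewrite HP. apply in_or_app; auto.
  - eapply NoDup_app_remove_l; eauto.
  - intros k Hk. apply Hi. rewrite HP. apply in_or_app; auto.
  - apply Permutation_length in HP. rewrite length_app in HP. lia.
  - intros k Hk. pose proof (INR_v_pos v v_pos) as Hv.
    apply Rmult_le_reg_r with (INR v); [lra|]. unfold Rdiv. rewrite Rmult_assoc, Rinv_l by lra.
    rewrite Rmult_1_r, Rmult_comm, <- H1, <- Rsum_const. apply Rsum_le. intros a Ha. auto.
Qed.

(** Blocks of [v] coefficients are peeled off in decreasing order. A block costs [sqrt v] times its
    supremum, which is at most the average of the preceding block, and these costs add up to the l1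
    norm over [sqrt v]. The induction is on a bound [n] for the number of frequencies. *)
Lemma emp_bound_sup n : forall T s, (length T <= n)%nat -> NoDup T -> incl T Lam ->
  0 <= s -> (forall k, In k T -> Cmod (c k) <= s) ->
  sqrt (emp xi (trigpoly T c))
  <= U * (sqrt (INR v) * s + Rsum T (fun k => Cmod (c k)) / sqrt (INR v)).
Proof.
  pose proof (INR_v_pos v v_pos) as Hv.
  assert (Hsv : 0 < sqrt (INR v)) by (apply sqrt_lt_R0; lra).
  assert (Hss : sqrt (INR v) * sqrt (INR v) = INR v) by (apply sqrt_sqrt; lra).
  induction n as [|n IH]; intros T s Hn Hd Hi Hs Hc;
    (destruct (le_lt_dec (length T) v) as [Hl|Hl];
     [|(try lia)]).
  1,2: eapply Rle_trans; [apply upper; split; auto|];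
    apply Rmult_le_compat_l; auto;
    assert (H0 : 0 <= Rsum T (fun k => Cmod (c k)) / sqrt (INR v))
      by (apply Rdiv_le_0_compat; [apply Rsum_ge0; intros; apply Cmod_ge_0|auto]);
    apply Rle_trans with (sqrt (INR v) * s); [|lra];
    rewrite <- (sqrt_pow2 s) by auto; rewrite <- sqrt_mult_alt by lra; apply sqrt_le_1_alt;
    (apply Rle_trans with (INR (length T) * s ^ 2);
      [apply Rsum_le_const; intros k Hk; apply pow_incr; split; [apply Cmod_ge_0|auto]
      |apply Rmult_le_compat_r; [apply pow2_ge_0|apply le_INR, Hl]]).
  destruct (top_block T Hd Hi Hl) as (T1 & T2 & HP & HS1 & Hd2 & Hi2 & Hl2 & Ht).
  rewrite (emp_ext xi _ (fun y => trigpoly T1 c y + trigpoly T2 c y)%C)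
    by (intros y _; rewrite <- trigpoly_app; apply Csum_perm, HP).
  rewrite (Rsum_perm _ _ _ HP), Rsum_app.
  set (a1 := Rsum T1 (fun k => Cmod (c k))) in *. set (a2 := Rsum T2 (fun k => Cmod (c k))).
  assert (Ha1 : 0 <= a1) by (apply Rsum_ge0; intros; apply Cmod_ge_0).
  eapply Rle_trans; [apply emp_triangle, xi_ne|].
  apply Rle_trans with (U * (sqrt (INR v) * s) + U * (a1 / sqrt (INR v) + a2 / sqrt (INR v))).
  - apply Rplus_le_compat.
    + eapply Rle_trans; [apply upper, HS1|]. apply Rmult_le_compat_l; auto.
      rewrite <- (sqrt_pow2 s) by auto. rewrite <- sqrt_mult_alt by lra. apply sqrt_le_1_alt.
      apply Rle_trans with (INR (length T1) * s ^ 2).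
      * apply Rsum_le_const. intros k Hk. apply pow_incr. split; [apply Cmod_ge_0|].
        apply Hc. rewrite HP. apply in_or_app; auto.
      * apply Rmult_le_compat_r; [apply pow2_ge_0|]. apply le_INR, HS1.
    + eapply Rle_trans; [apply (IH T2 (a1 / INR v)); auto; [lia|apply Rdiv_le_0_compat; lra]|].
      apply Rmult_le_compat_l; auto. fold a2. apply Rplus_le_compat_r. right.
      replace (a1 / INR v) with (a1 / (sqrt (INR v) * sqrt (INR v))) by (rewrite Hss; reflexivity).
      field. lra.
  - right. field. lra.
Qed.

(** The first block is charged by its l2 norm; all later ones fall under [emp_bound_sup] with the
    average of the first block as supremum. *)
Lemma emp_bound T : NoDup T -> incl T Lam ->
  sqrt (emp xi (trigpoly T c))
  <= U * (sqrt (Rsum T (fun k => Cmod (c k) ^ 2)) + Rsum T (fun k => Cmod (c k)) / sqrt (INR v)).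
Proof.
  intros Hd Hi. pose proof (INR_v_pos v v_pos) as Hv.
  assert (Hsv : 0 < sqrt (INR v)) by (apply sqrt_lt_R0; lra).
  assert (Hss : sqrt (INR v) * sqrt (INR v) = INR v) by (apply sqrt_sqrt; lra).
  destruct (le_lt_dec (length T) v) as [Hl|Hl].
  - eapply Rle_trans; [apply upper; split; auto|]. apply Rmult_le_compat_l; auto.
    assert (0 <= Rsum T (fun k => Cmod (c k)) / sqrt (INR v)); [|lra].
    apply Rdiv_le_0_compat; [apply Rsum_ge0; intros; apply Cmod_ge_0|auto].
  - destruct (top_block T Hd Hi Hl) as (T1 & T2 & HP & HS1 & Hd2 & Hi2 & Hl2 & Ht).
    rewrite (emp_ext xi _ (fun y => trigpoly T1 c y + trigpoly T2 c y)%C)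
      by (intros y _; rewrite <- trigpoly_app; apply Csum_perm, HP).
    rewrite !(Rsum_perm _ _ _ HP), !Rsum_app.
    set (a1 := Rsum T1 (fun k => Cmod (c k))) in *. set (a2 := Rsum T2 (fun k => Cmod (c k))).
    assert (Ha1 : 0 <= a1) by (apply Rsum_ge0; intros; apply Cmod_ge_0).
    eapply Rle_trans; [apply emp_triangle, xi_ne|].
    apply Rle_trans with (U * sqrt (Rsum T1 (fun k => Cmod (c k) ^ 2))
                          + U * (a1 / sqrt (INR v) + a2 / sqrt (INR v))).
    + apply Rplus_le_compat; [apply upper, HS1|].
      eapply Rle_trans; [apply (emp_bound_sup (length T2) T2 (a1 / INR v)); auto;
                         apply Rdiv_le_0_compat; lra|].
      apply Rmult_le_compat_l; auto. fold a2. apply Rplus_le_compat_r. right.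
      replace (a1 / INR v) with (a1 / (sqrt (INR v) * sqrt (INR v))) by (rewrite Hss; reflexivity).
      field. lra.
    + rewrite <- Rmult_plus_distr_l. apply Rmult_le_compat_l; auto.
      assert (sqrt (Rsum T1 (fun k => Cmod (c k) ^ 2))
              <= sqrt (Rsum T1 (fun k => Cmod (c k) ^ 2) + Rsum T2 (fun k => Cmod (c k) ^ 2))).
      { apply sqrt_le_1_alt. assert (0 <= Rsum T2 (fun k => Cmod (c k) ^ 2)); [|lra].
        apply Rsum_ge0; intros; apply pow2_ge_0. }
      replace ((a1 + a2) / sqrt (INR v)) with (a1 / sqrt (INR v) + a2 / sqrt (INR v)) by (field; lra).
      lra.
Qed.

End Bessel.

(** * Existence of least squares minimizers *)

Definition dotp (xi : list (list R)) (u w : list R -> C) : C :=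
  Csum xi (fun y => u y * Cconj (w y))%C.

Lemma dotp_comb xi u u' w z :
  dotp xi (fun y => u y - z * u' y)%C w = (dotp xi u w - z * dotp xi u' w)%C.
Proof. unfold dotp. rewrite <- Csum_scal, <- Csum_minus. apply Csum_ext. intros; ring. Qed.

Lemma dotp_trig xi u S c : (forall k, In k S -> dotp xi u (charac k) = RtoC 0) ->
  dotp xi u (trigpoly S c) = RtoC 0.
Proof.
  intros H. unfold dotp, trigpoly.
  rewrite (Csum_ext _ _ (fun y => Csum S (fun k => Cconj (c k) * (u y * Cconj (charac k y)))%C)).
  - rewrite Csum_swap. apply Csum_zero. intros k Hk. rewrite Csum_scal.
    change (Csum xi (fun y => u y * Cconj (charac k y))%C) with (dotp xi u (charac k)).
    rewrite H by auto. ring.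
  - intros y _. rewrite Cconj_Csum, <- Csum_scal. apply Csum_ext. intros k _.
    rewrite Cmult_conj. ring.
Qed.

Lemma dotp_self xi u : dotp xi u u = RtoC (Rsum xi (fun y => Cmod (u y) ^ 2)).
Proof. unfold dotp. rewrite RtoC_Rsum. apply Csum_ext. intros; symmetry; apply Cmod2_conj. Qed.

(** Gram-Schmidt for the empirical form, which may be degenerate: if [q = 0], the residual [rk]
    vanishes on [xi], every product with it is 0, and [z = 0] will do. *)
Lemma exists_projection xi S : NoDup S -> forall f, exists c,
  forall k, In k S -> dotp xi (fun y => f y - trigpoly S c y)%C (charac k) = RtoC 0.
Proof.
  induction S as [|k S IH]; intros Hd f; [exists (fun _ => RtoC 0); intros k []|].
  inversion Hd as [|? ? Hk HdS]; subst. specialize (IH HdS).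
  destruct (IH f) as [cf Hf]. destruct (IH (charac k)) as [ck Hck].
  set (rf := fun y => (f y - trigpoly S cf y)%C) in *.
  set (rk := fun y => (charac k y - trigpoly S ck y)%C) in *.
  set (q := Rsum xi (fun y => Cmod (rk y) ^ 2)).
  set (z := if Req_EM_T q 0 then RtoC 0 else (dotp xi rf rk / RtoC q)%C).
  set (c := fun l => if zl_eq_dec l k then z else (cf l - z * ck l)%C).
  assert (Eres : forall y, (f y - trigpoly (k :: S) c y)%C = (rf y - z * rk y)%C).
  { intros y. unfold trigpoly. rewrite Csum_cons.
    rewrite (Csum_ext S _ (fun l => cf l * charac l y - z * (ck l * charac l y))%C).
    - rewrite Csum_minus, Csum_scal. unfold c, rf, rk, trigpoly.
      destruct (zl_eq_dec k k); [|congruence]. ring.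
    - intros l Hl. unfold c. destruct (zl_eq_dec l k); [congruence|]. ring. }
  assert (HS : forall l, In l S -> dotp xi (fun y => rf y - z * rk y)%C (charac l) = RtoC 0).
  { intros l Hl. rewrite dotp_comb, Hf, Hck by auto. ring. }
  exists c. intros l Hl.
  rewrite (functional_extensionality (fun y => f y - trigpoly (k :: S) c y)%C
             (fun y => rf y - z * rk y)%C Eres).
  destruct Hl as [<-|Hl]; [|auto].
  assert (Ek : dotp xi (fun y => rf y - z * rk y)%C (charac k)
     = (dotp xi (fun y => rf y - z * rk y)%C rk
        + dotp xi (fun y => rf y - z * rk y)%C (trigpoly S ck))%C).
  { unfold dotp. rewrite <- Csum_plus. apply Csum_ext. intros y _. unfold rk at 3.
    rewrite Cminus_conj. ring. }
  rewrite Ek, (dotp_trig xi _ S ck HS), dotp_comb, dotp_self. fold q.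
  unfold z. destruct (Req_EM_T q 0) as [Hq|Hq].
  - rewrite Hq. assert (E0 : dotp xi rf rk = RtoC 0); [|rewrite E0; ring].
    apply Csum_zero. intros y Hy.
    pose proof (Rsum_elem xi (fun y => Cmod (rk y) ^ 2) y (fun _ _ => pow2_ge_0 _) Hy) as Hle.
    fold q in Hle. rewrite Hq in Hle. simpl in Hle. pose proof (Cmod_ge_0 (rk y)).
    assert (Hz : rk y = RtoC 0) by (apply Cmod_eq_0; nra).
    rewrite Hz. apply C_eq; simpl; ring.
  - assert (RtoC q <> 0) by (intros H; apply Hq, RtoC_inj, H). field. auto.
Qed.

(** Guarantees that the [epsilon] in [LS] selects a minimizer. An orthogonal residual is minimal by
    Pythagoras. *)
Lemma exists_least_squares xi S f : NoDup S -> (1 <= length xi)%nat ->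
  exists c, forall c', emp_err xi f (trigpoly S c) <= emp_err xi f (trigpoly S c').
Proof.
  intros Hd Hl. destruct (exists_projection xi S Hd f) as [c Hc]. exists c. intros c'.
  unfold emp_err. apply Rmult_le_compat_r; [left; apply Rinv_0_lt_compat, lt_0_INR; lia|].
  set (r := fun y => (f y - trigpoly S c y)%C) in *.
  set (h := trigpoly S (fun k => c k - c' k)%C).
  assert (Eh : forall y, h y = (trigpoly S c y - trigpoly S c' y)%C).
  { intros y. unfold h, trigpoly. rewrite <- Csum_minus. apply Csum_ext. intros; ring. }
  pose proof (dotp_trig xi r S (fun k => c k - c' k)%C Hc) as H0. fold h in H0.
  apply (f_equal Re) in H0. unfold dotp in H0. rewrite Re_Csum in H0. simpl (Re (RtoC 0)) in H0.
  apply Rle_trans with (Rsum xi (fun y => Cmod (r y) ^ 2 + 2 * Re (r y * Cconj (h y))%C + Cmod (h y) ^ 2)).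
  - rewrite !Rsum_plus, Rsum_scal, H0, Rmult_0_r, Rplus_0_r.
    assert (0 <= Rsum xi (fun y => Cmod (h y) ^ 2)) by (apply Rsum_ge0; intros; apply pow2_ge_0).
    unfold r in *. lra.
  - apply Req_le, Rsum_ext. intros y _.
    replace (f y - trigpoly S c' y)%C with (r y + h y)%C by (rewrite Eh; unfold r; ring).
    rewrite !Cmod_sqr, Re_plus, Im_plus, Re_mult, Re_conj, Im_conj. ring.
Qed.

(* [u] is the planned approximant and [g] the part of [f] it misses, up to a uniformly small remainder. *)
Lemma ls_error d t v xi m f S T (c : list Z -> C) tau : (1 <= v)%nat ->
  sample_points d m xi -> (1 <= length xi)%nat ->
  (forall S c, sparse (box d t) v S ->
    Rsum S (fun k => Cmod (c k) ^ 2) / 6 <= emp xi (trigpoly S c)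
    <= 6 * Rsum S (fun k => Cmod (c k) ^ 2)) ->
  ccont d f -> sparse (box d t) v S -> NoDup T -> incl T (box d t) -> 0 <= tau ->
  (forall x, length x = d -> in_box x ->
     Cmod (f x - (trigpoly S c x + trigpoly T c x)) <= tau) ->
  normq d 2 (fun x => f x - LS xi S f x)%C
  <= 18 * (sqrt (Rsum T (fun k => Cmod (c k) ^ 2))
           + Rsum T (fun k => Cmod (c k)) / sqrt (INR v) + tau).
Proof.
  intros Hv Hxi Hl Hrip Hf HS HdT HiT Ht Hrem.
  assert (HlenS : forall k, In k S -> length k = d).
  { intros k Hk. apply HS, in_box_list in Hk. tauto. }
  assert (HlenT : forall k, In k T -> length k = d).
  { intros k Hk. apply HiT, in_box_list in Hk. tauto. }
  assert (Hsv : 0 < sqrt (INR v)) by (apply sqrt_lt_R0; pose proof (INR_v_pos v Hv); lra).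
  set (l2 := Rsum T (fun k => Cmod (c k) ^ 2)). set (l1 := Rsum T (fun k => Cmod (c k))).
  assert (Hl2 : 0 <= l2) by (apply Rsum_ge0; intros; apply pow2_ge_0).
  assert (Hl1 : 0 <= l1 / sqrt (INR v)).
  { apply Rdiv_le_0_compat; auto. apply Rsum_ge0; intros; apply Cmod_ge_0. }
  set (u := trigpoly S c). set (g := trigpoly T c).
  unfold LS. set (ch := epsilon _ _).
  assert (Hch : forall c', emp_err xi f (trigpoly S ch) <= emp_err xi f (trigpoly S c')).
  { unfold ch. apply epsilon_spec. apply exists_least_squares; auto. apply HS. }
  set (h := trigpoly S ch).
  assert (Hpts : forall y, In y xi -> length y = d /\ in_box y).
  { intros y Hy. destruct Hxi as [_ Hxi]. rewrite List.Forall_forall in Hxi.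
    destruct (Hxi y Hy) as [H1 H2]. split; auto. eapply List.Forall_impl; [|exact H2].
    simpl; intros; lra. }
  set (E := sqrt l2 + l1 / sqrt (INR v) + tau).
  assert (HE : 0 <= E) by (unfold E; pose proof (sqrt_pos l2); lra).
  set (U := sqrt 6). assert (HU2 : U ^ 2 = 6) by (apply pow2_sqrt; lra).
  assert (HU : 1 <= U) by (unfold U; rewrite <- sqrt_1; apply sqrt_le_1_alt; lra).
  assert (Hfu : sqrt (emp xi (fun y => f y - u y)%C) <= U * E).
  { rewrite (emp_ext xi _ (fun y => g y + (f y - (u y + g y)))%C) by (intros; ring).
    eapply Rle_trans; [apply emp_triangle, Hl|].
    apply Rle_trans with (U * (sqrt l2 + l1 / sqrt (INR v)) + tau).
    - apply Rplus_le_compat.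
      + apply (emp_bound (box d t) v xi U Hv Hl); auto; [lra|].
        intros S' c' HS'. rewrite <- (sqrt_pow2 U), HU2 by lra. rewrite <- sqrt_mult_alt by lra.
        apply sqrt_le_1_alt. apply Hrip, HS'.
      + apply emp_le_sup; auto. intros y Hy. destruct (Hpts y Hy). apply Hrem; auto.
    - unfold E. nra. }
  assert (Hfh : sqrt (emp xi (fun y => f y - h y)%C) <= U * E).
  { eapply Rle_trans; [|exact Hfu]. apply sqrt_le_1_alt. apply (Hch c). }
  (* Planned approximant and least squares solution both have frequencies in [S]. The lower half of
     the norm equivalence therefore turns their empirical distance, at most [2 * U * E], into an l2
     distance. *)
  assert (Huh : Rsum S (fun k => Cmod (c k - ch k) ^ 2) <= 6 * (2 * U * E) ^ 2).
  { destruct (Hrip S (fun k => c k - ch k)%C HS) as [Hlow _].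
    assert (Hsq : sqrt (emp xi (trigpoly S (fun k => c k - ch k)%C)) <= 2 * U * E).
    { rewrite (emp_ext xi _ (fun y => (f y - h y) + - (f y - u y))%C).
      - eapply Rle_trans; [apply emp_triangle, Hl|].
        assert (En : emp xi (fun y => - (f y - u y))%C = emp xi (fun y => f y - u y)%C).
        { unfold emp. f_equal. apply Rsum_ext. intros; rewrite Cmod_opp; auto. }
        rewrite En. lra.
      - intros y _. unfold u, h, trigpoly.
        transitivity (Csum S (fun k => c k * charac k y)%C - Csum S (fun k => ch k * charac k y)%C)%C;
          [|ring].
        rewrite <- Csum_minus. apply Csum_ext. intros; ring. }
    pose proof (emp_ge0 xi (trigpoly S (fun k => c k - ch k)%C) Hl) as H0.
    assert (emp xi (trigpoly S (fun k => c k - ch k)%C) <= (2 * U * E) ^ 2); [|lra].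
    rewrite <- (pow2_sqrt (emp xi _)) by exact H0. apply pow_incr. split; [apply sqrt_pos|exact Hsq]. }
  assert (Cu : ccont d u) by (apply ccont_trigpoly, HlenS).
  assert (Ch : ccont d h) by (apply ccont_trigpoly, HlenS).
  assert (Cg : ccont d g) by (apply ccont_trigpoly, HlenT).
  set (w := trigpoly S (fun k => c k - ch k)%C).
  assert (Cw : ccont d w) by (apply ccont_trigpoly, HlenS).
  (* The term with [w] contributes at most [2 * 6 * 4 * 6 = 288] times [E ^ 2], those with [g] and
     [tau] at most 4 times, and [292 <= 18 ^ 2]. *)
  rewrite normq_2. rewrite <- (sqrt_pow2 (18 * E)) by lra. apply sqrt_le_1_alt.
  assert (Hpt : mean d (fun x => Cmod (f x - h x) ^ 2)
     <= mean d (fun x => 2 * Cmod (w x) ^ 2 + (4 * Cmod (g x) ^ 2 + 4 * tau ^ 2))).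
  { apply mean_le.
    - apply cont_Cmod_sqr, ccont_minus; auto.
    - apply cont_plus; [apply cont_scal, cont_Cmod_sqr, Cw|].
      apply cont_plus; [apply cont_scal, cont_Cmod_sqr, Cg|apply cont_const].
    - intros x Hx Hb.
      assert (Ew : w x = (u x - h x)%C).
      { unfold w, u, h, trigpoly. rewrite <- Csum_minus. apply Csum_ext. intros; ring. }
      replace (f x - h x)%C with (w x + (g x + (f x - (u x + g x))))%C by (rewrite Ew; ring).
      pose proof (Cmod_plus_sqr_le (w x) (g x + (f x - (u x + g x)))%C) as H1.
      pose proof (Cmod_plus_sqr_le (g x) (f x - (u x + g x))%C) as H2.
      assert (H3 : Cmod (f x - (u x + g x)) ^ 2 <= tau ^ 2).
      { apply pow_incr. split; [apply Cmod_ge_0|apply Hrem; auto]. }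
      lra. }
  eapply Rle_trans; [exact Hpt|].
  rewrite mean_plus, mean_plus, !mean_scal, mean_const;
    auto using cont_scal, cont_Cmod_sqr, cont_const, cont_plus.
  unfold w, g. rewrite !parseval by (auto; apply HS). fold l2.
  assert (Hl2E : l2 + tau ^ 2 <= E ^ 2).
  { unfold E. rewrite <- (pow2_sqrt l2) at 1 by auto. pose proof (sqrt_pos l2). nra. }
  replace ((2 * U * E) ^ 2) with (4 * U ^ 2 * E ^ 2) in Huh by ring. rewrite HU2 in Huh.
  pose proof (pow2_ge_0 E). replace ((18 * E) ^ 2) with (324 * E ^ 2) by ring. lra.
Qed.

(** * Rates *)

(** The bases are comparable in both directions, so one statement serves exponents of either
    sign. *)
Lemma Rpower_ratio K x y g : 1 <= K -> 0 < x -> 0 < y -> x <= K * y -> y <= K * x ->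
  Rpower x g <= Rpower K (Rabs g) * Rpower y g.
Proof.
  intros HK Hx Hy H1 H2. unfold Rpower. rewrite <- exp_plus. apply exp_monotone.
  apply ln_le in H1; auto. apply ln_le in H2; auto. rewrite ln_mult in H1, H2 by lra.
  assert (0 <= ln K) by (rewrite <- ln_1; apply ln_le; lra).
  unfold Rabs. destruct (Rcase_abs g); nra.
Qed.

Lemma poly_le_exp x y : 0 < x -> exists D, 0 < D /\
  forall t, 1 <= t -> Rpower t y <= D * Rpower 2 (x * t).
Proof.
  intros Hx. assert (Hl : 0 < ln 2) by (pose proof ln_lt_2; lra).
  pose proof (Rabs_pos y) as Hy.
  set (de := x * ln 2 / (Rabs y + 1)).
  assert (Hde : 0 < de) by (apply Rdiv_lt_0_compat; [nra|lra]).
  exists (exp (Rabs y * - ln de)). split; [apply exp_pos|]. intros t Ht.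
  apply Rle_trans with (Rpower t (Rabs y)); [apply Rle_Rpower; [lra|apply Rle_abs]|].
  unfold Rpower. rewrite <- exp_plus. apply exp_monotone.
  assert (H1 : ln (de * t) <= de * t).
  { pose proof (exp_ineq1_le (ln (de * t))) as H. rewrite exp_ln in H by nra. lra. }
  rewrite ln_mult in H1 by lra.
  assert (H2 : Rabs y * de <= x * ln 2).
  { unfold de. apply Rmult_le_reg_r with (Rabs y + 1); [lra|]. field_simplify; [|lra]. nra. }
  assert (H3 : Rabs y * ln t <= Rabs y * (de * t - ln de)) by (apply Rmult_le_compat_l; lra).
  nra.
Qed.

Lemma geometric_sum_le r m : 0 < r < 1 -> Rsum (seq 0 m) (fun i => r ^ i) <= / (1 - r).
Proof.
  intros Hr. assert (E : (1 - r) * Rsum (seq 0 m) (fun i => r ^ i) = 1 - r ^ m).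
  { induction m as [|m IH]; [simpl; ring|].
    rewrite seq_S, Rsum_app, Rmult_plus_distr_l, IH. simpl. ring. }
  apply Rmult_le_reg_l with (1 - r); [lra|]. rewrite E, Rinv_r by lra.
  assert (0 < r ^ m) by (apply pow_lt; lra). lra.
Qed.

Lemma Rpower_2_mult_INR x i : Rpower 2 (x * INR i) = Rpower 2 x ^ i.
Proof. rewrite <- Rpower_pow by apply Rpower_pos. rewrite Rpower_mult. reflexivity. Qed.

(** As [s + i + 1 <= (i + 1) * (s + 1)], the power at [s] splits off, and the remaining power of
    [i + 1] is absorbed by half of the exponential decay in [i]. *)
Lemma tail_sum x g : 0 < x -> exists K, 0 < K /\ forall s m,
  Rsum (seq s m) (fun j => Rpower 2 (- x * INR j) * Rpower (INR j + 1) g)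
  <= K * (Rpower 2 (- x * INR s) * Rpower (INR s + 1) g).
Proof.
  intros Hx. destruct (poly_le_exp (x / 2) (Rabs g) ltac:(lra)) as (D & HD & Hpk).
  set (r := Rpower 2 (- (x / 2))).
  assert (Hr : 0 < r < 1).
  { split; [apply Rpower_pos|]. unfold r. rewrite <- (Rpower_O 2) by lra. apply Rpower_lt; lra. }
  exists (D * Rpower 2 (x / 2) * / (1 - r)).
  assert (Hpos : 0 < D * Rpower 2 (x / 2)) by (apply Rmult_lt_0_compat; [auto|apply Rpower_pos]).
  split. { apply Rmult_lt_0_compat; auto. apply Rinv_0_lt_compat; lra. }
  intros s m. set (G := Rpower 2 (- x * INR s) * Rpower (INR s + 1) g).
  assert (HG : 0 < G) by (apply Rmult_lt_0_compat; apply Rpower_pos).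
  apply Rle_trans with (Rsum (seq 0 m) (fun i => (D * Rpower 2 (x / 2) * G) * r ^ i)).
  - assert (E : seq s m = map (fun i => (s + i)%nat) (seq 0 m)).
    { clear. revert s. induction m as [|m IH]; intros s; [reflexivity|].
      rewrite !seq_S, map_app, <- IH. reflexivity. }
    rewrite E, Rsum_map. apply Rsum_le. intros i _. rewrite plus_INR.
    pose proof (pos_INR s) as Hs. pose proof (pos_INR i) as Hi.
    assert (H1 : Rpower (INR s + INR i + 1) g <= Rpower (INR i + 1) (Rabs g) * Rpower (INR s + 1) g).
    { apply Rpower_ratio; nra. }
    pose proof (Hpk (INR i + 1) ltac:(lra)) as H2.
    replace (- x * (INR s + INR i)) with (- x * INR s + - x * INR i) by ring.
    rewrite Rpower_plus.
    unfold r. rewrite <- Rpower_2_mult_INR.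
    assert (E2 : Rpower 2 (- x * INR i) * Rpower 2 (x / 2 * (INR i + 1))
               = Rpower 2 (x / 2) * Rpower 2 (- (x / 2) * INR i)).
    { rewrite <- !Rpower_plus. f_equal. field. }
    apply Rle_trans with (Rpower 2 (- x * INR s) * Rpower 2 (- x * INR i)
       * (D * Rpower 2 (x / 2 * (INR i + 1)) * Rpower (INR s + 1) g)).
    + apply Rmult_le_compat_l.
      * left. apply Rmult_lt_0_compat; apply Rpower_pos.
      * eapply Rle_trans; [exact H1|]. apply Rmult_le_compat_r; [left; apply Rpower_pos|exact H2].
    + right. unfold G.
      transitivity (D * Rpower 2 (- x * INR s) * Rpower (INR s + 1) g
                    * (Rpower 2 (- x * INR i) * Rpower 2 (x / 2 * (INR i + 1)))); [ring|].
      rewrite E2. ring.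
  - rewrite Rsum_scal. pose proof (geometric_sum_le r m Hr) as H.
    apply Rle_trans with (D * Rpower 2 (x / 2) * G * / (1 - r)); [|right; ring].
    apply Rmult_le_compat_l; [|exact H]. left. apply Rmult_lt_0_compat; auto.
Qed.

(** The level [n] is [w] minus roughly [e * log2 w]. The layers below it then number at most
    [2 ^ w / 4], yet [2 ^ n] is smaller than [2 ^ w] by no more than a factor of order [w ^ e]. For
    small [w] the truncated subtraction gives [n = 0], and there are no low layers. *)
Lemma choose_level e : exists K c, 0 < K /\ 0 < c /\ forall w, (1 <= w)%nat -> exists n,
  (n <= w)%nat /\ (n = 0%nat \/ 3 ^ S e * INR n ^ e * 2 ^ n * 4 <= 2 ^ w) /\
  2 ^ w <= K * INR w ^ e * 2 ^ n /\ c * INR w <= INR n + 1.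
Proof.
  assert (Hl2 : 0 < ln 2) by (pose proof ln_lt_2; lra).
  set (b := (e + 2 * S e + 2)%nat).
  destruct (poly_le_exp (1 / 2) (INR e) ltac:(lra)) as (D & HD & Hpk).
  set (D2 := Rmax 1 (ln (2 ^ b * D) / ln 2)).
  assert (HD2 : 1 <= D2) by apply Rmax_l.
  exists (2 ^ b), (1 / (4 * D2)).
  assert (H2b : 0 < 2 ^ b) by (apply pow_lt; lra).
  split; [auto|]. split; [apply Rdiv_lt_0_compat; lra|].
  intros w Hw. set (lw := Nat.log2 w).
  destruct (Nat.log2_spec w ltac:(lia)) as [Hlo Hhi]. fold lw in Hlo, Hhi.
  (* The summands pay for [n ^ e] through [n <= w < 2 ^ (lw + 1)], for [3 ^ S e <= 2 ^ (2 * S e)],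
     and for the factor 4. *)
  set (sh := (e * (lw + 1) + 2 * S e + 2)%nat). set (n := (w - sh)%nat).
  assert (HwR : 1 <= INR w) by (apply (le_INR 1), Hw).
  assert (Hpow : 2 ^ w <= 2 ^ b * INR w ^ e * 2 ^ n).
  { apply Rle_trans with (2 ^ (sh + n)); [apply Rle_pow; [lra|unfold n; lia]|].
    rewrite pow_add. apply Rmult_le_compat_r; [apply pow_le; lra|].
    replace sh with (b + lw * e)%nat by (unfold sh, b; lia).
    rewrite pow_add, pow_mult. apply Rmult_le_compat_l; [lra|]. apply pow_incr.
    split; [apply pow_le; lra|]. apply le_INR in Hlo. rewrite pow_INR in Hlo.
    replace (INR 2) with 2 in Hlo by (simpl; ring). exact Hlo. }
  exists n. split; [unfold n; lia|]. split; [|split; [exact Hpow|]].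
  - destruct (Nat.eq_dec n 0) as [|Hn]; [left; auto|right].
    assert (Hnw : (n <= 2 ^ (lw + 1))%nat).
    { rewrite Nat.add_1_r. unfold n. lia. }
    apply le_INR in Hnw. rewrite pow_INR in Hnw. replace (INR 2) with 2 in Hnw by (simpl; ring).
    apply Rle_trans with (2 ^ (2 * S e) * (2 ^ (lw + 1)) ^ e * 2 ^ n * 2 ^ 2).
    + replace (2 ^ 2) with 4 by ring. apply Rmult_le_compat_r; [lra|].
      apply Rmult_le_compat_r; [apply pow_le; lra|].
      apply Rmult_le_compat; [apply pow_le; lra|apply pow_le, pos_INR| |].
      * rewrite pow_mult. apply pow_incr. lra.
      * apply pow_incr. split; [apply pos_INR|exact Hnw].
    + rewrite <- pow_mult, <- !pow_add. apply Rle_pow; [lra|]. unfold n, sh in *. nia.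
  (* Half of the exponential absorbs [w ^ e]; logarithms then give [w / 2 <= D2 + n], hence a linear
     lower bound for [n + 1]. *)
  - assert (Hx : Rpower 2 (INR w) <= 2 ^ b * D * Rpower 2 (1 / 2 * INR w) * Rpower 2 (INR n)).
    { rewrite !Rpower_pow by lra. eapply Rle_trans; [exact Hpow|].
      apply Rmult_le_compat_r; [apply pow_le; lra|]. rewrite Rmult_assoc.
      apply Rmult_le_compat_l; [lra|]. rewrite <- Rpower_pow by lra. apply Hpk, HwR. }
    assert (HbD : 0 < 2 ^ b * D) by nra.
    assert (Hln : INR w / 2 <= D2 + INR n).
    { apply ln_le in Hx; [|apply Rpower_pos].
      rewrite !ln_mult in Hx by (try apply Rmult_lt_0_compat; try apply Rpower_pos; lra).
      unfold Rpower in Hx. rewrite !ln_exp in Hx. rewrite <- ln_mult in Hx by lra.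
      assert (HL : ln (2 ^ b * D) <= D2 * ln 2).
      { apply Rle_trans with (ln (2 ^ b * D) / ln 2 * ln 2); [right; field; lra|].
        apply Rmult_le_compat_r; [lra|apply Rmax_r]. }
      apply Rmult_le_reg_r with (ln 2); [lra|]. lra. }
    pose proof (pos_INR n).
    apply Rmult_le_reg_l with (4 * D2); [lra|].
    replace (4 * D2 * (1 / (4 * D2) * INR w)) with (INR w) by (field; lra). nra.
Qed.

Lemma inW_ccont d p a b f : inW d p a b f -> ccont d f.
Proof.
  intros [[H _] _]. split; apply cont_eps; intros x Hx eps He;
    destruct (H x Hx eps He) as (del & Hd & HP); exists del; split; auto;
    intros y Hy Hxy; eapply Rle_lt_trans; [|apply (HP y Hy Hxy)| |apply (HP y Hy Hxy)].
  - rewrite <- Re_minus. apply Re_le_Cmod.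
  - rewrite <- Im_minus. apply Im_le_Cmod.
Qed.

(** The weight [max j 1] of the class is replaced, up to the constant [Kg], by [j + 1], the form in
    which the tail sums are stated. *)
Lemma inW_coeffs e p a b : 1 < p <= 2 -> exists K, 0 < K /\ forall f, inW (S e) p a b f ->
  let g := INR e * b in
  (forall j, Rsum (layer (S e) j) (fun k => Cmod (fhat (S e) f k))
     <= K * (Rpower 2 (- (a - 1 / p) * INR j) * Rpower (INR j + 1) (INR (S e) * (1 - 1 / p) + g))) /\
  (forall j k, In k (layer (S e) j) -> Cmod (fhat (S e) f k)
     <= K * (Rpower 2 (- a * INR j) * Rpower (INR j + 1) g)).
Proof.
  intros Hp. set (g := INR e * b).
  destruct (layer_holder (S e) p Hp) as (K0 & HK0 & H).
  set (Kg := Rpower 2 (Rabs g)). assert (HKg : 0 < Kg) by apply Rpower_pos.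
  exists (K0 * Kg + Kg). split; [nra|]. intros f [_ Hf]. cbv zeta. fold g.
  assert (HB : forall j, 0 < Rpower 2 (- a * INR j) * Rpower (INR (Nat.max j 1)) ((INR (S e) - 1) * b)).
  { intros j. apply Rmult_lt_0_compat; apply Rpower_pos. }
  assert (HBj : forall j, Rpower 2 (- a * INR j) * Rpower (INR (Nat.max j 1)) ((INR (S e) - 1) * b)
     <= Kg * (Rpower 2 (- a * INR j) * Rpower (INR j + 1) g)).
  { intros j. replace ((INR (S e) - 1) * b) with g by (rewrite S_INR; unfold g; ring).
    assert (Hm : Rpower (INR (Nat.max j 1)) g <= Kg * Rpower (INR j + 1) g).
    { pose proof (pos_INR j).
      destruct (Nat.le_gt_cases j 1) as [Hj|Hj].
      - rewrite Nat.max_r by exact Hj. apply (le_INR j 1) in Hj. simpl (INR 1) in *.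
        apply Rpower_ratio; lra.
      - rewrite Nat.max_l by lia. apply (lt_INR 1 j) in Hj. simpl (INR 1) in *.
        apply Rpower_ratio; lra. }
    pose proof (Rpower_pos 2 (- a * INR j)). nra. }
  assert (Hn : forall j, normq (S e) p (trigpoly (layer (S e) j) (fhat (S e) f))
      <= Rpower 2 (- a * INR j) * Rpower (INR (Nat.max j 1)) ((INR (S e) - 1) * b)).
  { intros j. replace (trigpoly (layer (S e) j) (fhat (S e) f)) with (fblock (S e) f j); [apply Hf|].
    apply functional_extensionality. intros x. apply fblock_trigpoly. }
  split.
  - intros j. eapply Rle_trans; [apply (H j _ _ (HB j) (Hn j))|].
    set (Q := Rpower 2 (- a * INR j) * Rpower (INR j + 1) g) in *.
    assert (HQ : 0 < Q) by (apply Rmult_lt_0_compat; apply Rpower_pos).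
    set (X := Rpower (2 ^ j) (1 / p) * Rpower (INR (j + 1)) (INR (S e) * (1 - 1 / p))).
    assert (HX : 0 < X) by (apply Rmult_lt_0_compat; apply Rpower_pos).
    assert (E : X * Q = Rpower 2 (- (a - 1 / p) * INR j)
                        * Rpower (INR j + 1) (INR (S e) * (1 - 1 / p) + g)).
    { unfold X, Q. rewrite <- (Rpower_pow j) by lra. rewrite Rpower_mult, plus_INR. simpl (INR 1).
      replace (- (a - 1 / p) * INR j) with (INR j * (1 / p) + - a * INR j) by ring.
      rewrite !Rpower_plus. ring. }
    rewrite <- E.
    apply Rle_trans with (K0 * X * (Kg * Q)).
    + rewrite (Rmult_assoc K0). apply Rmult_le_compat_l; [nra|apply HBj].
    + assert (0 < X * Q) by nra. nra.
  - intros j k Hk. eapply Rle_trans; [apply (proj2 (H j _ _ (HB j) (Hn j))), Hk|].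
    eapply Rle_trans; [apply HBj|]. apply Rmult_le_compat_r; [|nra].
    left. apply Rmult_lt_0_compat; apply Rpower_pos.
Qed.

(** * Choice of the frequencies *)

Lemma extend_NoDup (S0 l : list (list Z)) v : NoDup S0 -> NoDup l -> incl S0 l ->
  (length S0 <= v <= length l)%nat ->
  exists S, NoDup S /\ length S = v /\ incl S0 S /\ incl S l.
Proof.
  intros H0 Hl Hi Hv.
  set (R0 := filter (fun k => if in_dec zl_eq_dec k S0 then false else true) l).
  assert (HR : forall k, In k R0 <-> In k l /\ ~ In k S0).
  { intros k. unfold R0. rewrite filter_In. destruct in_dec; intuition congruence. }
  assert (Hlen : (length l <= length S0 + length R0)%nat).
  { rewrite <- length_app. apply NoDup_incl_length; auto. intros k Hk. apply in_or_app.
    destruct (in_dec zl_eq_dec k S0); [left; auto|right; apply HR; auto]. }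
  assert (HdR : NoDup R0) by (apply NoDup_filter, Hl).
  assert (Hfi : incl (firstn (v - length S0) R0) R0).
  { intros k Hk. rewrite <- (firstn_skipn (v - length S0) R0). apply in_or_app; auto. }
  exists (S0 ++ firstn (v - length S0) R0). split; [|split; [|split]].
  - apply NoDup_app; auto.
    + rewrite <- (firstn_skipn (v - length S0) R0) in HdR. eapply NoDup_app_remove_r; eauto.
    + intros k Hk Hk'. apply Hfi, HR in Hk'. tauto.
  - rewrite length_app, length_firstn. lia.
  - apply incl_appl, incl_refl.
  - apply incl_app; auto. intros k Hk. apply Hfi, HR in Hk. tauto.
Qed.

(** Multiplied over the coordinates, this places the hyperbolic cross of parameter [2 ^ J] between
    the levels up to [J] and those up to [J + d]. *)
Lemma bits_Rmax z : Rmax (IZR (Z.abs z)) 1 <= 2 ^ bits z <= 2 * Rmax (IZR (Z.abs z)) 1.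
Proof.
  unfold bits. destruct (Z.eq_dec z 0) as [->|Hz].
  - simpl. rewrite Rmax_right; lra.
  - destruct (Z.log2_spec (Z.abs z)) as [H1 H2]; [lia|].
    set (n := Z.to_nat (Z.log2 (Z.abs z))).
    pose proof (Z.log2_nonneg (Z.abs z)) as H0.
    replace (Z.succ (Z.log2 (Z.abs z))) with (Z.of_nat (S n)) in H2 by lia.
    replace (Z.log2 (Z.abs z)) with (Z.of_nat n) in H1 by lia.
    apply IZR_le in H1. apply IZR_lt in H2. rewrite <- pow_IZR in H1, H2.
    assert (1 <= IZR (Z.abs z)) by (apply IZR_le; lia).
    rewrite Rmax_left by lra. simpl pow in *. lra.
Qed.

Definition zprod (k : list Z) : R := fold_right (fun kj acc => Rmax (IZR (Z.abs kj)) 1 * acc) 1 k.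

Lemma zprod_ge_1 k : 1 <= zprod k.
Proof.
  induction k as [|a k IH]; simpl; [lra|]. fold (zprod k).
  pose proof (Rmax_r (IZR (Z.abs a)) 1). nra.
Qed.

Lemma zprod_le_lev k : zprod k <= 2 ^ lev k.
Proof.
  induction k as [|a k IH]; simpl; [lra|]. fold (zprod k) (lev k). rewrite pow_add.
  pose proof (zprod_ge_1 k). pose proof (Rmax_r (IZR (Z.abs a)) 1). pose proof (bits_Rmax a).
  apply Rmult_le_compat; lra.
Qed.

Lemma lev_le_zprod k : 2 ^ lev k <= 2 ^ length k * zprod k.
Proof.
  induction k as [|a k IH]; simpl; [lra|]. fold (zprod k) (lev k). rewrite pow_add.
  pose proof (bits_Rmax a). replace (2 * 2 ^ length k * (Rmax (IZR (Z.abs a)) 1 * zprod k))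
    with ((2 * Rmax (IZR (Z.abs a)) 1) * (2 ^ length k * zprod k)) by ring.
  apply Rmult_le_compat; try (apply pow_le; lra); lra.
Qed.

Lemma gammaM_lev d J k : gammaM d (2 ^ J) k -> length k = d /\ (lev k <= J + d)%nat.
Proof.
  intros [Hl H]. fold (zprod k) in H. split; auto.
  pose proof (lev_le_zprod k) as H1. rewrite Hl in H1.
  destruct (le_lt_dec (lev k) (J + d)) as [|Hlt]; auto. exfalso.
  assert (H2 : 2 ^ d * zprod k <= 2 ^ (J + d)).
  { rewrite pow_add, Rmult_comm. apply Rmult_le_compat_r; [apply pow_le; lra|exact H]. }
  assert (2 ^ (J + d) < 2 ^ lev k) by (apply Rlt_pow; [lra|exact Hlt]). lra.
Qed.

Lemma lev_gammaM d J k : length k = d -> (lev k <= J)%nat -> gammaM d (2 ^ J) k.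
Proof.
  intros Hl H. split; auto. fold (zprod k). eapply Rle_trans; [apply zprod_le_lev|].
  apply Rle_pow; [lra|auto].
Qed.

Definition gamma_list (d J : nat) : list (list Z) :=
  filter (fun k => if Rle_dec (zprod k) (2 ^ J) then true else false) (layers d 0 (J + d + 1)).

Lemma in_gamma_list d J k : In k (gamma_list d J) <-> gammaM d (2 ^ J) k.
Proof.
  unfold gamma_list. rewrite filter_In, in_layers. split.
  - intros [[H1 H2] H3]. split; auto. destruct Rle_dec; [auto|discriminate].
  - intros H. destruct (gammaM_lev d J k H) as [H1 H2]. destruct H as [_ H]. fold (zprod k) in H.
    split; [split; auto; lia|]. destruct Rle_dec; [auto|tauto].
Qed.

Lemma NoDup_gamma_list d J : NoDup (gamma_list d J).
Proof. apply NoDup_filter, NoDup_layers. Qed.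

Lemma length_gamma_list_le d J : (length (gamma_list d J) <= 2 ^ ((J + 2) * d))%nat.
Proof.
  eapply Nat.le_trans; [|replace (J + 2)%nat with (J + 1 + 1)%nat by lia; apply length_box].
  apply NoDup_incl_length; [apply NoDup_gamma_list|]. intros k Hk.
  apply in_gamma_list in Hk. destruct Hk as [Hl H]. fold (zprod k) in H.
  apply in_box_list. split; auto. intros z Hz.
  destruct (le_lt_dec (bits z) (J + 1)) as [|Hlt]; auto. exfalso.
  assert (Hz2 : Rmax (IZR (Z.abs z)) 1 <= zprod k).
  { clear H Hl. induction k as [|a k IH]; [destruct Hz|]. simpl. fold (zprod k).
    pose proof (zprod_ge_1 k). pose proof (Rmax_r (IZR (Z.abs a)) 1).
    destruct Hz as [->|Hz]; [nra|]. specialize (IH Hz). nra. }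
  pose proof (bits_Rmax z) as [_ H2].
  assert (H3 : 2 ^ S (J + 1) <= 2 ^ bits z) by (apply Rle_pow; [lra|lia]).
  rewrite Nat.add_1_r in H3. simpl in H3. assert (0 < 2 ^ J) by (apply pow_lt; lra). lra.
Qed.

(** The first coordinate axis alone supplies [v] frequencies. *)
Lemma length_gamma_list_ge e J v : (v <= 2 ^ J)%nat -> (v <= length (gamma_list (S e) J))%nat.
Proof.
  intros Hv.
  set (l := map (fun i => Z.of_nat i :: repeat 0%Z e) (seq 0 v)).
  assert (Hl : length l = v) by (unfold l; rewrite length_map, length_seq; auto).
  rewrite <- Hl at 1. apply NoDup_incl_length.
  - apply FinFun.Injective_map_NoDup; [|apply seq_NoDup]. intros i j E. injection E. lia.
  - intros k Hk. apply in_map_iff in Hk. destruct Hk as (i & <- & Hi). apply in_seq in Hi.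
    apply in_gamma_list. split; [simpl; rewrite repeat_length; auto|]. simpl.
    assert (E : fold_right (fun kj acc => Rmax (IZR (Z.abs kj)) 1 * acc) 1 (repeat 0%Z e) = 1).
    { clear. induction e as [|e IH]; simpl; [auto|]. rewrite IH, Rmax_right; lra. }
    rewrite E, Rmult_1_r. assert (HiJ : (i <= 2 ^ J)%nat) by lia.
    apply le_INR in HiJ. rewrite pow_INR in HiJ. replace (INR 2) with 2 in HiJ by (simpl; ring).
    rewrite Z.abs_eq, <- INR_IZR_INZ by lia. apply Rmax_lub; [exact HiJ|].
    apply pow_R1_Rle. lra.
Qed.

Lemma Rsum_layers d s m F : Rsum (layers d s m) F = Rsum (seq s m) (fun j => Rsum (layer d j) F).
Proof. apply Rsum_flat_map. Qed.

Lemma length_layers_low e n : INR (length (layers (S e) 0 n)) <= 3 ^ S e * INR n ^ e * 2 ^ n.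
Proof.
  rewrite <- (Rmult_1_r (INR (length _))), <- Rsum_const, Rsum_layers.
  set (X := 3 ^ S e * INR n ^ e).
  assert (HX : 0 <= X) by (apply Rmult_le_pos; apply pow_le; [lra|apply pos_INR]).
  apply Rle_trans with (Rsum (seq 0 n) (fun j => X * 2 ^ j)).
  - apply Rsum_le. intros j Hj. apply in_seq in Hj. rewrite Rsum_const, Rmult_1_r.
    eapply Rle_trans; [apply length_layer|]. apply Rmult_le_compat_r; [apply pow_le; lra|].
    apply Rmult_le_compat_l; [apply pow_le; lra|]. apply pow_incr.
    split; [apply pos_INR|apply le_INR; lia].
  - rewrite Rsum_scal. apply Rmult_le_compat_l; auto. clear.
    induction n as [|n IH]; [simpl; lra|]. rewrite seq_S, Rsum_app, Rsum_cons. simpl in *. lra.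
Qed.

(* All low layers, then the [v / 2] largest coefficients of the middle ones, padded up to exactly
   [v] frequencies. *)
Lemma select_frequencies e v n J J' (c : list Z -> C) : (1 <= v)%nat -> (v <= 2 ^ J)%nat ->
  (n <= J)%nat -> (J + S e <= J')%nat -> (2 * length (layers (S e) 0 n) <= v)%nat ->
  let N1 := Rsum (layers (S e) n (S J' - n)) (fun k => Cmod (c k)) in
  exists F T, v_subset (S e) v (2 ^ J) F /\ sparse (box (S e) J') v F /\
    NoDup T /\ incl T (box (S e) J') /\
    Permutation (layers (S e) 0 (S J')) (F ++ T) /\
    Rsum T (fun k => Cmod (c k)) <= N1 /\
    Rsum T (fun k => Cmod (c k) ^ 2) <= 2 / INR v * N1 ^ 2
      + Rsum (layers (S e) (S J) (J' - J)) (fun k => Cmod (c k) ^ 2).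
Proof.
  intros Hv HvJ HnJ HJJ Hlow N1. set (d := S e) in *.
  set (low := layers d 0 n) in *. set (mid := layers d n (S J - n)).
  (* At least [v / 2], since the low layers occupy at most half of the budget. *)
  set (vt := (v - length low)%nat).
  destruct (exists_top (fun k => Cmod (c k)) (Nat.min vt (length mid)) mid) as (T1 & T2 & HP & Hl1 & Htop);
    [lia|].
  assert (Hmid : forall k, In k mid <-> In k T1 \/ In k T2).
  { intros k. rewrite <- in_app_iff. split; apply Permutation_in; [exact HP|symmetry; exact HP]. }
  assert (HdM : NoDup (T1 ++ T2)) by (eapply Permutation_NoDup; [exact HP|apply NoDup_layers]).
  assert (Hin1 : forall k, In k T1 -> length k = d /\ (n <= lev k < S J)%nat).
  { intros k Hk. assert (Hk' : In k mid) by (apply Hmid; auto).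
    apply in_layers in Hk'. lia. }
  destruct (extend_NoDup (low ++ T1) (gamma_list d J) v) as (F & HdS & HlS & HiS & HSg).
  { apply NoDup_app; [apply NoDup_layers|eapply NoDup_app_remove_r; eauto|].
    intros k Hk Hk'. apply in_layers in Hk. apply Hin1 in Hk'. lia. }
  { apply NoDup_gamma_list. }
  { apply incl_app; intros k Hk; apply in_gamma_list, lev_gammaM.
    - apply in_layers in Hk; tauto.
    - apply in_layers in Hk; lia.
    - apply Hin1 in Hk; tauto.
    - apply Hin1 in Hk; lia. }
  { split; [rewrite length_app; lia|apply length_gamma_list_ge, HvJ]. }
  set (all := layers d 0 (S J')).
  set (T := filter (fun k => if in_dec zl_eq_dec k F then false else true) all).
  assert (HT : forall k, In k T <-> In k all /\ ~ In k F).
  { intros k. unfold T. rewrite filter_In. destruct in_dec; intuition congruence. }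
  assert (HSall : forall k, In k F -> In k all).
  { intros k Hk. apply HSg, in_gamma_list, gammaM_lev in Hk. apply in_layers. lia. }
  assert (Hbox : forall k, In k all -> In k (box d J')).
  { intros k Hk. apply in_layers in Hk. apply in_box_list. split; [tauto|].
    intros z Hz. apply lev_ge_bits in Hz. lia. }
  assert (HdT : NoDup T) by (apply NoDup_filter, NoDup_layers).
  assert (HTn : incl T (layers d n (S J' - n))).
  { intros k Hk. apply HT in Hk. destruct Hk as [Hk HkS]. apply in_layers in Hk. apply in_layers.
    split; [tauto|]. destruct (le_lt_dec n (lev k)) as [|Hlt]; [lia|]. exfalso. apply HkS, HiS.
    apply in_or_app. left. apply in_layers. lia. }
  assert (Hc0 : forall k, 0 <= Cmod (c k)) by (intros; apply Cmod_ge_0).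
  exists F, T. split; [|split; [|split; [|split; [|split; [|split]]]]].
  - split; [auto|]. split; [auto|]. apply List.Forall_forall. intros k Hk. apply in_gamma_list; auto.
  - split; [auto|]. split; [intros k Hk; auto|lia].
  - exact HdT.
  - intros k Hk. apply HT in Hk. apply Hbox. tauto.
  - apply NoDup_Permutation; [apply NoDup_layers| |].
    + apply NoDup_app; auto. intros k Hk Hk'. apply HT in Hk'. tauto.
    + intros k. rewrite in_app_iff, HT. fold all.
      destruct (in_dec zl_eq_dec k F); intuition auto.
  - apply Rsum_incl; auto.
  - assert (HN1 : 0 <= N1) by (apply Rsum_ge0; auto).
    assert (HvR : 1 <= INR v) by (apply (le_INR 1), Hv).
    (* A discarded coefficient is at most the average of the [vt >= v / 2] selected ones. Were fewer
       than [vt] selected, the middle layers would be exhausted and [T2] empty. *)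
    assert (HT2 : forall k, In k T2 -> Cmod (c k) <= 2 / INR v * N1).
    { intros k Hk. apply Rle_trans with (2 / INR v * Rsum T1 (fun k => Cmod (c k))).
      - assert (Hne : (length T1 = vt)%nat).
        { assert (length mid = length T1 + length T2)%nat
            by (rewrite <- length_app; apply Permutation_length, HP).
          assert (1 <= length T2)%nat by (destruct T2; [destruct Hk|simpl; lia]). lia. }
        assert (Hs : INR (length T1) * Cmod (c k) <= Rsum T1 (fun k => Cmod (c k))).
        { rewrite <- Rsum_const. apply Rsum_le. intros a Ha. auto. }
        assert (Hvt : INR v <= 2 * INR (length T1)).
        { rewrite Hne. replace 2 with (INR 2) by (simpl; ring). rewrite <- mult_INR.
          apply le_INR. unfold vt. lia. }
        apply Rmult_le_reg_l with (INR v); [lra|].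
        replace (INR v * (2 / INR v * Rsum T1 (fun k0 => Cmod (c k0))))
          with (2 * Rsum T1 (fun k0 => Cmod (c k0))) by (field; lra).
        specialize (Hc0 k). nra.
      - apply Rmult_le_compat_l; [apply Rdiv_le_0_compat; lra|].
        apply Rsum_incl; [eapply NoDup_app_remove_r; eauto| |auto].
        intros a Ha. apply Hin1 in Ha. apply in_layers. lia. }
    apply Rle_trans with (Rsum (T2 ++ layers d (S J) (J' - J)) (fun k => Cmod (c k) ^ 2)).
    + apply Rsum_incl; auto; [|intros; apply pow2_ge_0]. intros k Hk. apply in_or_app.
      pose proof (HTn k Hk) as Hn. apply in_layers in Hn. apply HT in Hk. destruct Hk as [Hk HkS].
      apply in_layers in Hk. destruct (le_lt_dec (S J) (lev k)).
      * right. apply in_layers. lia.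
      * left. assert (Hm : In k mid) by (apply in_layers; lia). apply Hmid in Hm.
        destruct Hm as [Hm|]; auto. exfalso. apply HkS, HiS, in_or_app. auto.
    + rewrite Rsum_app. apply Rplus_le_compat_r.
      apply Rle_trans with (Rsum T2 (fun k => (2 / INR v * N1) * Cmod (c k))).
      * apply Rsum_le. intros k Hk. simpl. rewrite Rmult_1_r. apply Rmult_le_compat_r; auto.
      * rewrite Rsum_scal. replace (2 / INR v * N1 ^ 2) with (2 / INR v * N1 * N1) by ring.
        apply Rmult_le_compat_l.
        -- apply Rmult_le_pos; auto. apply Rdiv_le_0_compat; lra.
        -- apply Rsum_incl; [eapply NoDup_app_remove_l; eauto| |auto].
           intros a Ha. assert (Hm : In a mid) by (apply Hmid; auto).
           apply in_layers in Hm. apply in_layers. lia.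
Qed.

(** * Conclusion *)

(** The rate of the theorem with [2 ^ w] in place of [v] and [w] in place of its logarithm. *)
Definition target (y g w : R) : R := Rpower 2 (- y * w) * Rpower w g.

Lemma target_pos y g w : 0 < target y g w.
Proof. apply Rmult_lt_0_compat; apply Rpower_pos. Qed.

Lemma target_absorb x y g g' : 0 < x -> exists K, 0 < K /\ forall w, 1 <= w ->
  target (y + x) g w <= K * target y g' w.
Proof.
  intros Hx. destruct (poly_le_exp x (g - g') Hx) as (D & HD & H). exists D. split; auto.
  intros w Hw. specialize (H w Hw). unfold target.
  replace (- (y + x) * w) with (- y * w + - (x * w)) by ring.
  replace g with (g' + (g - g')) at 1 by ring. rewrite !Rpower_plus, Rpower_Ropp.
  pose proof (Rpower_pos 2 (x * w)) as Hp.
  apply Rle_trans with (Rpower 2 (- y * w) * / Rpower 2 (x * w) * (Rpower w g' * (D * Rpower 2 (x * w)))).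
  - apply Rmult_le_compat_l.
    + left. apply Rmult_lt_0_compat; [apply Rpower_pos|apply Rinv_0_lt_compat, Hp].
    + apply Rmult_le_compat_l; [left; apply Rpower_pos|exact H].
  - right. field. lra.
Qed.

Lemma tail_vanish x g K eps n : 0 < x -> 0 < K -> 0 < eps -> exists J, (n <= J)%nat /\
  K * (Rpower 2 (- x * INR (S J)) * Rpower (INR (S J) + 1) g) < eps.
Proof.
  intros Hx HK He. destruct (poly_le_exp (x / 2) g ltac:(lra)) as (D & HD & Hp).
  set (r := Rpower 2 (- (x / 2))).
  assert (Hr : 0 < r < 1).
  { split; [apply Rpower_pos|]. unfold r. rewrite <- (Rpower_O 2) by lra. apply Rpower_lt; lra. }
  set (B := K * D * Rpower 2 (x / 2)).
  assert (HB : 0 < B) by (unfold B; pose proof (Rpower_pos 2 (x / 2)); apply Rmult_lt_0_compat; nra).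
  destruct (pow_lt_1_zero r) with (y := eps / B) as [N HN].
  { rewrite Rabs_pos_eq; lra. }
  { apply Rdiv_lt_0_compat; auto. }
  exists (Nat.max n N). split; [lia|]. set (J := Nat.max n N).
  specialize (HN (S J) ltac:(lia)). rewrite Rabs_pos_eq in HN by (apply pow_le; lra).
  apply Rle_lt_trans with (B * r ^ S J).
  - pose proof (pos_INR (S J)). specialize (Hp (INR (S J) + 1) ltac:(lra)).
    unfold B, r. rewrite <- Rpower_2_mult_INR.
    apply Rle_trans with (K * (Rpower 2 (- x * INR (S J)) * (D * Rpower 2 (x / 2 * (INR (S J) + 1))))).
    + apply Rmult_le_compat_l; [lra|]. apply Rmult_le_compat_l; [left; apply Rpower_pos|exact Hp].
    + right. transitivity (K * D * (Rpower 2 (- x * INR (S J)) * Rpower 2 (x / 2 * (INR (S J) + 1)))); [ring|].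
      rewrite <- Rpower_plus.
      replace (- x * INR (S J) + x / 2 * (INR (S J) + 1)) with (x / 2 + - (x / 2) * INR (S J)) by field.
      rewrite Rpower_plus. ring.
  - apply Rmult_lt_reg_r with (/ B); [apply Rinv_0_lt_compat, HB|].
    replace (B * r ^ S J * / B) with (r ^ S J) by (field; lra). exact HN.
Qed.

(** Replacing [2 ^ n] by [2 ^ w / (K * w ^ e)] under the power [- x] produces [w ^ (x * e)]. This is
    the origin of the summand [x * INR e] in the exponent of the logarithm. *)
Lemma main_term e x g g' K c : 0 < x -> x * INR e + g <= g' -> 0 < K -> 0 < c ->
  exists C0, 0 < C0 /\ forall w n : nat, (1 <= w)%nat -> (n <= w)%nat ->
    2 ^ w <= K * INR w ^ e * 2 ^ n -> c * INR w <= INR n + 1 ->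
    Rpower 2 (- x * INR n) * Rpower (INR n + 1) g * Rpower 2 (- (1 / 2) * INR w)
    <= C0 * target (x + 1 / 2) g' (INR w).
Proof.
  intros Hx Hg HK Hc. set (K' := Rmax 2 (/ c)).
  assert (HK' : 2 <= K' /\ / c <= K') by (split; [apply Rmax_l|apply Rmax_r]).
  exists (Rpower K x * Rpower K' (Rabs g)).
  split; [apply Rmult_lt_0_compat; apply Rpower_pos|].
  intros w n Hw Hn H2 Hcw. assert (HwR : 1 <= INR w) by (apply (le_INR 1), Hw).
  apply le_INR in Hn. pose proof (pos_INR n) as Hn0.
  assert (H1 : Rpower 2 (- x * INR n) <= Rpower K x * Rpower (INR w) (x * INR e) * Rpower 2 (- x * INR w)).
  { assert (Hwe : 0 < INR w ^ e) by (apply pow_lt; lra).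
    assert (Hr : Rpower (2 ^ w) x <= Rpower (K * INR w ^ e * 2 ^ n) x).
    { apply Rle_Rpower_l; [lra|]. split; [apply pow_lt; lra|exact H2]. }
    assert (H2n : 0 < 2 ^ n) by (apply pow_lt; lra).
    rewrite <- !Rpower_mult_distr in Hr by (auto; apply Rmult_lt_0_compat; auto).
    rewrite <- !Rpower_pow, !Rpower_mult in Hr by lra.
    replace (INR e * x) with (x * INR e) in Hr by ring.
    replace (- x * INR n) with (- (INR n * x)) by ring.
    replace (- x * INR w) with (- (INR w * x)) by ring.
    rewrite !Rpower_Ropp.
    pose proof (Rpower_pos 2 (INR n * x)). pose proof (Rpower_pos 2 (INR w * x)).
    apply Rmult_le_reg_r with (Rpower 2 (INR n * x) * Rpower 2 (INR w * x)); [nra|].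
    field_simplify; lra. }
  assert (H3 : Rpower (INR n + 1) g <= Rpower K' (Rabs g) * Rpower (INR w) g).
  { apply Rpower_ratio; try lra.
    - nra.
    - apply Rle_trans with (/ c * (INR n + 1)).
      + apply Rmult_le_reg_l with c; [lra|]. rewrite <- Rmult_assoc, Rinv_r by lra. lra.
      + apply Rmult_le_compat_r; lra. }
  assert (H4 : Rpower (INR w) (x * INR e) * Rpower (INR w) g <= Rpower (INR w) g').
  { rewrite <- Rpower_plus. apply Rle_Rpower; lra. }
  unfold target. replace (- (x + 1 / 2) * INR w) with (- x * INR w + - (1 / 2) * INR w) by ring.
  rewrite Rpower_plus.
  set (P1 := Rpower 2 (- x * INR w)) in *. set (P2 := Rpower 2 (- (1 / 2) * INR w)).
  assert (0 < P1) by apply Rpower_pos. assert (0 < P2) by apply Rpower_pos.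
  pose proof (Rpower_pos K x) as Q1. pose proof (Rpower_pos K' (Rabs g)) as Q2.
  apply Rle_trans with ((Rpower K x * Rpower (INR w) (x * INR e) * P1)
                        * (Rpower K' (Rabs g) * Rpower (INR w) g) * P2).
  - apply Rmult_le_compat_r; [lra|]. apply Rmult_le_compat; auto; left; apply Rpower_pos.
  - replace (Rpower K x * Rpower (INR w) (x * INR e) * P1 * (Rpower K' (Rabs g) * Rpower (INR w) g) * P2)
      with ((Rpower K x * Rpower K' (Rabs g) * (P1 * P2))
            * (Rpower (INR w) (x * INR e) * Rpower (INR w) g)) by ring.
    replace (Rpower K x * Rpower K' (Rabs g) * (P1 * P2 * Rpower (INR w) g'))
      with ((Rpower K x * Rpower K' (Rabs g) * (P1 * P2)) * Rpower (INR w) g') by ring.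
    apply Rmult_le_compat_l; [|exact H4].
    left. repeat apply Rmult_lt_0_compat; auto.
Qed.

(** The strict inequality [y < x * INR q] leaves an exponential surplus that absorbs every power of
    [w], so [g'] is arbitrary. *)
Lemma tail_term x g y g' (q : nat) : 0 < x -> (1 <= q)%nat -> y < x * INR q -> exists C0, 0 < C0 /\
  forall w : nat, (1 <= w)%nat ->
    Rpower 2 (- x * INR (S (q * w))) * Rpower (INR (S (q * w)) + 1) g <= C0 * target y g' (INR w).
Proof.
  intros Hx Hq1 Hq. apply (le_INR 1) in Hq1. simpl (INR 1) in Hq1.
  destruct (target_absorb (x * INR q - y) y g g' ltac:(lra)) as (K & HK & H).
  pose proof (pos_INR q) as Hq0.
  exists (Rpower (INR q + 2) (Rabs g) * K).
  split; [apply Rmult_lt_0_compat; [apply Rpower_pos|auto]|].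
  intros w Hw. assert (HwR : 1 <= INR w) by (apply (le_INR 1), Hw).
  specialize (H (INR w) HwR). replace (y + (x * INR q - y)) with (x * INR q) in H by ring.
  rewrite S_INR, mult_INR.
  assert (H1 : Rpower (INR q * INR w + 1 + 1) g <= Rpower (INR q + 2) (Rabs g) * Rpower (INR w) g).
  { apply Rpower_ratio; nra. }
  assert (H2 : Rpower 2 (- x * (INR q * INR w + 1)) <= Rpower 2 (- (x * INR q) * INR w)).
  { apply Rle_Rpower; nra. }
  unfold target in H at 1.
  apply Rle_trans with (Rpower 2 (- (x * INR q) * INR w) * (Rpower (INR q + 2) (Rabs g) * Rpower (INR w) g)).
  - apply Rmult_le_compat; auto; left; apply Rpower_pos.
  - pose proof (Rpower_pos (INR q + 2) (Rabs g)). nra.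
Qed.

Lemma target_le_rate y g : exists C0, 0 < C0 /\ forall v w : nat, (2 <= v)%nat ->
  2 ^ w / 2 <= INR v <= 2 ^ w -> 0 <= y ->
  target y g (INR w) <= C0 * (Rpower (INR v) (- y) * Rpower (ln (INR v)) g).
Proof.
  exists (Rpower 4 (Rabs g)). split; [apply Rpower_pos|]. intros v w Hv Hw Hy.
  assert (HvR : 2 <= INR v) by (apply (le_INR 2) in Hv; simpl in Hv; lra).
  assert (Hl2 : 1 / 2 < ln 2) by (pose proof ln_lt_2; lra).
  assert (Hl2' : ln 2 <= 1).
  { rewrite <- (ln_exp 1). apply ln_le; [lra|apply exp_1_ge_2]. }
  assert (H2w : 0 < 2 ^ w) by (apply pow_lt; lra).
  assert (Hln1 : ln (INR v) <= INR w * ln 2) by (rewrite <- ln_pow by lra; apply ln_le; lra).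
  assert (Hln2 : ln 2 <= ln (INR v)) by (apply ln_le; lra).
  assert (Hln3 : INR w * ln 2 <= ln (INR v) + ln 2).
  { rewrite <- ln_pow, <- ln_mult by lra. apply ln_le; lra. }
  assert (Hw1 : INR w <= 4 * ln (INR v)) by (pose proof (pos_INR w); nra).
  assert (HwR : 0 < INR w).
  { destruct w; [simpl in *; lra|]. apply lt_0_INR. lia. }
  unfold target.
  assert (H1 : Rpower 2 (- y * INR w) <= Rpower (INR v) (- y)).
  { replace (- y * INR w) with (INR w * - y) by ring.
    rewrite <- Rpower_mult, Rpower_pow by lra. rewrite !Rpower_Ropp.
    apply Rinv_le_contravar; [apply Rpower_pos|]. apply Rle_Rpower_l; lra. }
  assert (H2 : Rpower (INR w) g <= Rpower 4 (Rabs g) * Rpower (ln (INR v)) g).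
  { apply Rpower_ratio; nra. }
  replace (Rpower 4 (Rabs g) * (Rpower (INR v) (- y) * Rpower (ln (INR v)) g))
    with (Rpower (INR v) (- y) * (Rpower 4 (Rabs g) * Rpower (ln (INR v)) g)) by ring.
  apply Rmult_le_compat; auto; left; apply Rpower_pos.
Qed.

Lemma sqrt_Rpower_prod x s t g :
  sqrt (Rpower 2 (- x * s) * Rpower t g) = Rpower 2 (- (x / 2) * s) * Rpower t (g / 2).
Proof.
  rewrite <- Rpower_sqrt by (apply Rmult_lt_0_compat; apply Rpower_pos).
  rewrite <- Rpower_mult_distr, !Rpower_mult by apply Rpower_pos.
  f_equal; f_equal; field.
Qed.

Lemma sqrt_plus_le a b : 0 <= a -> 0 <= b -> sqrt (a + b) <= sqrt a + sqrt b.
Proof.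
  intros Ha Hb. pose proof (sqrt_pos a). pose proof (sqrt_pos b).
  rewrite <- (sqrt_pow2 (sqrt a + sqrt b)) by lra. apply sqrt_le_1_alt.
  rewrite <- (pow2_sqrt a) at 1 by auto. rewrite <- (pow2_sqrt b) at 1 by auto. nra.
Qed.

(** From [2 ^ w <= 2 v] with [w = S (Nat.log2 v)] follows [2 ^ (3 w + 2) <= 2 ^ 5 * v ^ 3 <= v ^ 8]
    per coordinate, as [v >= 2]. *)
Lemma card_gamma_log2 e v : (2 <= v)%nat ->
  card_gamma_le (S e) (2 ^ (3 * S (Nat.log2 v))) (Rpower (INR v) (8 * INR (S e))).
Proof.
  intros Hv. set (w := S (Nat.log2 v)).
  exists (gamma_list (S e) (3 * w)). split; [apply NoDup_gamma_list|]. split; [apply in_gamma_list|].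
  assert (HvR : 0 < INR v) by (apply lt_0_INR; lia).
  replace (8 * INR (S e)) with (INR (8 * S e)) by (rewrite mult_INR; simpl (INR 8); ring).
  rewrite Rpower_pow, <- pow_INR by exact HvR. apply le_INR.
  eapply Nat.le_trans; [apply length_gamma_list_le|].
  rewrite !Nat.pow_mul_r. apply Nat.pow_le_mono_l.
  destruct (Nat.log2_spec v ltac:(lia)) as [H1 _].
  assert (H2 : (2 ^ w <= 2 * v)%nat) by (unfold w; rewrite Nat.pow_succ_r'; lia).
  rewrite Nat.pow_add_r, Nat.mul_comm, (Nat.mul_comm 3), Nat.pow_mul_r.
  apply Nat.le_trans with (2 ^ 2 * (2 * v) ^ 3)%nat.
  - apply Nat.mul_le_mono_l, Nat.pow_le_mono_l, H2.
  - rewrite Nat.pow_mul_l. replace (2 ^ 2 * (2 ^ 3 * v ^ 3))%nat with (2 ^ 5 * v ^ 3)%nat by (simpl; lia).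
    replace (v ^ 8)%nat with (v ^ 5 * v ^ 3)%nat by (rewrite <- Nat.pow_add_r; reflexivity).
    apply Nat.mul_le_mono_r, Nat.pow_le_mono_l, Hv.
Qed.

Lemma log2_bounds v : (2 <= v)%nat -> let w := S (Nat.log2 v) in
  2 ^ w / 2 <= INR v <= 2 ^ w /\ INR w <= 2 * ln (2 * INR v) /\
  1 / sqrt (INR v) <= 2 * Rpower 2 (- (1 / 2) * INR w).
Proof.
  intros Hv w. destruct (Nat.log2_spec v ltac:(lia)) as [H1 H2]. fold w in H2.
  assert (Hw : 2 ^ w / 2 <= INR v <= 2 ^ w).
  { apply le_INR in H1. apply lt_INR in H2. rewrite pow_INR in H1, H2.
    replace (INR 2) with 2 in * by (simpl; ring). unfold w in *. simpl pow in *. lra. }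
  assert (H2w : 0 < 2 ^ w) by (apply pow_lt; lra).
  split; [exact Hw|]. split.
  - assert (Hl : INR w * ln 2 <= ln (2 * INR v)) by (rewrite <- ln_pow by lra; apply ln_le; lra).
    pose proof ln_lt_2. pose proof (pos_INR w). nra.
  - replace (- (1 / 2) * INR w) with (- (INR w * / 2)) by field. rewrite Rpower_Ropp.
    rewrite <- Rpower_mult, Rpower_pow, Rpower_sqrt by lra.
    assert (Hs : 0 < sqrt (2 ^ w)) by (apply sqrt_lt_R0, H2w).
    assert (Hs2 : sqrt (2 ^ w) / 2 <= sqrt (INR v)).
    { replace (sqrt (2 ^ w) / 2) with (sqrt (2 ^ w / 4)).
      - apply sqrt_le_1_alt. lra.
      - rewrite sqrt_div_alt by lra. f_equal. replace 4 with (2 ^ 2) by ring. apply sqrt_pow2. lra. }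
    assert (Hsv : 0 < sqrt (INR v)) by lra.
    apply Rmult_le_reg_r with (sqrt (INR v) * sqrt (2 ^ w)); [nra|]. field_simplify; lra.
Qed.

Theorem theorem5p2 :
  forall d : nat, (1 <= d)%nat ->
  exists c0 : R, 0 < c0 /\
  forall p a : R, 1 < p <= 2 -> a > 1 / p ->
  exists c : R, 0 < c /\
  forall b : R,
  exists C : R, 0 < C /\
  forall v : nat, (2 <= v)%nat ->
  exists M : R,
    card_gamma_le d M (Rpower (INR v) c0) /\
    forall m : nat, c * INR v * (ln (2 * INR v)) ^ 4 <= INR m ->
      varrho_ls_le d m v M p a b
        (C * Rpower (INR v) (- a + 1 / p - 1 / 2)
           * Rpower (ln (INR v)) ((INR d - 1) * (a + b + 1 - 2 / p) + 1 / 2)).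
Proof.
  intros d Hd. destruct d as [|e]; [lia|].
  exists (8 * INR (S e)). split; [apply Rmult_lt_0_compat; [lra|apply lt_0_INR; lia]|].
  intros p a Hp Ha. set (x := a - 1 / p).
  assert (Hx : 0 < x) by (unfold x; lra).
  assert (Hip : 1 / 2 <= 1 / p < 1).
  { split.
    - apply Rmult_le_compat_l; [lra|]. apply Rinv_le_contravar; lra.
    - apply Rmult_lt_reg_r with p; [lra|]. field_simplify; lra. }
  (* The summand [q0] of [q] makes the levels beyond [q * w] negligible in the sup norm, and [e + 4]
     ensures [3 * w + S e <= q * w]. As [q] depends on [a], [p] and [d], so does [c]. *)
  destruct (INR_unbounded ((x + 1 / 2) / x)) as [q0 Hq0].
  set (q := (q0 + e + 4)%nat).
  assert (Hq : x + 1 / 2 < x * INR q).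
  { assert (Hqq : INR q0 <= INR q) by (apply le_INR; unfold q; lia).
    apply Rle_lt_trans with (x * ((x + 1 / 2) / x)); [right; field; lra|].
    apply Rmult_lt_compat_l; lra. }
  set (A := INR (q * S e + S e + 3)).
  assert (HA : 0 < A) by (apply lt_0_INR; lia).
  set (c := 216 * kappa * (2 * A) ^ 4).
  exists c. split.
  { unfold c, kappa. apply Rmult_lt_0_compat; [lra|]. apply pow_lt. lra. }
  intros b.
  destruct (inW_coeffs e p a b Hp) as (K1 & HK1 & Hcoef).
  set (g := INR e * b) in *. set (be := INR (S e) * (1 - 1 / p) + g) in *.
  set (E := (INR (S e) - 1) * (a + b + 1 - 2 / p) + 1 / 2).
  destruct (tail_sum x be Hx) as (Ka & HKa & Hta).
  destruct (tail_sum (x + a) (be + g)) as (Kb & HKb & Htb); [lra|].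
  destruct (choose_level e) as (Kc & cc & HKc & Hcc & Hlev).
  (* The left side equals [INR e * (a + b + 1 - 2 / p) + (1 - 1 / p)], and [p <= 2] gives
     [1 - 1 / p <= 1 / 2]. *)
  assert (HE : x * INR e + be <= E).
  { unfold be, E, x, g. rewrite S_INR.
    replace (2 / p) with (2 * (1 / p)) by (field; lra). set (ip := 1 / p) in *.
    apply Rle_trans with (INR e * (a + b + 1 - 2 * ip) + (1 - ip)); [right; ring|].
    replace (INR e + 1 - 1) with (INR e) by ring. lra. }
  destruct (main_term e x be E Kc cc Hx HE HKc Hcc) as (C1 & HC1 & Hmain).
  (* The factor 3 suffices for every positive [x]: since [a = x + 1 / p] and [1 / p >= 1 / 2], one
     has [3 * (x + a) / 2 >= 3 * x + 3 / 4 > x + 1 / 2]. Hence [c0] does not depend on [a] or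
     [p]. *)
  destruct (tail_term ((x + a) / 2) ((be + g) / 2) (x + 1 / 2) E 3) as (C2 & HC2 & Htail2);
    [lra|lia|simpl; unfold x in *; lra|].
  destruct (tail_term x be (x + 1 / 2) E q) as (C3 & HC3 & Htail3); [lra|unfold q; lia|exact Hq|].
  destruct (target_le_rate (x + 1 / 2) E) as (C4 & HC4 & Hrate).
  (* [N1 / sqrt v] enters twice through the l2 norm and once through the l1 norm, each time bounded
     by [2 * (K1 * Ka) * C1] times the target. *)
  set (B1 := 6 * (K1 * Ka) * C1). set (B2 := sqrt (K1 * K1 * Kb) * C2). set (B3 := 2 * (K1 * Ka) * C3).
  assert (HKK : 0 < K1 * Ka) by nra.
  assert (HB1 : 0 < B1) by (unfold B1; nra).
  assert (HB2 : 0 <= B2) by (unfold B2; pose proof (sqrt_pos (K1 * K1 * Kb)); nra).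
  assert (HB3 : 0 < B3) by (unfold B3; nra).
  exists (18 * (B1 + B2 + B3) * C4). split; [nra|].
  intros v Hv. set (w := S (Nat.log2 v)).
  exists (2 ^ (3 * w)). split; [apply card_gamma_log2, Hv|].
  intros m Hm eps Heps.
  destruct (log2_bounds v Hv) as (Hvw & Hlnw & Hsqv). fold w in Hvw, Hlnw, Hsqv.
  assert (Hw1 : (1 <= w)%nat) by (unfold w; lia).
  assert (HvR : 2 <= INR v) by (apply (le_INR 2) in Hv; simpl in Hv; lra).
  destruct (good_points (S e) (q * w) v m) as (xi & Hxi & Hxil & Hrip); [lia| |].
  { eapply Rle_trans; [|exact Hm]. unfold c.
    assert (HAw : INR ((q * w + 1) * S e + 3) <= A * (2 * ln (2 * INR v))).
    { apply Rle_trans with (A * INR w); [|apply Rmult_le_compat_l; lra].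
      unfold A. rewrite <- mult_INR. apply le_INR. nia. }
    apply Rle_trans with (216 * kappa * INR v * (A * (2 * ln (2 * INR v))) ^ 4).
    - apply Rmult_le_compat_l; [unfold kappa; lra|]. apply pow_incr. split; [apply pos_INR|exact HAw].
    - right. ring. }
  exists xi. split; [exact Hxi|]. intros f Hf.
  destruct (Hcoef f Hf) as [HcA HcB]. set (cf := fhat (S e) f) in *.
  destruct (Hlev w Hw1) as (n & Hnw & Hnlow & Hn2 & Hncc).
  set (tau := fun J => K1 * Ka * (Rpower 2 (- x * INR (S J)) * Rpower (INR (S J) + 1) be)).
  assert (Hsum : forall s i, Rsum (seq s i) (fun j => Rsum (layer (S e) j) (fun k => Cmod (cf k)))
      <= K1 * Ka * (Rpower 2 (- x * INR s) * Rpower (INR s + 1) be)).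
  { intros s i. eapply Rle_trans; [apply Rsum_le; intros j _; apply HcA|].
    rewrite Rsum_scal, Rmult_assoc. apply Rmult_le_compat_l; [lra|apply Hta]. }
  assert (Hinv : forall y, length y = S e -> in_box y ->
     Cmod (f y - trigpoly (layers (S e) 0 (S (q * w))) cf y) <= 2 * tau (q * w)%nat).
  { apply (fourier_inversion (S e) f (fun j => Rsum (layer (S e) j) (fun k => Cmod (cf k))) tau).
    - eapply inW_ccont, Hf.
    - intros j. apply Rle_refl.
    - intros J i. apply Hsum.
    - intros eps0 n0 He0. apply tail_vanish; auto. }
  assert (Hqw : (3 * w + S e <= q * w)%nat) by (unfold q; nia).
  destruct (select_frequencies e v n (3 * w) (q * w) cf) as (F & T & HF & HFs & HdT & HiT & HP & HN1 & HN2).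
  { lia. }
  { apply Nat.le_trans with (2 ^ w)%nat; [|apply Nat.pow_le_mono_r; lia].
    unfold w. destruct (Nat.log2_spec v ltac:(lia)). lia. }
  { lia. }
  { exact Hqw. }
  (* The low layers number at most [2 ^ w / 4], and [2 ^ w / 2 <= v]. *)
  { destruct Hnlow as [->|Hnlow]; [simpl; lia|]. apply INR_le. rewrite mult_INR.
    replace (INR 2) with 2 by (simpl; ring).
    pose proof (length_layers_low e n) as Hlow. lra. }
  exists F. split; [exact HF|].
  set (N1 := Rsum (layers (S e) n (S (q * w) - n)) (fun k => Cmod (cf k))) in *.
  assert (Htau0 : 0 <= 2 * tau (q * w)%nat).
  { unfold tau. pose proof (Rpower_pos 2 (- x * INR (S (q * w)))).
    pose proof (Rpower_pos (INR (S (q * w)) + 1) be).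
    apply Rmult_le_pos; [lra|]. apply Rmult_le_pos; [lra|]. nra. }
  eapply Rle_trans.
  { apply (ls_error (S e) (q * w) v xi m f F T cf (2 * tau (q * w)%nat)); auto; try lia.
    - eapply inW_ccont, Hf.
    - intros y Hy Hb. rewrite <- trigpoly_app.
      replace (trigpoly (F ++ T) cf y) with (trigpoly (layers (S e) 0 (S (q * w))) cf y)
        by (apply Csum_perm, HP).
      apply Hinv; auto. }
  assert (HN1le : N1 <= K1 * Ka * (Rpower 2 (- x * INR n) * Rpower (INR n + 1) be)).
  { unfold N1. rewrite Rsum_layers. apply Hsum. }
  assert (HN1pos : 0 <= N1) by (apply Rsum_ge0; intros; apply Cmod_ge_0).
  assert (Hsv : 0 < sqrt (INR v)) by (apply sqrt_lt_R0; lra).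
  set (Tg := target (x + 1 / 2) E (INR w)).
  assert (HTg : 0 < Tg) by apply target_pos.
  assert (HNv : N1 / sqrt (INR v) <= 2 * (K1 * Ka) * C1 * Tg).
  { specialize (Hmain w n Hw1 Hnw Hn2 Hncc). fold Tg in Hmain.
    apply Rle_trans with (K1 * Ka * (Rpower 2 (- x * INR n) * Rpower (INR n + 1) be)
                          * (2 * Rpower 2 (- (1 / 2) * INR w))).
    - unfold Rdiv. apply Rmult_le_compat; auto; [left; apply Rinv_0_lt_compat, Hsv|].
      unfold Rdiv in Hsqv. rewrite Rmult_1_l in Hsqv. exact Hsqv.
    - apply Rle_trans with (2 * (K1 * Ka) * (Rpower 2 (- x * INR n) * Rpower (INR n + 1) be
          * Rpower 2 (- (1 / 2) * INR w))); [right; ring|].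
      rewrite (Rmult_assoc (2 * (K1 * Ka)) C1). apply Rmult_le_compat_l; [lra|exact Hmain]. }
  set (L2 := Rsum (layers (S e) (S (3 * w)) (q * w - 3 * w)) (fun k => Cmod (cf k) ^ 2)) in *.
  assert (HL20 : 0 <= L2) by (apply Rsum_ge0; intros; apply pow2_ge_0).
  (* In each layer the sum of squares is at most the largest coefficient times the l1 norm, so the
     decay rates [a] and [x] add; the square root halves the sum. *)
  assert (HL2 : sqrt L2 <= B2 * Tg).
  { apply Rle_trans with (sqrt (K1 * K1 * Kb * (Rpower 2 (- (x + a) * INR (S (3 * w)))
                                  * Rpower (INR (S (3 * w)) + 1) (be + g)))).
    - apply sqrt_le_1_alt. unfold L2. rewrite Rsum_layers.
      apply Rle_trans with (Rsum (seq (S (3 * w)) (q * w - 3 * w)) (fun j => K1 * K1 *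
          (Rpower 2 (- (x + a) * INR j) * Rpower (INR j + 1) (be + g)))).
      + apply Rsum_le. intros j _.
        set (u1 := K1 * (Rpower 2 (- a * INR j) * Rpower (INR j + 1) g)).
        apply Rle_trans with (Rsum (layer (S e) j) (fun k => u1 * Cmod (cf k))).
        * apply Rsum_le. intros k Hk. simpl. rewrite Rmult_1_r.
          apply Rmult_le_compat_r; [apply Cmod_ge_0|]. apply HcB, Hk.
        * rewrite Rsum_scal. eapply Rle_trans; [apply Rmult_le_compat_l; [|apply HcA]|].
          -- unfold u1. apply Rmult_le_pos; [lra|]. left. apply Rmult_lt_0_compat; apply Rpower_pos.
          -- right. unfold u1. fold x. cbv beta zeta. fold g. fold be.
             replace (- (x + a) * INR j) with (- a * INR j + - x * INR j) by ring.
             rewrite !Rpower_plus. ring.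
      + rewrite Rsum_scal, (Rmult_assoc (K1 * K1) Kb). apply Rmult_le_compat_l; [nra|apply Htb].
    - rewrite sqrt_mult_alt by (apply Rmult_le_pos; nra). rewrite sqrt_Rpower_prod.
      unfold B2. rewrite (Rmult_assoc (sqrt _)). apply Rmult_le_compat_l; [apply sqrt_pos|].
      apply Htail2, Hw1. }
  assert (HT2 : sqrt (Rsum T (fun k => Cmod (cf k) ^ 2)) <= 2 * (N1 / sqrt (INR v)) + sqrt L2).
  { eapply Rle_trans; [apply sqrt_le_1_alt, HN2|].
    eapply Rle_trans; [apply sqrt_plus_le; auto|].
    - apply Rmult_le_pos; [apply Rdiv_le_0_compat; lra|apply pow2_ge_0].
    - apply Rplus_le_compat_r.
      rewrite <- (sqrt_pow2 (2 * (N1 / sqrt (INR v)))).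
      + apply sqrt_le_1_alt. apply Rle_trans with (4 * (N1 ^ 2 / (sqrt (INR v)) ^ 2)).
        * rewrite pow2_sqrt by lra. apply Rmult_le_reg_r with (INR v); [lra|]. field_simplify; [|lra|lra].
          pose proof (pow2_ge_0 N1). lra.
        * right. field. lra.
      + apply Rmult_le_pos; [lra|]. apply Rdiv_le_0_compat; lra. }
  assert (HT1 : Rsum T (fun k => Cmod (cf k)) / sqrt (INR v) <= N1 / sqrt (INR v)).
  { apply Rmult_le_compat_r; [left; apply Rinv_0_lt_compat, Hsv|exact HN1]. }
  assert (HT3 : 2 * tau (q * w)%nat <= B3 * Tg).
  { unfold tau, B3. specialize (Htail3 w Hw1). fold Tg in Htail3.
    apply Rle_trans with (2 * (K1 * Ka) * (C3 * Tg)); [|right; ring].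
    rewrite <- (Rmult_assoc 2). apply Rmult_le_compat_l; [lra|exact Htail3]. }
  specialize (Hrate v w Hv Hvw ltac:(lra)). fold Tg in Hrate.
  replace (- (x + 1 / 2)) with (- a + 1 / p - 1 / 2) in Hrate by (unfold x; ring).
  set (RR := Rpower (INR v) (- a + 1 / p - 1 / 2) * Rpower (ln (INR v)) E) in *.
  apply Rle_trans with (18 * ((B1 + B2 + B3) * Tg)).
  - apply Rmult_le_compat_l; [lra|]. unfold B1. nra.
  - apply Rle_trans with (18 * (B1 + B2 + B3) * (C4 * RR)).
    + rewrite <- Rmult_assoc. apply Rmult_le_compat_l; [lra|exact Hrate].
    + replace (18 * (B1 + B2 + B3) * C4 * Rpower (INR v) (- a + 1 / p - 1 / 2) * Rpower (ln (INR v)) E)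
        with (18 * (B1 + B2 + B3) * (C4 * RR)) by (unfold RR; ring). lra.
Qed.
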